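(* Let $3_1$ and $10_6$ be the knots of those names in the standard (Rolfsen) knot table, with mirror images chosen so that the connected sum $K_3=3_1\#10_6$ has signature satisfying $|\sigma(K_3)|=2$. Then $u(3_1)=1$, $u(10_6)\in\{2,3\}$, and $u(3_1\#10_6)\le 3$.
   Context: Knots are smooth (tame) knots in $S^3$ up to isotopy. The unknotting number $u(K)$ of a knot $K$ is the minimum number of crossing changes, interspersed with isotopy, required to transform a diagram of $K$ into a diagram of the unknot. $K_1\#K_2$ denotes the connected sum, and $\sigma$ denotes the (Murasugi/Trotter) knot signature, which is additive under connected sum and changes sign under mirror image. Knot names are from the standard Rolfsen table: $3_1$ is the trefoil, i.e. the $(2,3)$ torus knot (up to mirror image), with signature $\pm2$; $10_6$ is, up to mirror image, the 2-bridge knot with fraction $37/7=5+\cfrac{1}{3+\cfrac12}$ (Conway notation $5\,3\,2$), with signature $\pm4$. The signs depend on the choice of mirror image, so the condition $|\sigma(K_3)|=2$ says that the mirror images are chosen so that the two signatures have opposite signs. *)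

(* Defs.v *)
From HB Require Import structures.
From Stdlib Require Import Relations.
From mathcomp Require Import all_boot all_order all_algebra.

Set Implicit Arguments.
Unset Strict Implicit.
Unset Printing Implicit Defensive.

Import Order.TTheory GRing.Theory Num.Theory.

(* Unoriented knot diagrams on the sphere S^2, as planar-diagram codes: a     *)
(* list of vertices, each given by the labels of the edges met in             *)
(* counterclockwise order. A vertex with four edges is a crossing; one with   *)
(* two edges is a mere marked point of an arc, needed to write the diagram    *)
(* without crossings and to state the Reidemeister moves locally.             *)
Definition diagram := seq (seq nat).

(* The under-strand joins a and c, the over-strand joins b and d.             *)
Definition X (a b c d : nat) : seq nat := [:: a; b; c; d].
Definition P (a b : nat) : seq nat := [:: a; b].

(* A half-edge is a position in the list flatten D of all edge labels.        *)
Section HalfEdges.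
Variable D : diagram.

Definition nhalf : nat := size (flatten D).

Definition label (k : nat) : nat := nth 0 (flatten D) k.

Definition valence (k : nat) : nat :=
  nth 0 (shape D) (reshape_index (shape D) k).

(* The half-edge j steps counterclockwise from k around the vertex of k.      *)
Definition turn (j k : nat) : nat :=
  flatten_index (shape D) (reshape_index (shape D) k)
    ((reshape_offset (shape D) k + j) %% valence k).

(* The other position at which the label of k occurs.                         *)
Definition mate (k : nat) : nat :=
  let i := index (label k) (flatten D) in
  if i < k then i else k.+1 + index (label k) (drop k.+1 (flatten D)).

(* Leave a vertex along k, go straight through the next vertex.               *)
Definition strand_next (k : nat) : nat :=
  let q := mate k in turn (valence q)./2 q.

(* The half-edge k also names the corner between k and turn 1 k, which is on  *)
(* the left of k seen from its vertex; this is the next corner of its face.   *)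
Definition face_next (k : nat) : nat :=
  let q := mate k in turn (valence q).-1 q.

(* The least element of the orbit of k under a permutation f of the           *)
(* half-edges, and the list of these representatives.                         *)
Definition orbit_rep (f : nat -> nat) (k : nat) : nat :=
  foldr minn k (traject f k nhalf).

Definition orbit_reps (f : nat -> nat) : seq nat :=
  [seq k <- iota 0 nhalf | orbit_rep f k == k].

Definition faces : seq nat := orbit_reps face_next.

(* The last two conditions: there is one component (which is one strand       *)
(* orbit for each of its two directions), and V - E + F = 2.                  *)
Definition is_knot_diagram : bool :=
  [&& all (fun v => (size v == 2) || (size v == 4)) D,
      all (fun e => count_mem e (flatten D) == 2) (flatten D),
      size (orbit_reps strand_next) == 2
    & size D + size faces == nhalf./2 + 2].

End HalfEdges.

(* The generators other than R1, R2, R3 only change the coding of a diagram.  *)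
Inductive move : diagram -> diagram -> Prop :=
| move_perm D D' : perm_eq D D' -> move D D'
| move_relabel (f : nat -> nat) D :
    {in flatten D &, injective f} -> move D (map (map f) D)
| move_rotX a b c d C : move (X a b c d :: C) (X c d a b :: C)
| move_rotP a b C : move (P a b :: C) (P b a :: C)
| move_erase a b C : a != b ->
    move (P a b :: C) (map (map (fun x => if x == b then a else x)) C)
| move_R1l e a b C : move (X e e a b :: C) (P a b :: C)
| move_R1r e a b C : move (X a e e b :: C) (P a b :: C)
(* the over-strand a-e-b and the under-strand c-f-d bound a bigon e, f        *)
| move_R2 a b c d e f C :
    move [:: X c e f a, X f e d b & C] [:: P a b, P c d & C]
(* the strand t1-t2-t3 lies over the strands m1-m2-m3 and u1-u2-u3, and       *)
(* slides across their crossing, at which m is over u in the first rule and   *)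
(* u is over m in the second                                                  *)
| move_R3l t1 t2 t3 m1 m2 m3 u1 u2 u3 C :
    move [:: X m1 t2 m2 t1, X u1 t3 u2 t2, X u2 m3 u3 m2 & C]
         [:: X m2 t3 m3 t2, X u2 t2 u3 t1, X u1 m2 u2 m1 & C]
| move_R3r t1 t2 t3 m1 m2 m3 u1 u2 u3 C :
    move [:: X m1 t2 m2 t1, X u1 t3 u2 t2, X m2 u2 m3 u3 & C]
         [:: X m2 t3 m3 t2, X u2 t2 u3 t1, X m1 u1 m2 u2 & C].

(* Asking both sides to be planar makes the creation of a bigon by R2         *)
(* legitimate exactly when the two arcs are suitably placed along a face.     *)
Definition knot_move (D D' : diagram) : Prop :=
  [/\ is_knot_diagram D, is_knot_diagram D' & move D D'].

(* Isotopy of tame knots in S^3, read on diagrams (Reidemeister).             *)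
Definition isotopic : diagram -> diagram -> Prop :=
  clos_refl_sym_trans diagram knot_move.

Definition unknot : diagram := [:: P 0 0].

Inductive crossing_change : diagram -> diagram -> Prop :=
| crossing_change_at a b c d C :
    crossing_change (X a b c d :: C) (X b c d a :: C).

Inductive unknots_in : diagram -> nat -> Prop :=
| unknots_in0 D : isotopic D unknot -> unknots_in D 0
| unknots_inS D D1 D2 n : isotopic D D1 -> crossing_change D1 D2 ->
    unknots_in D2 n -> unknots_in D n.+1.

Definition unknotting_number (D : diagram) (n : nat) : Prop :=
  unknots_in D n /\ forall m, unknots_in D m -> n <= m.

Definition mirror (D : diagram) : diagram :=
  [seq if size v == 4 then rot 1 v else v | v <- D].

(* Cut D1 at the edge of the half-edge h1 and D2 (with its labels made        *)
(* disjoint from those of D1) at the edge of h2, and join h1 to the mate of   *)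
(* h2 and the mate of h1 to h2: this exchanges the labels of h1 and h2.       *)
(* Taking all h1, h2 gives both ways to match the four ends, that is, both    *)
(* relative orientations of the summands.                                     *)
Definition csum (D1 : diagram) (h1 : nat) (D2 : diagram) (h2 : nat) : diagram :=
  let n := (foldr maxn 0 (flatten D1)).+1 in
  let D := D1 ++ map (map (addn n)) D2 in
  let k2 := nhalf D1 + h2 in
  reshape (shape D)
    (set_nth 0 (set_nth 0 (flatten D) h1 (label D k2)) k2 (label D h1)).

Definition connected_sum (D1 D2 D3 : diagram) : Prop :=
  exists h1 h2, [/\ h1 < nhalf D1, h2 < nhalf D2 & D3 = csum D1 h1 D2 h2].

Local Open Scope ring_scope.

Section Seifert.
Variable D : diagram.

(* The orientation of the knot given by leaving a vertex along half-edge 0.   *)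
Definition outgoing (k : nat) : bool := k \in traject (strand_next D) 0%N (nhalf D).

Definition corner_face (k : nat) : nat := orbit_rep D (face_next D) k.

(* With both strands of a crossing pointing north, its northern corner. The   *)
(* western, southern and eastern ones are turn 1, turn 2 and turn 3 of it.    *)
Definition north_corners : seq nat :=
  [seq k <- iota 0 (nhalf D) |
     [&& valence D k == 4, outgoing k & outgoing (turn D 1 k)]].

(* The crossing is positive iff its north-eastern half-edge k is on the       *)
(* over-strand, i.e. at an odd position of X.                                 *)
Definition positive_crossing (k : nat) : bool := odd (reshape_offset (shape D) k).

(* The Seifert form of the surface F which Seifert's algorithm produces       *)
(* (inner discs stacked above outer ones), on the boundary loops of the faces *)
(* f and g, drawn on F along the Seifert circles and through the bands.       *)
(* Since cycles of the diagram project onto H_1(F), these loops generate      *)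
(* H_1(F). The linking number lk(x, y^+) counts the places where x passes     *)
(* over y^+, which can be arranged to be at the bands, over the western       *)
(* strand: x = bd f uses the band of a crossing [N = f] - [S = f] times, and  *)
(* y = bd g runs along the western strand [W = g] - [N = g] times after a     *)
(* positive crossing and [W = g] - [S = g] times before a negative one.       *)
Definition seifert_form (f g : nat) : int :=
  \sum_(k <- north_corners)
    let N := corner_face k in
    let W := corner_face (turn D 1 k) in
    let S := corner_face (turn D 2 k) in
    let Z := if positive_crossing k then N else S in
    ((N == f)%:R - (S == f)%:R) * ((W == g)%:R - (Z == g)%:R).

Definition seifert_matrix : 'M[rat]_(size (faces D)) :=
  \matrix_(i, j) (seifert_form (nth 0%N (faces D) i) (nth 0%N (faces D) j))%:~R.

End Seifert.

Definition form_signature (n : nat) (A : 'M[rat]_n) (s : int) : Prop :=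
  exists (Q : 'M[rat]_n) (d : 'rV[rat]_n),
    [/\ Q \in unitmx, Q *m A *m Q^T = diag_mx d & s = \sum_i sgz (d 0 i)].

(* seifert_matrix is the Gram matrix of a generating family rather than of a  *)
(* basis of H_1(F); this only enlarges the radical of V + V^T.                *)
Definition knot_signature (D : diagram) (s : int) : Prop :=
  form_signature (seifert_matrix D + (seifert_matrix D)^T) s.

Definition knot3_1 : diagram :=
  [:: X 1 5 2 4; X 3 1 4 6; X 5 3 6 2].

(* The standard alternating diagram of the 2-bridge knot C(5, 3, 2), one twist *)
(* region per line.                                                           *)
Definition knot10_6 : diagram :=
  [:: X 20 14 1 13; X 12 20 13 19; X 18 12 19 11; X 10 18 11 17; X 16 10 17 9;
      X 8 2 9 1; X 2 8 3 7; X 6 4 7 3;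
      X 4 15 5 16; X 14 5 15 6].

(* Main.v *)
From Stdlib Require Import Relations Classical_Prop.
From mathcomp Require Import all_boot all_order all_algebra zify ring lra.
Require Import Defs.

Set Implicit Arguments.
Unset Strict Implicit.
Unset Printing Implicit Defensive.

Import Order.TTheory GRing.Theory Num.Theory.

(** Upper bounds. Unknotting sequences are scripts of Reidemeister moves and
    crossing changes, found by a computer search and replayed by a verified
    checker. For the sum of knots with signatures of opposite signs one sequence
    of three crossing changes suffices: the trefoil slides along the other
    summand, so all the diagrams of the sum are isotopic.

    Lower bounds. On the rational labelings x of the edges of a diagram such that
    x a + x c = x b + x d at each crossing X a b c d, take the quadratic form
    \sum (x a - x c) (x b - x d). Its signature, corrected by the writhe, is
    invariant under Reidemeister moves and moves by at most 4 under a crossing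
    change; it is 4 in absolute value for the trefoil and 8 for 10_6.

    If the signatures of the summands have the same sign e, the Seifert form of
    the sum is definite of sign e on a space of dimension 5, and semidefinite of
    sign e on a hyperplane, so the signature is at least 4 in absolute value and
    this case does not occur. *)

(** * Orbits of permutations of an initial segment of nat *)

(** If every face gets a value and every edge the sum of the values of its two faces, the equations
    at the crossings hold, and the term of a crossing becomes a difference of two squares, one for
    each pair of opposite corners. So the form combines the Goeritz forms of the two checkerboard
    surfaces with opposite signs. By Gordon and Litherland each of them computes the signature up to
    a correction, and the two corrections add up to the writhe; this is why twice the signature
    appears.

    Edge labelings are local, so a Reidemeister move concerns a few edges only, whereas Seifert
    matrices would have to be compared across changes of the surface. The signature of Seifert
    matrices is never shown to be invariant: it enters only as a hypothesis on the given sum. For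
    equal signs its expected absolute value is 6, and the bound 4 already contradicts 2.

    A sum depends on one of 12 half-edges of the trefoil and one of 40 of 10_6. The unknotting
    search concerns a single diagram, to which the others are linked by symmetries of the trefoil,
    slides and one inversion. *)

Definition stable (n : nat) (f : nat -> nat) : Prop :=
  (forall k, k < n -> f k < n) /\
  (forall j k, j < n -> k < n -> f j = f k -> j = k).

Definition minrep (n : nat) (f : nat -> nat) (k : nat) : nat :=
  foldr minn k (traject f k n).

Definition minreps (n : nat) (f : nat -> nat) : seq nat :=
  [seq k <- iota 0 n | minrep n f k == k].

Lemma foldr_minn_le x s : foldr minn x s <= x.
Proof. by elim: s => //= y s IH; rewrite geq_min IH orbT. Qed.

Lemma foldr_minn_mem x s : foldr minn x s \in x :: s.
Proof.
elim: s => [|y s IH] /=; first by rewrite mem_head.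
rewrite /minn; case: ifP => _; first by rewrite !inE eqxx orbT.
by move: IH; rewrite !inE => /orP[->|->]; rewrite ?orbT.
Qed.

Lemma foldr_minn_lb x s y : y \in s -> foldr minn x s <= y.
Proof.
elim: s => //= z s IH; rewrite inE => /predU1P[->|/IH h]; rewrite geq_min ?leqnn //.
by rewrite h orbT.
Qed.

Lemma minrep_eq n f k : (minrep n f k == k) = all (leq k) (traject f k n).
Proof.
apply/eqP/allP => [e y yin|h]; first by rewrite -e; apply: foldr_minn_lb.
have := foldr_minn_mem k (traject f k n); rewrite inE => /predU1P[//|/h le_k].
by apply/eqP; rewrite eqn_leq le_k foldr_minn_le.
Qed.

Section Orbits.

Variables (n : nat) (f : nat -> nat).
Hypothesis fP : stable n f.

Lemma iter_lt k i : k < n -> iter i f k < n.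
Proof. by move=> kn; elim: i => //= i IH; apply: fP.1. Qed.

Lemma orbit_looping k : k < n -> looping f k n.
Proof.
move=> kn; apply: contraT; rewrite -looping_uniq => /uniq_leq_size u.
have /u : {subset traject f k n.+1 <= iota 0 n}.
  by move=> y /trajectP[i _ ->]; rewrite mem_iota /= add0n iter_lt.
by rewrite size_traject size_iota ltnn.
Qed.

Lemma iter_inj i j k : j < n -> k < n -> iter i f j = iter i f k -> j = k.
Proof.
by move=> jn kn; elim: i => //= i IH /fP.2 e; apply/IH/e; apply: iter_lt.
Qed.

Lemma iter_back k i : k < n -> exists j, iter j f (iter i f k) = k.
Proof.
move=> kn; have /trajectP[j jn e] := orbit_looping kn.
have {e} : iter (n - j) f k = k.
  by apply: (@iter_inj j) => //; rewrite ?iter_lt // -iterD subnKC // ltnW.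
have: 0 < n - j by rewrite subn_gt0.
move: (n - j) => p p0 e.
have eqp m : iter (m * p) f k = k by elim: m => // m IH; rewrite mulSn iterD IH.
(* [p] is a positive period of [k], so [i] steps followed by [i * p - i] more return to [k], and the
   subtraction does not truncate. *)
exists (i * p - i); rewrite -iterD subnK ?eqp //.
by rewrite leq_pmulr.
Qed.

Lemma minrep_iter k : exists i, minrep n f k = iter i f k.
Proof.
have := foldr_minn_mem k (traject f k n).
rewrite -/(minrep n f k) inE => /predU1P[->|/trajectP[i _ ->]].
  by exists 0.
by exists i.
Qed.

Lemma minrep_le k i : k < n -> minrep n f k <= iter i f k.
Proof. by move=> /orbit_looping/loopingP h; apply: foldr_minn_lb. Qed.

Lemma minrep_lt k : k < n -> minrep n f k < n.
Proof. by move=> kn; have [i ->] := minrep_iter k; apply: iter_lt. Qed.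

Lemma minrep_orbit k i : k < n -> minrep n f (iter i f k) = minrep n f k.
Proof.
move=> kn; have kn' := iter_lt i kn.
apply/eqP; rewrite eqn_leq; apply/andP; split.
  have [a ->] := minrep_iter k; have [b eb] := iter_back i kn.
  by rewrite -{2}eb -iterD; apply: minrep_le.
by have [a ->] := minrep_iter (iter i f k); rewrite -iterD; apply: minrep_le.
Qed.

Lemma minrep_idem k : k < n -> minrep n f (minrep n f k) = minrep n f k.
Proof. by move=> kn; have [i ei] := minrep_iter k; rewrite {1}ei minrep_orbit. Qed.

End Orbits.

Lemma mem_minreps n f k : (k \in minreps n f) = (k < n) && (minrep n f k == k).
Proof. by rewrite mem_filter mem_iota /= add0n andbC. Qed.

(** The least element of an [f]-orbit is sent by [phi] into a [g]-orbit, then to the least element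
    of that orbit. Two [f]-orbits with the same image orbit coincide, as [phi] is injective and
    commutes with the iterates. *)
Lemma minreps_conj_le n f g (phi : nat -> nat) :
  stable n f -> stable n g -> stable n phi ->
  (forall k, k < n -> g (phi k) = phi (f k)) ->
  size (minreps n f) <= size (minreps n g).
Proof.
move=> fP gP pP com.
have comi i k : k < n -> iter i g (phi k) = phi (iter i f k).
  by move=> kn; elim: i => //= i ->; rewrite com // iter_lt.
rewrite -(size_map (fun k => minrep n g (phi k))); apply: uniq_leq_size.
  rewrite map_inj_in_uniq ?filter_uniq ?iota_uniq // => j k.
  rewrite !mem_minreps => /andP[jn /eqP ej] /andP[kn /eqP ek].
  have [a ->] := minrep_iter n g (phi j); have [b ->] := minrep_iter n g (phi k).
  rewrite !comi // => /pP.2 e; have {e} := e (iter_lt fP a jn) (iter_lt fP b kn).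
  move=> e; rewrite -ej -ek -(minrep_orbit fP a jn) -(minrep_orbit fP b kn).
  by rewrite e.
move=> y /mapP[k]; rewrite mem_minreps => /andP[kn _] ->.
have pk := pP.1 _ kn; rewrite mem_minreps minrep_lt //=.
by rewrite (minrep_idem gP) // eqxx.
Qed.

Lemma stable_inverse n phi : stable n phi ->
  exists2 psi, stable n psi & forall k, k < n -> phi (psi k) = k /\ psi (phi k) = k.
Proof.
move=> pP; have back k : k < n -> exists j, iter j phi k == k /\ 0 < j.
  move=> kn; have [j ej] := iter_back pP 1 kn.
  by exists j.+1; split => //; rewrite iterSr; apply/eqP.
pose psi k := if k < n then index k (map phi (iota 0 n)) else k.
have psiP k : k < n -> psi k < n /\ phi (psi k) = k.
  move=> kn; have [j [/eqP ej j0]] := back _ kn.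
  have kin : k \in map phi (iota 0 n).
    apply/mapP; exists (iter j.-1 phi k); last by rewrite -iterS prednK.
    by rewrite mem_iota /= add0n iter_lt.
  have lt : index k (map phi (iota 0 n)) < n.
    by move: kin; rewrite -index_mem size_map size_iota.
  rewrite /psi kn; split=> //.
  have := nth_index 0 kin; rewrite (nth_map 0) ?size_iota // nth_iota //.
exists psi.
  split=> [k /psiP[]//|j k jn kn e].
  by rewrite -(psiP j jn).2 -(psiP k kn).2 e.
move=> k kn; split; first exact: (psiP k kn).2.
have pk := pP.1 _ kn; apply: pP.2 => //; first exact: (psiP _ pk).1.
exact: (psiP _ pk).2.
Qed.

Lemma minreps_conj n f g (phi : nat -> nat) :
  stable n f -> stable n g -> stable n phi ->
  (forall k, k < n -> g (phi k) = phi (f k)) ->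
  size (minreps n f) = size (minreps n g).
Proof.
move=> fP gP pP com; apply/eqP; rewrite eqn_leq (minreps_conj_le fP gP pP com) /=.
have [psi psiP can] := stable_inverse pP.
apply: (minreps_conj_le gP fP psiP) => k kn.
have pk := psiP.1 _ kn.
have := com _ pk; rewrite (can k kn).1 => ->.
by rewrite (can (f (psi k)) (fP.1 _ pk)).2.
Qed.

(** * Half-edges *)

(** Half-edges are positions in a flattened list. These recursions on the first vertex let the facts
    about [turn] be proved by induction on the diagram. *)
Lemma reshape_index_cons n sh k :
  reshape_index (n :: sh) k = if k < n then 0 else (reshape_index sh (k - n)).+1.
Proof.
rewrite /reshape_index /= subn_eq0; case: ltnP => // le_nk.
by rewrite subSn.
Qed.

Lemma reshape_offset_cons n sh k :
  reshape_offset (n :: sh) k = if k < n then k else reshape_offset sh (k - n).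
Proof.
rewrite /reshape_offset reshape_index_cons; case: ltnP => _ /=; first by rewrite subn0.
by rewrite subnDA.
Qed.

Lemma nhalf_cons v D : nhalf (v :: D) = size v + nhalf D.
Proof. by rewrite /nhalf /= size_cat. Qed.

Lemma nhalf_cat D1 D2 : nhalf (D1 ++ D2) = nhalf D1 + nhalf D2.
Proof. by rewrite /nhalf flatten_cat size_cat. Qed.

Lemma valence_cons v D k :
  valence (v :: D) k = if k < size v then size v else valence D (k - size v).
Proof. by rewrite /valence /= reshape_index_cons; case: ltnP. Qed.

Lemma turn_cons v D j k :
  turn (v :: D) j k =
    if k < size v then (k + j) %% size v else size v + turn D j (k - size v).
Proof.
rewrite /turn valence_cons /= reshape_index_cons reshape_offset_cons.
by case: ltnP => _; rewrite /flatten_index /= ?add0n ?addnA.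
Qed.

Lemma label_cons v D k :
  label (v :: D) k = if k < size v then nth 0 v k else label D (k - size v).
Proof. by rewrite /label /= nth_cat. Qed.

Lemma valence_cat D1 D2 k :
  valence (D1 ++ D2) k = if k < nhalf D1 then valence D1 k else valence D2 (k - nhalf D1).
Proof.
elim: D1 k => [|v D1 IH] k /=; first by rewrite subn0.
rewrite !valence_cons IH nhalf_cons subnDA; case: (ltnP k (size v)) => h.
  by rewrite ltn_addr.
by rewrite ltn_subLR.
Qed.

Lemma turn_cat D1 D2 j k :
  turn (D1 ++ D2) j k =
    if k < nhalf D1 then turn D1 j k else nhalf D1 + turn D2 j (k - nhalf D1).
Proof.
elim: D1 k => [|v D1 IH] k /=; first by rewrite subn0.
rewrite !turn_cons IH nhalf_cons subnDA; case: (ltnP k (size v)) => h.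
  by rewrite ltn_addr.
by rewrite ltn_subLR //; case: ifP => // _; rewrite addnA.
Qed.

Lemma label_cat D1 D2 k :
  label (D1 ++ D2) k = if k < nhalf D1 then label D1 k else label D2 (k - nhalf D1).
Proof. by rewrite /label flatten_cat nth_cat. Qed.

Lemma turn_valence D j k : k < nhalf D ->
  [/\ 0 < valence D k, turn D j k < nhalf D & valence D (turn D j k) = valence D k].
Proof.
elim: D k => [|v D IH] k //; rewrite nhalf_cons => kn.
rewrite turn_cons; case: (ltnP k (size v)) => h.
  have v0 : 0 < size v by apply: leq_trans h.
  by rewrite !valence_cons h !ltn_pmod // ltn_addr // ltn_pmod.
have kn' : k - size v < nhalf D by rewrite ltn_subLR.
have [h1 h2 h3] := IH _ kn'.
have hk : (k < size v) = false by rewrite ltnNge h.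
have ht : (size v + turn D j (k - size v) < size v) = false by rewrite ltnNge leq_addr.
by rewrite !valence_cons ltn_add2l hk ht addKn.
Qed.

Lemma turnD D i j k : k < nhalf D -> turn D i (turn D j k) = turn D (j + i) k.
Proof.
elim: D k => [|v D IH] k //; rewrite nhalf_cons => kn.
rewrite !(turn_cons v D) ; case: (ltnP k (size v)) => h.
  have v0 : 0 < size v by apply: leq_trans h.
  by rewrite ltn_pmod // modnDml addnA.
have kn' : k - size v < nhalf D by rewrite ltn_subLR.
have -> : (size v + turn D j (k - size v) < size v) = false by rewrite ltnNge leq_addr.
by rewrite addKn IH.
Qed.

Lemma turn_full D k : k < nhalf D -> turn D (valence D k) k = k.
Proof.
elim: D k => [|v D IH] k //; rewrite nhalf_cons => kn.
rewrite turn_cons valence_cons; case: (ltnP k (size v)) => h.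
  by rewrite modnDr modn_small.
by rewrite IH ?subnKC // ltn_subLR.
Qed.

(** The parameter [c] treats both permutations of half-edges at once: [half] gives [strand_next] and
    [predn] gives [face_next]. *)
Lemma stable_turn D (c : nat -> nat) : (forall v, c v <= v) ->
  stable (nhalf D) (fun k => turn D (c (valence D k)) k).
Proof.
move=> cP; split=> [k kn|j k jn kn e]; first by have [] := turn_valence (c (valence D k)) kn.
have back i : i < nhalf D ->
    turn D (valence D i - c (valence D i)) (turn D (c (valence D i)) i) = i.
  by move=> h; rewrite turnD // subnKC ?cP // turn_full.
have val i : i < nhalf D -> valence D (turn D (c (valence D i)) i) = valence D i.
  by move=> h; have [] := turn_valence (c (valence D i)) h.
have ev : valence D j = valence D k by rewrite -(val j) // e val.
by rewrite -(back j jn) -(back k kn) e ev.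
Qed.

Section Mate.

Variable D : diagram.
Hypothesis pairD : all (fun e => count_mem e (flatten D) == 2) (flatten D).

Let fl := flatten D.

Lemma count2_pos i j k : i < j < nhalf D -> k < nhalf D ->
  label D i = label D j -> label D k = label D i -> k = i \/ k = j.
Proof.
move=> /andP[ij jn] kn eij eki.
have := allP pairD _ (mem_nth 0 jn); rewrite -/(label D j) -eij => /eqP.
set e := label D i; rewrite -/fl => c2.
case: (eqVneq k i) => [->|ki]; first by left.
case: (eqVneq k j) => [->|kj]; first by right.
pose P := [seq x <- iota 0 (nhalf D) | label D x == e].
have szP : size P = 2.
  rewrite size_filter -c2 /fl -[flatten D in RHS](mkseq_nth 0) count_map.
  by apply: eq_count => x.
have sub : {subset [:: i; j; k] <= P}.
  move=> x; rewrite !inE mem_filter mem_iota /= add0n => /or3P[]/eqP->;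
  by rewrite ?(ltn_trans ij) // ?jn ?kn ?eki -?eij eqxx.
have : uniq [:: i; j; k].
  by rewrite /= !inE negb_or (ltn_eqF ij) eq_sym ki eq_sym kj.
by move=> /uniq_leq_size/(_ sub); rewrite szP.
Qed.

Lemma mateP k : k < nhalf D ->
  [/\ mate D k < nhalf D, mate D k != k & label D (mate D k) = label D k].
Proof.
move=> kn; rewrite /mate -/fl.
have kin : label D k \in fl by apply: mem_nth.
have inx : index (label D k) fl <= k.
  by rewrite leqNgt; apply/negP => /(before_find 0) /=; rewrite eqxx.
have lab : label D (index (label D k) fl) = label D k by apply: nth_index.
case: (ltnP (index (label D k) fl) k) => h.
  by rewrite (ltn_trans h kn) neq_ltn h.
have ek : index (label D k) fl = k by apply/eqP; rewrite eqn_leq inx.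
set s := drop k.+1 fl.
have kins : label D k \in s.
  rewrite -has_pred1 has_count; have := allP pairD _ kin.
  rewrite -/fl -{1}(cat_take_drop k.+1 fl) count_cat -/s (take_nth 0) //.
  rewrite -cats1 count_cat /= eqxx addn0.
  have -> : count_mem (label D k) (take k fl) = 0.
    apply/count_memPn; apply/negP => /(nthP 0)[i].
    rewrite size_take kn => ik; rewrite nth_take // => e.
    have := @before_find _ 0 (pred1 (label D k)) fl i; rewrite -/(index _ _) ek.
    by move=> /(_ ik) /=; rewrite e eqxx.
  by case: (count _ s).
rewrite neq_ltn addSn ltnS leq_addr orbT; split=> //.
  move: kins kn; rewrite -index_mem -/s /s size_drop /nhalf -/fl.
  by rewrite ltn_subRL addSn.
by rewrite /label -addSn -nth_drop nth_index.
Qed.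

Lemma mate_unique j k : j < nhalf D -> k < nhalf D -> j != k ->
  label D j = label D k -> j = mate D k.
Proof.
move=> jn kn jk e; have [mn mk em] := mateP kn.
case: (ltngtP k (mate D k)) mk => // h _.
  have cp : k < mate D k < nhalf D by rewrite h.
  have [ejk|//] := count2_pos cp jn (esym em) e.
  by rewrite ejk eqxx in jk.
have cp : mate D k < k < nhalf D by rewrite h.
have [//|ejk] := count2_pos cp jn em (etrans e (esym em)).
by rewrite ejk eqxx in jk.
Qed.

Lemma mateK k : k < nhalf D -> mate D (mate D k) = k.
Proof.
move=> kn; have [mn mk em] := mateP kn.
by apply/esym/mate_unique => //; rewrite eq_sym.
Qed.

Lemma stable_mate : stable (nhalf D) (mate D).
Proof.
split=> [k /mateP[]//|j k jn kn e].
by rewrite -(mateK jn) -(mateK kn) e.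
Qed.

Lemma stable_next (c : nat -> nat) : (forall v, c v <= v) ->
  stable (nhalf D) (fun k => let q := mate D k in turn D (c (valence D q)) q).
Proof.
move=> cP; have tP := @stable_turn D _ cP; have mP := stable_mate.
split=> [k kn|j k jn kn e] /=; first by apply/tP.1/mP.1.
by apply: mP.2 => //; apply: tP.2 => //; apply: mP.1.
Qed.

End Mate.

Lemma half_le v : v./2 <= v.
Proof. by rewrite -{2}(odd_double_half v) -addnn addnA leq_addl. Qed.

(** * Invariance of knot diagrams under isomorphisms of half-edge structures *)

Section Conjugation.

Variables (D D' : diagram) (phi : nat -> nat).
Hypothesis phiP : stable (nhalf D) phi.
Hypothesis pairD' : all (fun e => count_mem e (flatten D') == 2) (flatten D').
Hypothesis shD : perm_eq (shape D') (shape D).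
Hypothesis labD : forall j k, j < nhalf D -> k < nhalf D ->
  label D j = label D k -> label D' (phi j) = label D' (phi k).
Hypothesis valD : forall k, k < nhalf D -> valence D' (phi k) = valence D k.
Hypothesis turnD' : forall j k, k < nhalf D -> turn D' j (phi k) = phi (turn D j k).

(** Labels come in pairs, so [phi] commutes with [mate], hence conjugates the strand and the face
    permutations; the numbers of components and of faces agree. *)
Lemma is_knot_conj : is_knot_diagram D -> is_knot_diagram D'.
Proof.
have nD : nhalf D' = nhalf D.
  by rewrite /nhalf !size_flatten; apply: perm_sumn.
have sD : size D' = size D by have := perm_size shD; rewrite !size_map.
case/and4P => h1 h2 h3 h4.
have mt k : k < nhalf D -> mate D' (phi k) = phi (mate D k).
  move=> kn; have [mn mk em] := mateP h2 kn.
  apply/esym/mate_unique; rewrite ?nD //; try exact: phiP.1; last exact: labD.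
  by apply: contra mk => /eqP e; apply/eqP/(phiP.2).
have nx c : (forall v, c v <= v) ->
    size (minreps (nhalf D) (fun k => let q := mate D k in turn D (c (valence D q)) q)) =
    size (minreps (nhalf D') (fun k => let q := mate D' k in turn D' (c (valence D' q)) q)).
  move=> cP; rewrite nD; apply: (@minreps_conj _ _ _ phi) => //.
  - exact: stable_next.
  - by rewrite -nD; apply: stable_next.
  - move=> k kn; have [mn _ _] := mateP h2 kn.
    by rewrite /= mt // valD // turnD'.
apply/and4P; split=> //.
- have al E : all (fun v : seq nat => (size v == 2) || (size v == 4)) E =
              all (fun s => (s == 2) || (s == 4)) (shape E) by rewrite all_map.
  by rewrite al (perm_all _ shD) -al.
- by rewrite -(eqP h3); apply/eqP/esym/(nx (fun v => v./2) half_le).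
- rewrite nD sD -(eqP h4); apply/eqP; congr (_ + _).
  exact/esym/(nx (fun v => v.-1) leq_pred).
Qed.

End Conjugation.

Lemma pair_perm (s t : seq nat) : perm_eq s t ->
  all (fun e => count_mem e s == 2) s -> all (fun e => count_mem e t == 2) t.
Proof.
move=> st h; apply/allP => e; rewrite -(perm_mem st) => /(allP h).
by rewrite (permP st).
Qed.

Lemma is_knot_swap A B C :
  is_knot_diagram (A ++ B ++ C) -> is_knot_diagram (B ++ A ++ C).
Proof.
move=> kD.
pose phi k := if k < nhalf A then nhalf B + k
              else if k < nhalf A + nhalf B then k - nhalf A else k.
have n1 : nhalf (A ++ B ++ C) = nhalf A + nhalf B + nhalf C by rewrite !nhalf_cat addnA.
have lab k : label (B ++ A ++ C) (phi k) = label (A ++ B ++ C) k.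
  rewrite !label_cat /phi.
  case: (ltnP k (nhalf A)) => h1.
    by rewrite ltnNge leq_addr /= addKn h1.
  case: (ltnP k (nhalf A + nhalf B)) => h2.
    by have -> : k - nhalf A < nhalf B by lia.
  have -> : (k < nhalf B) = false by lia.
  have -> : (k - nhalf B < nhalf A) = false by lia.
  have -> : (k - nhalf A < nhalf B) = false by lia.
  by rewrite -!subnDA addnC.
apply: (@is_knot_conj _ _ phi) (kD).
- split=> [k|j k]; rewrite n1 /phi.
    by case: (ltnP k (nhalf A)) => ?; [|case: (ltnP k (nhalf A + _)) => ?]; lia.
  by case: (ltnP j (nhalf A)) => ?; [|case: (ltnP j (nhalf A + _)) => ?];
    (case: (ltnP k (nhalf A)) => ?; [|case: (ltnP k (nhalf A + _)) => ?]); lia.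
- apply: (pair_perm (s := flatten (A ++ B ++ C))); last by case/and4P: kD.
  by rewrite !flatten_cat perm_catCA.
- by rewrite /shape !map_cat perm_catCA.
- by move=> j k _ _; rewrite !lab.
- move=> k _; rewrite !valence_cat /phi.
  case: (ltnP k (nhalf A)) => h1.
    by rewrite ltnNge leq_addr /= addKn h1.
  case: (ltnP k (nhalf A + nhalf B)) => h2.
    by have -> : k - nhalf A < nhalf B by lia.
  have -> : (k < nhalf B) = false by lia.
  have -> : (k - nhalf B < nhalf A) = false by lia.
  have -> : (k - nhalf A < nhalf B) = false by lia.
  by rewrite -!subnDA addnC.
- move=> j k; rewrite n1 => kn; rewrite !turn_cat {1 2 3 4 5 6}/phi.
  case: (ltnP k (nhalf A)) => h1.
    have -> : (nhalf B + k < nhalf B) = false by lia.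
    have [_ tl _] := turn_valence j h1.
    by rewrite /= addKn h1 /phi tl.
  case: (ltnP k (nhalf A + nhalf B)) => h2.
    have h3 : k - nhalf A < nhalf B by lia.
    have [_ tl _] := turn_valence j h3.
    rewrite h3 /phi ltnNge leq_addr /= ltn_add2l tl addKn //.
  have -> : (k < nhalf B) = false by lia.
  have -> : (k - nhalf B < nhalf A) = false by lia.
  have -> : (k - nhalf A < nhalf B) = false by lia.
  have -> : k - nhalf B - nhalf A = k - nhalf A - nhalf B by lia.
  by rewrite /phi; do 2 (case: ltnP => ? /=; try lia).
Qed.

(** Any rotation is allowed, not only a half-turn: the test sees the projection of the knot alone,
    so it is also invariant under crossing changes and mirror images. *)
Lemma is_knot_rot r v C : is_knot_diagram (v :: C) -> is_knot_diagram (rot r v :: C).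
Proof.
move=> kD; case: (leqP (size v) r) => [h|rs]; first by rewrite rot_oversize.
pose phi k := if k < size v then (if r <= k then k - r else k + size v - r) else k.
have phiE k : k < size v -> phi k = (k + (size v - r)) %% size v.
  move=> h; rewrite /phi h; case: (leqP r k) => h'; last by rewrite modn_small; lia.
  have -> : k + (size v - r) = k - r + size v by lia.
  by rewrite modnDr modn_small //; lia.
have szr : size (rot r v) = size v by rewrite size_rot.
have phl k : (phi k < size v) = (k < size v).
  by rewrite /phi; case: (ltnP k (size v)) => ?; [case: (leqP r k) => ?|]; lia.
have lab k : label (rot r v :: C) (phi k) = label (v :: C) k.
  rewrite !label_cons szr phl; case: ltnP => h; last by rewrite /phi ltnNge h.
  rewrite /phi h /rot nth_cat size_drop; case: (leqP r k) => h'.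
    by rewrite ltn_sub2r // nth_drop subnKC.
  have -> : (k + size v - r < size v - r) = false by lia.
  by rewrite nth_take; [congr nth; lia | lia].
have n1 := nhalf_cons v C.
apply: (@is_knot_conj _ _ phi) (kD).
- split=> [k|j k]; rewrite n1 /phi.
    by case: (ltnP k (size v)) => ?; [case: (leqP r k) => ?|]; lia.
  by case: (ltnP j (size v)) => ?; [case: (leqP r j) => ?|];
    (case: (ltnP k (size v)) => ?; [case: (leqP r k) => ?|]); lia.
- apply: (pair_perm (s := flatten (v :: C))); last by case/and4P: kD.
  by rewrite /= perm_cat2r perm_sym perm_rot.
- by rewrite /= size_rot.
- by move=> j k _ _; rewrite !lab.
- by move=> k _; rewrite !valence_cons szr phl; case: ltnP => // h; rewrite /phi ltnNge h.
- move=> j k kn; rewrite !turn_cons szr phl; case: ltnP => h.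
    have v0 : 0 < size v by lia.
    by rewrite !phiE ?ltn_pmod // !modnDml addnAC.
  by rewrite /phi [k < _]ltnNge h /= ltnNge leq_addr.
Qed.

Lemma flatten_map2 (f : nat -> nat) (D : diagram) :
  flatten (map (map f) D) = map f (flatten D).
Proof. by rewrite map_flatten. Qed.

Lemma shape_map2 (f : nat -> nat) (D : diagram) : shape (map (map f) D) = shape D.
Proof. by rewrite /shape -map_comp; apply: eq_map => v /=; rewrite size_map. Qed.

Lemma is_knot_relabel (f : nat -> nat) D : {in flatten D &, injective f} ->
  is_knot_diagram D -> is_knot_diagram (map (map f) D).
Proof.
move=> fI kD; have fl := flatten_map2 f D; have sh := shape_map2 f D.
have lab k : k < nhalf D -> label (map (map f) D) k = f (label D k).
  by move=> kn; rewrite /label fl (nth_map 0).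
apply: (@is_knot_conj _ _ id) (kD).
- by split.
- rewrite fl; apply/allP => _ /mapP[x xD ->].
  case/and4P: kD => _ /allP/(_ x xD) /eqP <- _ _.
  rewrite count_map; apply/eqP/eq_in_count => y yD /=.
  by apply/eqP/eqP => [/fI->|->].
- by rewrite sh.
- by move=> j k jn kn /= e; rewrite !lab // e.
- by move=> k _; rewrite /valence sh.
- by move=> j k _; rewrite /turn /valence sh.
Qed.

Lemma is_knot_mirror D : is_knot_diagram D -> is_knot_diagram (mirror D).
Proof.
rewrite -[D in is_knot_diagram D]cats0 -[mirror D]cats0 /mirror.
set g := fun v => _; suff h A B : is_knot_diagram (A ++ B) -> is_knot_diagram (map g A ++ B) by apply: h.
elim: A B => // v A IH B kD.
rewrite /= -cat1s; apply: (@is_knot_swap (map g A) [:: g v] B); apply: IH.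
apply: (@is_knot_swap [:: g v] A B); rewrite /= /g.
by case: ifP => // _; apply: is_knot_rot.
Qed.

(** * A faster test for knot diagrams *)

Definition mate_in (fl : seq nat) (k : nat) : nat :=
  let e := nth 0 fl k in
  let i := index e fl in
  if i < k then i else k.+1 + index e (drop k.+1 fl).

Fixpoint turn_table (c : nat -> nat) (b : nat) (D : diagram) : seq nat :=
  if D is v :: D' then
    [seq b + (k + c (size v)) %% size v | k <- iota 0 (size v)]
      ++ turn_table c (b + size v) D'
  else [::].

(** The walk stops as soon as the orbit returns to [k] or drops below it, whereas [orbit_rep] always
    makes a full number of steps. *)
Fixpoint stays_above (s : seq nat) (k x m : nat) : bool :=
  if m is m'.+1 then
    if x == k then true else if x < k then false else stays_above s k (nth 0 s x) m'
  else true.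

Definition count_orbits (n : nat) (s : seq nat) : nat :=
  count (fun k => stays_above s k (nth 0 s k) n.-1) (iota 0 n).

Definition mates (D : diagram) : seq nat :=
  mkseq (mate_in (flatten D)) (nhalf D).

(** Replaces the counting of labels. The mate of a label that occurs once is out of range, and a
    third occurrence of a label has the first one as mate, whose mate is the second. *)
Definition paired (D : diagram) : bool :=
  let m := mates D in let n := nhalf D in
  all (fun k => let q := nth n m k in (q < n) && (nth n m q == k)) (iota 0 n).

Definition fast_knot (D : diagram) : bool :=
  let m := mates D in let n := nhalf D in
  [&& all (fun v => (size v == 2) || (size v == 4)) D,
      paired D,
      count_orbits n (map (nth 0 (turn_table half 0 D)) m) == 2
    & size D + count_orbits n (map (nth 0 (turn_table predn 0 D)) m) == n./2 + 2].

Lemma nth_turn_table c b D k : k < nhalf D ->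
  nth 0 (turn_table c b D) k = b + turn D (c (valence D k)) k.
Proof.
elim: D b k => // v D IH b k; rewrite nhalf_cons => kn /=.
rewrite nth_cat size_map size_iota turn_cons valence_cons; case: (ltnP k (size v)) => h.
  by rewrite (nth_map 0) ?size_iota // nth_iota.
by rewrite IH ?ltn_subLR // addnA.
Qed.

Lemma stays_aboveE s k j m : 0 < j ->
  (forall i, i < j -> k <= iter i (nth 0 s) k) ->
  stays_above s k (iter j (nth 0 s) k) m =
  all (leq k) (traject (nth 0 s) (iter j (nth 0 s) k) m).
Proof.
elim: m j => //= m IH j j0 above; case: eqVneq => [ej|nej] /=.
  (* After a return to [k] the walk has period [j], so all later values are among those already
     known to be at least [k]. *)
  rewrite ej leqnn /=; apply/esym/allP => y /trajectP[i _ ->].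
  rewrite -[nth 0 s k]/(iter 1 (nth 0 s) k) -iterD.
  rewrite (divn_eq (i + 1) j) addnC iterD.
  have -> : iter ((i + 1) %/ j * j) (nth 0 s) k = k.
    by elim: (_ %/ j) => // d IHd; rewrite mulSn iterD IHd.
  by apply: above; rewrite ltn_pmod.
case: leqP => //= le.
apply: (IH j.+1) => // i; rewrite ltnS leq_eqVlt => /predU1P[->|/above]//.
Qed.

Lemma count_orbitsE n (s : seq nat) f :
  (forall k, k < n -> nth 0 s k = f k) -> stable n f ->
  count_orbits n s = size (minreps n f).
Proof.
move=> sf fP; rewrite /minreps size_filter; apply: eq_in_count => k.
rewrite mem_iota /= add0n => kn; rewrite minrep_eq.
have it i : iter i (nth 0 s) k = iter i f k.
  by elim: i => //= i ->; rewrite sf // iter_lt.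
case: n => // n in sf fP kn *.
rewrite -pred_Sn -[nth 0 s k]/(iter 1 (nth 0 s) k) stays_aboveE //; last first.
  by move=> [|i].
rewrite /= leqnn /=; congr (all _ _).
elim: n {sf fP kn} => // m IH; rewrite !trajectSr IH.
rewrite -[nth 0 s k]/(iter 1 (nth 0 s) k) -[f k]/(iter 1 f k).
by rewrite -!iterD it.
Qed.

Lemma nth_mates x0 D k : k < nhalf D -> nth x0 (mates D) k = mate D k.
Proof. by move=> kn; rewrite nth_mkseq. Qed.

Lemma pairedP D : paired D ->
  (forall k, k < nhalf D -> mate D k < nhalf D) /\
  all (fun e => count_mem e (flatten D) == 2) (flatten D).
Proof.
move=> h2.
have {}h2 k : k < nhalf D -> mate D k < nhalf D /\ mate D (mate D k) = k.
  move=> kn; have := allP h2 k; rewrite mem_iota /= add0n => /(_ kn).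
  by rewrite nth_mates // => /andP[q1 /eqP]; rewrite nth_mates.
split=> [k /h2[]//|].
apply/allP => e ein; set i := index e (flatten D).
have ilt : i < nhalf D by rewrite /nhalf index_mem.
have ei : label D i = e by apply: nth_index.
have mi : i < mate D i.
  by rewrite /mate ei -/i ltnn addSn ltnS leq_addr.
have [mn mk] := h2 _ ilt.
have labm : label D (mate D i) = e.
  move: mn; rewrite /mate ei -/i ltnn /label -nth_drop => lt; apply: nth_index.
  rewrite -index_mem size_drop ltn_subRL; exact: lt.
have pos k : k < nhalf D -> label D k = e -> k \in [:: i; mate D i].
  move=> kn ek; rewrite !inE; case: (ltngtP k i) => [ki|ik|//].
    have := @before_find _ 0 (pred1 e) (flatten D) k ki.
    by rewrite /= -/(label D k) ek eqxx.
  have e1 : mate D k = i by rewrite /mate ek -/i ik.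
  by have [_ e2] := h2 _ kn; rewrite e1 in e2; rewrite e2 eqxx.
have -> : count_mem e (flatten D) =
          size [seq x <- iota 0 (nhalf D) | label D x == e].
  rewrite size_filter -[flatten D in LHS](mkseq_nth 0) count_map.
  by apply: eq_count => x.
have mem x : (x \in [seq x <- iota 0 (nhalf D) | label D x == e])
              = (x \in [:: i; mate D i]).
  rewrite mem_filter mem_iota /= add0n; apply/andP/idP => [[/eqP ex xn]|].
    exact: pos.
  by rewrite !inE => /orP[]/eqP->; rewrite ?ei ?labm eqxx.
have u : uniq [:: i; mate D i] by rewrite /= inE neq_ltn mi.
by rewrite (perm_size (uniq_perm (filter_uniq _ (iota_uniq _ _)) u mem)).
Qed.

Lemma fast_knotP D : fast_knot D -> is_knot_diagram D.
Proof.
case/and4P=> h1 /pairedP[h2 pairD] h3 h4.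
have orb c : (forall v, c v <= v) ->
    count_orbits (nhalf D) (map (nth 0 (turn_table c 0 D)) (mates D)) =
    size (minreps (nhalf D) (fun k => let q := mate D k in turn D (c (valence D q)) q)).
  move=> cP; apply: count_orbitsE; last exact: stable_next.
  move=> k kn; rewrite (nth_map 0) ?size_mkseq // nth_mates // nth_turn_table //.
  exact: h2.
apply/and4P; split=> //.
  by rewrite -[size _](orb half half_le).
by rewrite -[size (faces D)](orb predn leq_pred).
Qed.

(** * Isotopies *)

Lemma isotopic_refl D : isotopic D D.
Proof. exact: rst_refl. Qed.

Lemma isotopic_sym D D' : isotopic D D' -> isotopic D' D.
Proof. exact: rst_sym. Qed.

Lemma isotopic_trans D' D D'' : isotopic D D' -> isotopic D' D'' -> isotopic D D''.
Proof. exact: rst_trans. Qed.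

Lemma move_isotopic D D' :
  is_knot_diagram D -> is_knot_diagram D' -> move D D' -> isotopic D D'.
Proof. by move=> kD kD' m; apply: rst_step. Qed.

Lemma isotopic_knot D D' : isotopic D D' -> is_knot_diagram D = is_knot_diagram D'.
Proof. by elim=> {D D'} [D D' [-> ->] | | D D' _ -> | D1 D2 D3 _ -> _ ->]. Qed.

Lemma isotopic_unknots_in D D' n : isotopic D D' -> unknots_in D' n -> unknots_in D n.
Proof.
move=> iso u; case: u iso => [E h | E D1 D2 m h c u] iso.
  by apply: unknots_in0; apply: isotopic_trans h.
by apply: (unknots_inS _ c u); apply: isotopic_trans h.
Qed.

Definition half_turn (v : seq nat) : seq nat := rot (size v)./2 v.

Lemma isotopic_swap A B C :
  is_knot_diagram (A ++ B ++ C) -> isotopic (A ++ B ++ C) (B ++ A ++ C).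
Proof.
move=> kD; apply: move_isotopic => //; first exact: is_knot_swap.
by apply: move_perm; rewrite perm_catCA.
Qed.

Lemma isotopic_half_turn v C :
  is_knot_diagram (v :: C) -> isotopic (v :: C) (half_turn v :: C).
Proof.
move=> kD; apply: move_isotopic => //; first exact: is_knot_rot.
case/and4P: kD => /andP[/orP[]/eqP sv _] _ _ _; rewrite /half_turn sv.
  by case: v sv => [|a [|b []]] // _; apply: move_rotP.
by case: v sv => [|a [|b [|c [|d []]]]] // _; apply: move_rotX.
Qed.

Lemma isotopic_turn_at A v C :
  is_knot_diagram (A ++ v :: C) -> isotopic (A ++ v :: C) (A ++ half_turn v :: C).
Proof.
move=> kD; have h1 := @isotopic_swap A [:: v] C kD.
have k1 : is_knot_diagram (v :: A ++ C) := etrans (esym (isotopic_knot h1)) kD.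
have h2 := isotopic_half_turn k1.
apply: (isotopic_trans h1); apply: (isotopic_trans h2).
by apply: (@isotopic_swap [:: _] A C); rewrite -(isotopic_knot h2).
Qed.

Lemma isotopic_relabel (f : nat -> nat) D :
  {in flatten D &, injective f} -> is_knot_diagram D -> isotopic D (map (map f) D).
Proof.
move=> fI kD; apply: move_isotopic => //; first exact: is_knot_relabel.
exact: move_relabel.
Qed.

Definition relabeling (D D' : diagram) (x : nat) : nat :=
  nth 0 (flatten D') (index x (flatten D)).

(** Testing both directions makes the relabeling injective on the labels of [D], as [move_relabel]
    requires. *)
Definition same_up_to_labels (D D' : diagram) : bool :=
  (map (map (relabeling D D')) D == D') && (map (map (relabeling D' D)) D' == D).

Lemma same_up_to_labels_isotopic D D' :
  is_knot_diagram D -> same_up_to_labels D D' -> isotopic D D'.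
Proof.
move=> kD /andP[/eqP e /eqP e']; rewrite -e; apply: isotopic_relabel => //.
have can : {in flatten D, cancel (relabeling D D') (relabeling D' D)}.
  have ff : map (fun x => relabeling D' D (relabeling D D' x)) (flatten D) = flatten D.
    by rewrite (map_comp (relabeling D' D)) -!flatten_map2 e e'.
  move=> x xD; have := nth_index 0 xD; rewrite -{1}ff (nth_map 0) ?index_mem //.
  by rewrite nth_index.
exact: (can_in_inj can).
Qed.

(** * Mirror images of isotopies and of unknotting sequences *)

Section MirrorImages.

Lemma mirror_cons v D :
  mirror (v :: D) = (if size v == 4 then rot 1 v else v) :: mirror D.
Proof. by []. Qed.

Lemma mirror_relabel (f : nat -> nat) D : mirror (map (map f) D) = map (map f) (mirror D).
Proof.
rewrite /mirror -!map_comp; apply: eq_map => v /=; rewrite size_map.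
by case: ifP => // _; rewrite map_rot.
Qed.

Lemma mem_flatten_mirror D : flatten (mirror D) =i flatten D.
Proof.
elim: D => // v D IH x; rewrite mirror_cons /= !mem_cat IH.
by case: ifP => // _; rewrite mem_rot.
Qed.

(** Up to half-turns and reordering, mirroring exchanges the two kinks. It also exchanges the two
    triangle rules, as the top and the bottom strand trade places, and it maps the bigon rule to
    itself with the over-arc and the under-arc exchanged. *)
Lemma mirror_move D D' : is_knot_diagram D -> is_knot_diagram D' ->
  move D D' -> isotopic (mirror D) (mirror D').
Proof.
move=> /is_knot_mirror + /is_knot_mirror; move=> + + m.
case: m => {D D'}.
- move=> D D' p k k'; apply: move_isotopic => //; apply: move_perm.
  exact: perm_map.
- move=> f D fI k k'; rewrite mirror_relabel; apply: isotopic_relabel => //.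
  by move=> x y; rewrite !mem_flatten_mirror; apply: fI.
- move=> a b c d C k k'; apply: move_isotopic => //; exact: move_rotX.
- move=> a b C k k'; apply: move_isotopic => //; exact: move_rotP.
- move=> a b C ab k; rewrite mirror_relabel => k'; apply: move_isotopic => //.
  exact: move_erase.
- move=> e a b C k k'; rewrite !mirror_cons /= in k k' *.
  have h1 := isotopic_half_turn k; have h2 := isotopic_half_turn k'.
  apply: (isotopic_trans h1); apply: isotopic_trans (isotopic_sym h2).
  apply: move_isotopic; rewrite -?(isotopic_knot h1) -?(isotopic_knot h2) //.
  exact: move_R1r.
- move=> e a b C k k'; rewrite !mirror_cons /= in k k' *.
  have h2 := isotopic_half_turn k'; apply: isotopic_trans (isotopic_sym h2).
  apply: move_isotopic; rewrite -?(isotopic_knot h2) //.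
  exact: move_R1l.
- move=> a b c d e f C k k'; rewrite !mirror_cons /= in k k' *.
  have h1 := @isotopic_swap [:: [:: e; f; a; c]] [:: [:: e; d; b; f]] _ k.
  have k1 : is_knot_diagram _ := etrans (esym (isotopic_knot h1)) k.
  have h2 := isotopic_half_turn k1.
  have k2 : is_knot_diagram _ := etrans (esym (isotopic_knot h2)) k1.
  have h1' := isotopic_half_turn k'.
  have k1' : is_knot_diagram _ := etrans (esym (isotopic_knot h1')) k'.
  have h2' := @isotopic_swap [:: [:: b; a]] [:: [:: c; d]] _ k1'.
  have k2' : is_knot_diagram _ := etrans (esym (isotopic_knot h2')) k1'.
  have h3' := isotopic_half_turn k2'.
  have k3' : is_knot_diagram _ := etrans (esym (isotopic_knot h3')) k2'.
  apply: (isotopic_trans h1); apply: (isotopic_trans h2).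
  apply: isotopic_trans (isotopic_sym h1'); apply: isotopic_trans (isotopic_sym h2').
  apply: isotopic_trans (isotopic_sym h3').
  by apply: move_isotopic => //; apply: move_R2.
- move=> t1 t2 t3 m1 m2 m3 u1 u2 u3 C k k'; rewrite !mirror_cons /= in k k' *.
  have h1 := @isotopic_swap [:: [:: t2; m2; t1; m1]]
    [:: [:: t3; u2; t2; u1]; [:: m3; u3; m2; u2]] _ k.
  have k1 : is_knot_diagram _ := etrans (esym (isotopic_knot h1)) k.
  have h1' := @isotopic_swap [:: [:: t3; m3; t2; m2]]
    [:: [:: t2; u3; t1; u2]; [:: m2; u2; m1; u1]] _ k'.
  have k1' : is_knot_diagram _ := etrans (esym (isotopic_knot h1')) k'.
  apply: (isotopic_trans h1); apply: isotopic_trans (isotopic_sym h1').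
  by apply: move_isotopic => //; apply: move_R3r.
- move=> t1 t2 t3 m1 m2 m3 u1 u2 u3 C k k'; rewrite !mirror_cons /= in k k' *.
  have turn3 (v1 v2 v3 : seq nat) E : is_knot_diagram [:: v1, v2, v3 & E] ->
      isotopic [:: v1, v2, v3 & E] [:: half_turn v3, half_turn v1, half_turn v2 & E].
    move=> kk; have g1 := isotopic_half_turn kk.
    have kk1 : is_knot_diagram _ := etrans (esym (isotopic_knot g1)) kk.
    have g2 := @isotopic_turn_at [:: half_turn v1] _ _ kk1.
    have kk2 : is_knot_diagram _ := etrans (esym (isotopic_knot g2)) kk1.
    have g3 := @isotopic_turn_at [:: half_turn v1; half_turn v2] _ _ kk2.
    have kk3 : is_knot_diagram _ := etrans (esym (isotopic_knot g3)) kk2.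
    apply: (isotopic_trans g1); apply: (isotopic_trans g2); apply: (isotopic_trans g3).
    exact: (@isotopic_swap [:: half_turn v1; half_turn v2] [:: half_turn v3] E kk3).
  have h1 := turn3 _ _ _ _ k; have h1' := turn3 _ _ _ _ k'.
  apply: (isotopic_trans h1); apply: isotopic_trans (isotopic_sym h1').
  apply: move_isotopic; rewrite -?(isotopic_knot h1) -?(isotopic_knot h1') //.
  exact: move_R3l.
Qed.

Lemma isotopic_mirror D D' : isotopic D D' -> isotopic (mirror D) (mirror D').
Proof.
elim=> {D D'} [D D' [k k' m] | D | D D' _ | D1 D2 D3 _ + _].
- exact: mirror_move.
- exact: isotopic_refl.
- exact: isotopic_sym.
- exact: isotopic_trans.
Qed.

Lemma unknots_in_mirror D n : unknots_in D n -> unknots_in (mirror D) n.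
Proof.
elim=> {D n} [D iso | D D1 D2 n iso c _ IH].
  by apply: unknots_in0; apply: (isotopic_mirror iso).
apply: unknots_inS (isotopic_mirror iso) _ IH.
by case: c => a b c d C; rewrite !mirror_cons; apply: crossing_change_at.
Qed.

End MirrorImages.

(** * Certified sequences of moves *)

(* Steps act on the first vertices of the list. [Pull]/[PullT] bring a vertex to *)
(* the front, the latter with a half-turn; [Subdivide k b] inserts a marked      *)
(* point in the edge at half-edge k, which gets the new label b.                 *)
Inductive step :=
| Pull of nat | PullT of nat | Subdivide of nat & nat | Erase
| Unkink | Kinkl of nat | Kinkr of nat
| Unpoke | Poke of nat & nat
| Slidel | Slidel' | Slider | Slider'.

Definition set_label (D : diagram) (k b : nat) : diagram :=
  reshape (shape D) (set_nth 0 (flatten D) k b).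

Definition merge_labels (a b : nat) (C : diagram) : diagram :=
  map (map (fun x => if x == b then a else x)) C.

(** An inapplicable step returns the empty diagram, which [fast_knot] rejects. In [Subdivide] the
    comparison with [D] forces the new label to be fresh, since an older occurrence of [b] would be
    merged into [a]. *)
Definition apply_step (s : step) (D : diagram) : diagram :=
  match s with
  | Pull i => nth [::] D i :: take i D ++ drop i.+1 D
  | PullT i => half_turn (nth [::] D i) :: take i D ++ drop i.+1 D
  | Subdivide k b =>
      let a := label D k in
      let C := set_label D k b in
      if (a != b) && (merge_labels a b C == D) then P a b :: C else [::]
  | Erase => if D is [:: a; b] :: C then
      if a != b then merge_labels a b C else [::] else [::]
  | Unkink => if D is [:: a; b; c; d] :: C then
      if a == b then P c d :: C else if b == c then P a d :: C else [::] else [::]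
  | Kinkl e => if D is [:: a; b] :: C then X e e a b :: C else [::]
  | Kinkr e => if D is [:: a; b] :: C then X a e e b :: C else [::]
  | Unpoke => if D is [:: [:: c; e; f; a], [:: f'; e'; d; b] & C] then
      if (e == e') && (f == f') then [:: P a b, P c d & C] else [::] else [::]
  | Poke e f => if D is [:: [:: a; b], [:: c; d] & C] then
      [:: X c e f a, X f e d b & C] else [::]
  | Slidel =>
      if D is [:: [:: m1; t2; m2; t1], [:: u1; t3; u2; t2'], [:: u2'; m3; u3; m2'] & C] then
      if [&& t2 == t2', u2 == u2' & m2 == m2'] then
        [:: X m2 t3 m3 t2, X u2 t2 u3 t1, X u1 m2 u2 m1 & C] else [::] else [::]
  | Slidel' =>
      if D is [:: [:: m2; t3; m3; t2], [:: u2; t2'; u3; t1], [:: u1; m2'; u2'; m1] & C] then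
      if [&& t2 == t2', u2 == u2' & m2 == m2'] then
        [:: X m1 t2 m2 t1, X u1 t3 u2 t2, X u2 m3 u3 m2 & C] else [::] else [::]
  | Slider =>
      if D is [:: [:: m1; t2; m2; t1], [:: u1; t3; u2; t2'], [:: m2'; u2'; m3; u3] & C] then
      if [&& t2 == t2', u2 == u2' & m2 == m2'] then
        [:: X m2 t3 m3 t2, X u2 t2 u3 t1, X m1 u1 m2 u2 & C] else [::] else [::]
  | Slider' =>
      if D is [:: [:: m2; t3; m3; t2], [:: u2; t2'; u3; t1], [:: m1; u1; m2'; u2'] & C] then
      if [&& t2 == t2', u2 == u2' & m2 == m2'] then
        [:: X m1 t2 m2 t1, X u1 t3 u2 t2, X m2 u2 m3 u3 & C] else [::] else [::]
  end.

(** The planarity of the result is what makes a [Poke] legitimate; pulling a vertex to the front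
    cannot destroy it. *)
Definition valid_step (s : step) (D D' : diagram) : bool :=
  match s with
  | Pull i | PullT i => i < size D
  | _ => fast_knot D'
  end.

Fixpoint run (ss : seq step) (D : diagram) : option diagram :=
  if ss is s :: ss' then
    let D' := apply_step s D in
    if valid_step s D D' then run ss' D' else None
  else Some D.

Lemma apply_step_isotopic s D :
  is_knot_diagram D -> valid_step s D (apply_step s D) -> isotopic D (apply_step s D).
Proof.
move=> kD; have pull i : i < size D -> isotopic D (nth [::] D i :: take i D ++ drop i.+1 D).
  move=> iD; rewrite -{1}(cat_take_drop i D) (drop_nth [::] iD).
  apply: (@isotopic_swap (take i D) [:: nth [::] D i]).
  by rewrite cat1s -drop_nth // cat_take_drop.
have nknil : fast_knot [::] = false by [].
have fwd D' : fast_knot D' -> move D D' -> isotopic D D'.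
  by move=> /fast_knotP k' m; apply: move_isotopic.
have bwd D' : fast_knot D' -> move D' D -> isotopic D D'.
  by move=> /fast_knotP k' m; apply/isotopic_sym/move_isotopic.
case: s => [i|i|k b|||e|e||e f||||] /=.
- exact: pull.
- move=> /pull h; apply: (isotopic_trans h); apply: isotopic_half_turn.
  by rewrite -(isotopic_knot h).
- case: ifP => [/andP[ab /eqP e] k'|]; last by rewrite nknil.
  by apply: (bwd _ k'); rewrite -[X in move _ X]e; apply: move_erase.
- case: D kD fwd bwd {pull} => [|[|a [|b []]] C] kD fwd bwd; rewrite ?nknil //.
  case: ifP => [ab k'|]; last by rewrite nknil.
  by apply: (fwd _ k'); apply: move_erase.
- case: D kD fwd bwd {pull} => [|[|a [|b [|c [|d []]]]] C] kD fwd bwd; rewrite ?nknil //.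
  case: (a =P b) => [ab|_]; first by subst b => h; apply: (fwd _ h); apply: move_R1l.
  case: (b =P c) => [bc|_]; last by rewrite nknil.
  by subst c => h; apply: (fwd _ h); apply: move_R1r.
- case: D kD fwd bwd {pull} => [|[|a [|b []]] C] kD fwd bwd; rewrite ?nknil // => h.
  by apply: (bwd _ h); apply: move_R1l.
- case: D kD fwd bwd {pull} => [|[|a [|b []]] C] kD fwd bwd; rewrite ?nknil // => h.
  by apply: (bwd _ h); apply: move_R1r.
- case: D kD fwd bwd {pull} => [|[|c [|e [|f [|a []]]]] [|[|f' [|e' [|d [|b []]]]] C]] kD fwd bwd; rewrite ?nknil //.
  case: ifP => [/andP[/eqP e1 /eqP e2] h|]; last by rewrite nknil.
  by subst e' f'; apply: (fwd _ h); apply: move_R2.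
- case: D kD fwd bwd {pull} => [|[|a [|b []]] [|[|c [|d []]] C]] kD fwd bwd; rewrite ?nknil // => h.
  by apply: (bwd _ h); apply: move_R2.
all: case: D kD fwd bwd {pull} => [|[|? [|? [|? [|? []]]]] [|[|? [|? [|? [|? []]]]] [|[|? [|? [|? [|? []]]]] ?]]] kD fwd bwd; rewrite ?nknil //.
all: case: ifP => [/and3P[/eqP e1 /eqP e2 /eqP e3] h|]; last by rewrite nknil.
all: rewrite -?e1 -?e2 -?e3 in kD fwd bwd *.
- by apply: (fwd _ h); apply: move_R3l.
- by apply: (bwd _ h); apply: move_R3l.
- by apply: (fwd _ h); apply: move_R3r.
- by apply: (bwd _ h); apply: move_R3r.
Qed.

Lemma run_isotopic ss D D' : is_knot_diagram D -> run ss D = Some D' -> isotopic D D'.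
Proof.
elim: ss D => [|s ss IH] D kD /=; first by case=> ->; apply: isotopic_refl.
case: ifP => // v r; have h := apply_step_isotopic kD v.
by apply: (isotopic_trans h); apply: IH r; rewrite -(isotopic_knot h).
Qed.

(* Each script but the last brings to the front a crossing to be changed. *)
Fixpoint unknots_by (sss : seq (seq step)) (D : diagram) : bool :=
  if sss is ss :: sss' then
    match run ss D with
    | Some ([:: a; b; c; d] :: C) => unknots_by sss' ([:: b; c; d; a] :: C)
    | Some [:: [:: a; b]] => (a == b) && nilp sss'
    | _ => false
    end
  else false.

Lemma unknots_byP sss D :
  is_knot_diagram D -> unknots_by sss D -> unknots_in D (size sss).-1.
Proof.
elim: sss D => // ss sss IH D kD /=.
case r: (run ss D) => [[|[|a [|b [|c [|d []]]]] C]|] //; have iso := run_isotopic kD r.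
  case: C r iso => // r iso /andP[/eqP ab /nilP ->]; apply: unknots_in0.
  apply: (isotopic_trans iso); subst b.
  apply: (@isotopic_relabel (fun=> 0)); last by rewrite -(isotopic_knot iso).
  by move=> x y; rewrite !inE !orbb => /eqP-> /eqP->.
move=> u; case: sss u IH => // ss' sss u IH.
apply: (unknots_inS iso); first exact: crossing_change_at.
apply: IH u; rewrite -[_ :: C]/(rot 1 [:: a; b; c; d] :: C); apply: is_knot_rot.
by rewrite -(isotopic_knot iso).
Qed.

(** * Unknotting sequences *)

Definition unknot_trefoil : seq (seq step) :=
  [:: [::]; [:: Pull 0; PullT 2; Unpoke; Erase; Erase; Unkink]].

Definition unknot_10_6 : seq (seq step) :=
  [:: [::]; [:: Pull 1]; [:: Pull 8]; [:: PullT 1; Pull 3; Unpoke; Erase;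
     Erase; PullT 1; Pull 2; Unpoke; Erase; Erase; Pull 0; Pull 5; Unpoke;
     Erase; Erase; Unkink; Erase; PullT 0; Unkink; Erase; Unkink; Erase;
     Unkink]].

(* A diagram with 16 crossings of the sum of the mirrored trefoil and 10_6, at   *)
(* which the search for an unknotting sequence of length 3 succeeded.            *)
Definition hub : diagram :=
  [:: X 1 19 32 20; X 17 13 16 14; X 19 31 18 32; X 2 22 3 21; X 23 3 22 4;
     X 11 6 10 5; X 8 31 7 30; X 4 9 5 10; X 13 30 12 29; X 12 24 11 25;
     X 29 25 28 26; X 15 28 14 27; X 26 15 27 16; X 21 1 20 2; X 9 18 8 17;
     X 6 24 7 23].

Definition hub_to_sum : seq step :=
  [:: PullT 14; PullT 7; Pull 4; Slidel; Pull 4; PullT 9; Pull 2; Slider;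
     Subdivide 6 0; Subdivide 4 33; Poke 34 35; Pull 14; PullT 15; Pull 2;
     Slider'; Pull 12; PullT 17; Pull 15; Slider; Slider'; Pull 10; Pull 11;
     Pull 12; Slidel; PullT 6; Unkink; Erase; Pull 11; Pull 11; Pull 11;
     Slider'; PullT 1; Pull 15; Pull 7; Slider'; Pull 6; Pull 7; Pull 16;
     Slidel; Pull 5; Pull 5; Pull 5; Slider; PullT 11; PullT 2; Pull 12;
     Slidel'; Pull 1; Unkink; Erase; PullT 5; PullT 6; Pull 13; Slidel';
     PullT 1; PullT 2; Pull 14; Slidel; Pull 12; PullT 3; Unpoke; Erase;
     Erase; Subdivide 54 6; Subdivide 7 7; Poke 15 16; PullT 15; Pull 2;
     Pull 4; Slidel; PullT 1; Unkink; Erase; Pull 11; PullT 9; Pull 11;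
     Slider; Slider'; Pull 4; PullT 4; Pull 5; Slider; Unkink; Erase; Pull 4;
     Pull 4; Pull 4; Slider; Slider'; Subdivide 6 4; Subdivide 35 6;
     Poke 7 15; PullT 3; Pull 2; Pull 10; Slidel; Pull 1; PullT 10; Pull 11;
     Slider'; Pull 4; PullT 4; Pull 5; Slider; Slider'; PullT 2; PullT 3;
     Unpoke; Erase; Erase; Subdivide 42 4; Subdivide 43 15; Poke 23 24;
     Pull 2; Pull 15; Pull 6; Slider'; Pull 0; PullT 8; Pull 3; Slider';
     PullT 5; Pull 13; Unpoke; Erase; Erase; PullT 0; Unkink; Erase; PullT 5;
     Pull 3; PullT 2; Pull 3; Pull 9; PullT 10; PullT 6; Pull 11; Pull 9;
     Pull 10; Pull 11; Pull 12].

Definition unknot_hub : seq (seq step) :=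
  [:: [:: Pull 14]; [:: Pull 6; PullT 15; Pull 11; Slider; Pull 2; Pull 9;
     Pull 11; Slider; Subdivide 3 0; Subdivide 4 33; Poke 34 35; Pull 9;
     PullT 5; Pull 8; Slider; Slider'; Slider; Slider'; Pull 6; Pull 14;
     Pull 9; Slider'; Pull 5; Pull 5; Pull 5; Slider; Pull 2; PullT 8;
     Pull 11; Slider; PullT 8; Pull 7; Pull 10; Slidel'; Pull 3; Pull 10;
     Pull 6; Slider]; [:: Pull 4]; [:: Subdivide 15 36; Subdivide 16 37;
     Poke 38 39; PullT 4; PullT 4; Pull 2; Slider'; Subdivide 25 40;
     Subdivide 12 41; Poke 42 43; PullT 14; Pull 18; Pull 11; Slidel;
     PullT 19; Pull 15; Pull 2; Slidel; Pull 6; Pull 6; Unpoke; Erase; Erase;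
     PullT 12; Pull 6; Pull 7; Slider'; PullT 6; Pull 12; Pull 14; Slider;
     PullT 18; Pull 15; Pull 8; Slider; PullT 1; Pull 9; Unpoke; Erase; Erase;
     Subdivide 3 8; Subdivide 4 9; Poke 15 16; PullT 18; Pull 15; Pull 13;
     Slidel'; PullT 8; PullT 4; Unpoke; Erase; Erase; Pull 16; Pull 1; Pull 2;
     Slidel'; PullT 17; Pull 1; Pull 2; Slidel'; PullT 17; Pull 1; Pull 2;
     Slidel'; Pull 17; PullT 1; Unpoke; Erase; Erase; PullT 13; Pull 8;
     Pull 11; Slider'; PullT 0; Unkink; Erase; Pull 2; PullT 11; Pull 14;
     Slidel; PullT 1; PullT 5; Unpoke; Erase; Erase; Pull 2; Pull 1; Unpoke;
     Erase; Erase; Pull 2; PullT 2; Pull 2; Slidel; Pull 9; PullT 3; Unpoke;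
     Erase; Erase; PullT 8; Pull 2; Pull 2; Slider'; PullT 2; PullT 3; Unpoke;
     Erase; Erase; PullT 0; Unkink; Erase; PullT 0; PullT 1; Unpoke; Erase;
     Erase; Pull 2; Pull 3; Unpoke; Erase; Erase; Pull 1; Unkink; Erase;
     Unkink]].

(** In [sum_at h] the labels 1 to 6 come from the trefoil and 8 to 27 from 10_6, so 0, 7, 28 and 29
    are free. With the crossing of [h] in front, the script acts on this crossing and the trefoil
    only, so it serves all half-edges of under-strands. It pokes a bigon, makes one slide for each
    crossing of the trefoil, and removes a bigon. *)
Definition pass_under : seq step :=
  [:: Subdivide 12 0; Subdivide 5 7; Poke 28 29; PullT 5; PullT 2; Pull 3;
     Slidel'; Pull 5; Pull 4; Pull 2; Slider'; Pull 5; Pull 2; Pull 4;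
     Slidel'; Pull 3; PullT 1; Unpoke; Erase; Erase; PullT 3; Pull 3; Pull 3;
     Pull 3].

Definition pass_over : seq step :=
  [:: Subdivide 0 0; PullT 0; Subdivide 13 7; Poke 28 29; PullT 0; Pull 2;
     Pull 5; Slidel'; PullT 1; PullT 5; Pull 4; Slider'; Pull 0; PullT 4;
     Pull 5; Slidel; PullT 1; PullT 4; Unpoke; Erase; Erase; PullT 2; Pull 1;
     PullT 2].

(* Reverses the orientation of the trefoil relative to that of 10_6. *)
Definition invert_trefoil : seq step :=
  [:: Subdivide 7 0; Kinkr 7; PullT 3; PullT 3; Pull 2; Slider'; Pull 0;
     PullT 3; Pull 3; Slider'; PullT 0; Unkink; Erase; Pull 2].

(** Entry [h1] reorders the crossings as the symmetry of the diagram does that relates half-edge 0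
    to [h1], or to the mate of [h1] if [h1] is odd; hence mates have equal entries. *)
Definition trefoil_symmetries : seq (seq step) :=
  [:: [::]; [:: PullT 0; PullT 1; PullT 2]; [:: PullT 1; PullT 2; PullT 2];
     [:: Pull 1; Pull 1; Pull 2]; [:: Pull 1; Pull 1; Pull 2]; [:: PullT 1;
     PullT 2; PullT 2]; [:: PullT 2; PullT 1; PullT 2]; [:: Pull 0; Pull 2;
     Pull 2]; [:: Pull 0; Pull 2; Pull 2]; [:: PullT 2; PullT 1; PullT 2];
     [:: PullT 0; PullT 1; PullT 2]; [::]].

Lemma trefoil_unknots_in1 : unknots_in knot3_1 1.
Proof.
apply: (@unknots_byP unknot_trefoil); first by apply: fast_knotP; vm_compute.
by vm_compute.
Qed.

Lemma knot10_6_unknots_in3 : unknots_in knot10_6 3.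
Proof.
apply: (@unknots_byP unknot_10_6); first by apply: fast_knotP; vm_compute.
by vm_compute.
Qed.

Lemma hub_knot : is_knot_diagram hub.
Proof. by apply: fast_knotP; vm_compute. Qed.

Lemma hub_unknots_in3 : unknots_in hub 3.
Proof. by apply: (@unknots_byP unknot_hub _ hub_knot); vm_compute. Qed.

(** * Sliding the trefoil along 10_6 *)

Definition sum_at (h : nat) : diagram := csum (mirror knot3_1) 0 knot10_6 h.

(* The trefoil of [sum_at h] passes the crossing of h. *)
Definition sum_next (h : nat) : nat := mate knot10_6 (turn knot10_6 2 h).

(** The 3 skips the crossings of the trefoil. The half-turn puts [h] at position 0 of the front
    crossing, on the under-strand, or at position 1, on the over-strand. *)
Definition pull_crossing (h : nat) : seq step :=
  [:: (if h %% 4 < 2 then Pull else PullT) (3 + h %/ 4)].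

Definition pass (h : nat) : seq step :=
  pull_crossing h ++ if odd h then pass_over else pass_under.

Definition leads_to (ss : seq step) (D : diagram) (ss' : seq step) (D' : diagram) : bool :=
  match run ss D, run ss' D' with
  | Some E, Some E' => same_up_to_labels E E'
  | _, _ => false
  end.

Lemma leads_to_isotopic ss D ss' D' : is_knot_diagram D -> is_knot_diagram D' ->
  leads_to ss D ss' D' -> isotopic D D'.
Proof.
move=> kD kD'; rewrite /leads_to.
case r: (run ss D) => [E|//]; case r': (run ss' D') => [E'|//] s.
have h := run_isotopic kD r; have h' := run_isotopic kD' r'.
apply: (isotopic_trans h); apply: isotopic_trans (isotopic_sym h').
by apply: same_up_to_labels_isotopic; rewrite -?(isotopic_knot h).
Qed.

Lemma sum_at_knot h : h < 40 -> is_knot_diagram (sum_at h).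
Proof.
move=> h40; apply: fast_knotP.
suff /allP : all (fun h => fast_knot (sum_at h)) (iota 0 40) by apply; rewrite mem_iota.
by vm_compute.
Qed.

Lemma sum_next_lt h : h < 40 -> sum_next h < 40.
Proof.
move=> h40; suff /allP : all (fun h => sum_next h < 40) (iota 0 40).
  by apply; rewrite mem_iota.
by vm_compute.
Qed.

Lemma sum_at_next h : h < 40 -> isotopic (sum_at h) (sum_at (sum_next h)).
Proof.
move=> h40; apply: (@leads_to_isotopic (pass h) _ (pull_crossing h)).
- exact: sum_at_knot.
- by apply: sum_at_knot; apply: sum_next_lt.
suff /allP : all (fun h => leads_to (pass h) (sum_at h) (pull_crossing h) (sum_at (sum_next h)))
                 (iota 0 40) by apply; rewrite mem_iota.
by vm_compute.
Qed.

Lemma sum_at_iter h k : h < 40 ->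
  iter k sum_next h < 40 /\ isotopic (sum_at h) (sum_at (iter k sum_next h)).
Proof.
move=> h40; elim: k => [|k [lt iso]] /=; first by split=> //; apply: isotopic_refl.
by split; [apply: sum_next_lt | apply: (isotopic_trans iso); apply: sum_at_next].
Qed.

(** The half-edges form two orbits under [sum_next], one for each direction along 10_6, that is, for
    each relative orientation of the summands. The hub is the sum at 19. The half-edges 34 and 37
    are the two ends of one edge, so inverting the trefoil there links the two orbits. *)
Lemma sum_at_unknots_in3 h : h < 40 -> unknots_in (sum_at h) 3.
Proof.
have u19 : unknots_in (sum_at 19) 3.
  apply: isotopic_unknots_in hub_unknots_in3; apply: isotopic_sym.
  apply: (@leads_to_isotopic hub_to_sum _ [::] _ hub_knot); first exact: sum_at_knot.
  by vm_compute.
have reach k m h' : m < 40 -> has (fun i => iter i sum_next m == h') (iota 0 k) ->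
    unknots_in (sum_at h') 3 -> unknots_in (sum_at m) 3.
  move=> m40 /hasP[i _ /eqP <-]; apply: isotopic_unknots_in.
  exact: (sum_at_iter i m40).2.
have u37 : unknots_in (sum_at 37) 3 by apply: (@reach 20 37 19).
have u34 : unknots_in (sum_at 34) 3.
  apply: isotopic_unknots_in u37; apply: isotopic_sym.
  apply: (@leads_to_isotopic invert_trefoil _ [::]); [exact: sum_at_knot.. |].
  by vm_compute.
move=> h40; suff /allP/(_ h) : all (fun m =>
    has (fun i => iter i sum_next m == 19) (iota 0 20) ||
    has (fun i => iter i sum_next m == 34) (iota 0 20)) (iota 0 40).
  by rewrite mem_iota => /(_ h40)/orP[] r; apply: reach r _.
by vm_compute.
Qed.

(** Replacing both half-edges by their mates gives the same sum up to labels. The diagram of the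
    trefoil is alternating, so the mate of an odd half-edge is even, and its symmetries permute the
    even half-edges transitively; hence the mate of [h2] is taken when [h1] is odd. *)
Lemma csum_mirror_trefoil h1 h2 : h1 < 12 -> h2 < 40 ->
  exists2 h, h < 40 & isotopic (sum_at h) (csum (mirror knot3_1) h1 knot10_6 h2).
Proof.
move=> h1n h2n; pose h := if odd h1 then mate knot10_6 h2 else h2.
have h40 : h < 40.
  suff /allP/(_ h2) : all (fun h2 => mate knot10_6 h2 < 40) (iota 0 40).
    by rewrite mem_iota /h => /(_ h2n); case: ifP.
  by vm_compute.
exists h => //.
suff /allP/(_ h1) : all (fun h1 => all (fun h2 =>
    if run (nth [::] trefoil_symmetries h1)
           (sum_at (if odd h1 then mate knot10_6 h2 else h2)) is Some E
    then same_up_to_labels E (csum (mirror knot3_1) h1 knot10_6 h2) else false)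
    (iota 0 40)) (iota 0 12).
  rewrite mem_iota => /(_ h1n)/allP/(_ h2); rewrite mem_iota => /(_ h2n); rewrite -/h.
  case r: (run _ _) => [E|//] s; have iso := run_isotopic (sum_at_knot h40) r.
  apply: (isotopic_trans iso); apply: same_up_to_labels_isotopic => //.
  by rewrite -(isotopic_knot iso) sum_at_knot.
by vm_compute.
Qed.

Lemma csum_mirror_trefoil_unknots_in3 h1 h2 : h1 < 12 -> h2 < 40 ->
  unknots_in (csum (mirror knot3_1) h1 knot10_6 h2) 3.
Proof.
move=> h1n h2n; have [h h40 iso] := csum_mirror_trefoil h1n h2n.
exact: isotopic_unknots_in (isotopic_sym iso) (sum_at_unknots_in3 h40).
Qed.

Lemma csum_mirror_knot10_6_unknots_in3 h1 h2 : h1 < 12 -> h2 < 40 ->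
  unknots_in (csum knot3_1 h1 (mirror knot10_6) h2) 3.
Proof.
(* Mirroring moves each half-edge one place back around its crossing: [h1] in the trefoil is
   [q 3 h1] in its mirror image, and [h2] in the mirror image of 10_6 is [q 1 h2] in 10_6. *)
move=> h1n h2n; pose q i h := 4 * (h %/ 4) + (h + i) %% 4.
have lt n i h : h < 4 * n -> q i h < 4 * n by rewrite /q; lia.
have h1n' : q 3 h1 < 12 := lt 3 3 h1 h1n.
have h2n' : q 1 h2 < 40 := lt 10 1 h2 h2n.
apply: isotopic_unknots_in (unknots_in_mirror (csum_mirror_trefoil_unknots_in3 h1n' h2n')).
set M := mirror (csum _ _ _ _); have kM : is_knot_diagram M.
  have [h h40 iso] := csum_mirror_trefoil h1n' h2n'.
  by apply: is_knot_mirror; rewrite -(isotopic_knot iso) sum_at_knot.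
(* Mirrored twice, the three crossings of the trefoil have made a half-turn; three pulls of the
   third vertex undo this and restore the order. *)
apply/isotopic_sym/(run_isotopic (ss := nseq 3 (PullT 2)) kM)/eqP.
suff /allP/(_ h1) : all (fun h1 => all (fun h2 =>
    run (nseq 3 (PullT 2)) (mirror (csum (mirror knot3_1) (q 3 h1) knot10_6 (q 1 h2)))
      == Some (csum knot3_1 h1 (mirror knot10_6) h2)) (iota 0 40)) (iota 0 12).
  by rewrite mem_iota => /(_ h1n)/allP/(_ h2); rewrite mem_iota => /(_ h2n).
by vm_compute.
Qed.

Local Open Scope ring_scope.

(** * A quadratic form on edge labelings *)

Definition balanced (x : nat -> rat) (v : seq nat) : bool :=
  match v with
  | [:: a; b; c; d] => x a + x c == x b + x d
  | [:: a; b] => x a == x b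
  | _ => true
  end.

Definition energy (x : nat -> rat) (v : seq nat) : rat :=
  if v is [:: a; b; c; d] then (x a - x c) * (x b - x d) else 0.

Definition balanced_on (D : diagram) (x : nat -> rat) : bool := all (balanced x) D.

Definition form (D : diagram) (x : nat -> rat) : rat := \sum_(v <- D) energy x v.

Definition polar (D : diagram) (x y : nat -> rat) : rat :=
  \sum_(v <- D) if v is [:: a; b; c; d] then
    (x a - x c) * (y b - y d) + (y a - y c) * (x b - x d) else 0.

Lemma form_cons v D x : form (v :: D) x = energy x v + form D x.
Proof. by rewrite /form big_cons. Qed.

Lemma balanced_on_cons v D x : balanced_on (v :: D) x = balanced x v && balanced_on D x.
Proof. by []. Qed.

Lemma balancedX a b c d x : balanced x (X a b c d) = (x a + x c == x b + x d).
Proof. by []. Qed.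

Lemma balancedP a b x : balanced x (P a b) = (x a == x b).
Proof. by []. Qed.

Lemma energyE a b c d x : energy x (X a b c d) = (x a - x c) * (x b - x d).
Proof. by []. Qed.

Lemma energyP a b x : energy x (P a b) = 0.
Proof. by []. Qed.

Lemma balanced_ext x y v : {in v, x =1 y} -> balanced x v = balanced y v.
Proof.
case: v => [|a [|b [|c [|d []]]]] //= e; rewrite !e ?inE ?eqxx ?orbT //.
Qed.

Lemma energy_ext x y v : {in v, x =1 y} -> energy x v = energy y v.
Proof.
case: v => [|a [|b [|c [|d []]]]] //= e; rewrite !e ?inE ?eqxx ?orbT //.
Qed.

Lemma balanced_on_ext D x y : {in flatten D, x =1 y} -> balanced_on D x = balanced_on D y.
Proof.
move=> e; apply: eq_in_all => v vD; apply: balanced_ext => n nv; apply: e.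
by apply/flattenP; exists v.
Qed.

Lemma form_ext D x y : {in flatten D, x =1 y} -> form D x = form D y.
Proof.
move=> e; rewrite /form big_seq [RHS]big_seq; apply: eq_bigr => v vD.
apply: energy_ext => n nv; apply: e; by apply/flattenP; exists v.
Qed.

Lemma balanced_on_map (f : nat -> nat) D x :
  balanced_on (map (map f) D) x = balanced_on D (x \o f).
Proof. by rewrite /balanced_on all_map; apply: eq_all => [[|a [|b [|c [|d []]]]]]. Qed.

Lemma form_map (f : nat -> nat) D x : form (map (map f) D) x = form D (x \o f).
Proof. by rewrite /form big_map; apply: eq_bigr => [[|a [|b [|c [|d []]]]]]. Qed.

Lemma form_polar D x y c :
  form D (fun n => x n + c * y n) = form D x + c * polar D x y + c ^+ 2 * form D y.
Proof.
rewrite /form /polar !mulr_sumr -!big_split /=; apply: eq_bigr => v _.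
by case: v => [|a1 [|a2 [|a3 [|a4 [|? ?]]]]] /=; ring.
Qed.

Lemma polar_linear D a x y z w : (forall n, z n = a * x n + y n) ->
  polar D z w = a * polar D x w + polar D y w.
Proof.
move=> zE; rewrite /polar mulr_sumr -!big_split /=; apply: eq_bigr => v _.
by case: v => [|a1 [|a2 [|a3 [|a4 [|? ?]]]]] /=; rewrite ?zE; ring.
Qed.

Lemma balanced_onD D x y c : balanced_on D x -> balanced_on D y ->
  balanced_on D (fun n => x n + c * y n).
Proof.
move=> /allP bx /allP bz; apply/allP => v vD; move: (bx v vD) (bz v vD).
case: v vD => [|a1 [|a2 [|a3 [|a4 []]]]] //= _ /eqP e1 /eqP e2; apply/eqP; last by nra.
by rewrite e1 e2.
Qed.

Definition sg (s : bool) : rat := if s then 1 else -1.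

(** Labelings are functions on all of [nat], of which only the values on the labels of a diagram
    matter, so subspaces are given by linear parametrizations. The definiteness in [Pos] makes these
    injective. *)
Definition additive_family (k : nat) (F : 'rV[rat]_k -> nat -> rat) : Prop :=
  forall a u v n, F (a *: u + v) n = a * F u n + F v n.

(* The form has k squares of sign s. *)
Definition Pos (s : bool) (D : diagram) (k : nat) : Prop :=
  exists F : 'rV[rat]_k -> nat -> rat,
    [/\ additive_family F, forall u, balanced_on D (F u)
      & forall u, u != 0 -> 0 < sg s * form D (F u)].

Definition linear_op (T : (nat -> rat) -> nat -> rat) : Prop :=
  forall a x y z, (forall n, z n = a * x n + y n) ->
  forall n, T z n = a * T x n + T y n.

Lemma Pos0 s D : Pos s D 0.
Proof.
exists (fun _ _ => 0); split=> [a u v n|u|u].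
- by rewrite mulr0 addr0.
- by apply/allP => -[|a [|b [|c [|d []]]]] //= _; rewrite ?addr0.
- by rewrite (thinmx0 u) eqxx.
Qed.

Lemma Pos_op s D D' k T : linear_op T ->
  (forall x, balanced_on D x ->
     balanced_on D' (T x) /\ sg s * form D x <= sg s * form D' (T x)) ->
  Pos s D k -> Pos s D' k.
Proof.
move=> linT TP [F [linF bF pF]]; exists (fun u => T (F u)); split.
- by move=> a u v n; apply: linT => m; apply: linF.
- by move=> u; apply: (TP _ (bF u)).1.
- by move=> u /pF h; apply: lt_le_trans h (TP _ (bF u)).2.
Qed.

Lemma linear_id : linear_op id.
Proof. by move=> a x y z h n; apply: h. Qed.

Lemma additive_family_sum k (F : 'rV[rat]_k -> nat -> rat) u n :
  additive_family F -> F u n = \sum_i u 0 i * F (delta_mx 0 i) n.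
Proof.
move=> linF; rewrite [in LHS](row_sum_delta u).
have F0 : F 0 n = 0 by have := linF (-1) 0 0 n; rewrite scaler0 addr0 mulN1r addNr.
elim: (index_enum _) => [|i r IH]; first by rewrite !big_nil.
by rewrite !big_cons linF IH.
Qed.

Lemma kernel_exists (k l : nat) (A : 'M[rat]_(k, l)) : (l < k)%N ->
  exists2 u : 'rV_k, u != 0 & u *m A = 0.
Proof.
move=> lk; have : kermx A != 0.
  by rewrite -mxrank_eq0 mxrank_ker subn_eq0 -ltnNge (leq_ltn_trans (rank_leq_col A)).
case/rowV0Pn => u /sub_kermxP uA u0; by exists u.
Qed.

(** The equation [x a = x b] cuts out a subspace of codimension at most one, which costs at most one
    square. *)
Lemma Pos_cut s D D' k (a b : nat) :
  (forall x, balanced_on D x -> x a = x b ->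
     balanced_on D' x /\ sg s * form D x <= sg s * form D' x) ->
  Pos s D k.+1 -> Pos s D' k.
Proof.
move=> cP [F [linF bF pF]].
pose A : 'cV[rat]_k.+1 := \col_i (F (delta_mx 0 i) a - F (delta_mx 0 i) b).
have AE u : F u a - F u b = (u *m A) 0 0.
  rewrite !(additive_family_sum u _ linF) mxE -sumrB; apply: eq_bigr => i _.
  by rewrite mxE mulrBr.
have rk : (k <= \rank (kermx A))%N.
  by rewrite mxrank_ker leq_subRL ?rank_leq_row //;
     apply: leq_trans (leq_add (rank_leq_col A) (leqnn k)) _; rewrite add1n.
(* The kernel may be larger than needed; [pid_mx k] selects the first [k] rows of a basis. *)
pose B := row_base (kermx A).
pose M : 'M[rat]_(k, k.+1) := pid_mx k *m B.
have fM : row_free M.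
  rewrite /row_free mxrankMfree ?row_base_free //.
  by rewrite rank_pid_mx.
have MA u : u *m M *m A = 0.
  apply/sub_kermxP; rewrite /M mulmxA; apply: submx_trans (submxMl _ _) _.
  by rewrite eq_row_base.
exists (fun u => F (u *m M)); split.
- by move=> c u v n; rewrite mulmxDl -scalemxAl linF.
- move=> u; have [] // := cP _ (bF (u *m M)).
  by apply/eqP; rewrite -subr_eq0 AE MA mxE.
- move=> u u0; have uM : u *m M != 0.
    by apply: contra u0 => /eqP e; apply/eqP/(row_free_inj fM); rewrite e mul0mx.
  apply: lt_le_trans (pF _ uM) _; have [] // := cP _ (bF (u *m M)).
  by apply/eqP; rewrite -subr_eq0 AE MA mxE.
Qed.

Lemma Pos_le s D k l : (l <= k)%N -> Pos s D k -> Pos s D l.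
Proof.
move=> /subnK <-; elim: (k - l)%N => // m IH; rewrite addSn => h; apply: IH.
by apply: (@Pos_cut s D D _ 0 0) h.
Qed.

(** The hypothesis says that [T] preserves the form and that [v] is orthogonal to its image, with
    square [sg s]. *)
Lemma Pos_add s D D' k T v : linear_op T ->
  (forall x c, balanced_on D x ->
     balanced_on D' (fun n => T x n + c * v n) /\
     form D' (fun n => T x n + c * v n) = form D x + sg s * c ^+ 2) ->
  Pos s D k -> Pos s D' k.+1.
Proof.
move=> linT TP [F [linF bF pF]].
pose r (u : 'rV[rat]_k.+1) : 'rV[rat]_k := rsubmx (u : 'rV_(1 + k)).
exists (fun u n => T (F (r u)) n + u 0 0 * v n); split.
- move=> a u w n.
  have -> : r (a *: u + w) = a *: r u + r w by rewrite /r linearP.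
  rewrite (linT a (F (r u)) (F (r w))) => [|m]; last exact: linF.
  by rewrite !mxE; ring.
- by move=> u; have [] := TP _ (u 0 0) (bF (r u)).
- move=> u u0; have [_ ->] := TP _ (u 0 0) (bF (r u)).
  have sg2 : sg s * sg s = 1 by rewrite /sg; case: s {TP pF}; rewrite ?mul1r ?mulrNN ?mul1r.
  rewrite mulrDr mulrA sg2 mul1r.
  have [r0|rn0] := eqVneq (r u) 0; last first.
    by rewrite ltr_wpDr ?sqr_ge0 ?pF.
  have f0 : form D (F (r u)) = 0.
    rewrite r0 /form big1 // => w _; case: w => [|a1 [|a2 [|a3 [|a4 [|? ?]]]]] //=.
    have F0 n : F 0 n = 0 by have := linF (-1) 0 0 n; rewrite scaler0 addr0 mulN1r addNr.
    by rewrite !F0 subrr mul0r.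
  rewrite f0 mulr0 add0r exprn_even_gt0 //=; apply: contra u0 => /eqP u00.
  rewrite -(hsubmxK (u : 'rV_(1 + k))) -/(r u) r0; apply/eqP/rowP => i.
  rewrite !mxE; case: splitP => j _; rewrite !mxE // (ord1 j).
  by rewrite -u00; congr (u _ _); apply: val_inj.
Qed.

Local Close Scope ring_scope.

(** * Orientations and crossing signs *)

Definition overtex : Type := seq nat * (bool * bool).

(* The bits tell whether the strands enter the vertex along a and along b. *)
Definition flow_in (w : overtex) : seq nat :=
  let: (v, (p, q)) := w in
  match v with
  | [:: a; b; c; d] => [:: if p then a else c; if q then b else d]
  | [:: a; b] => [:: if p then a else b]
  | _ => [::]
  end.

Definition flow_out (w : overtex) : seq nat :=
  let: (v, (p, q)) := w in flow_in (v, (~~ p, ~~ q)).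

Definition ins (OD : seq overtex) : seq nat := flatten (map flow_in OD).
Definition outs (OD : seq overtex) : seq nat := flatten (map flow_out OD).

(** For a label with two occurrences this says that its edge leaves one end and enters at the
    other. *)
Definition oriented (OD : seq overtex) : bool := perm_eq (ins OD) (outs OD).

Lemma orientedP OD :
  (forall e, count_mem e (ins OD) = count_mem e (outs OD)) <-> oriented OD.
Proof.
split=> [h|/permP h e]; last exact: h.
by apply/allP => e _; apply/eqP; apply: h.
Qed.

Lemma ins_cat OD1 OD2 : ins (OD1 ++ OD2) = ins OD1 ++ ins OD2.
Proof. by rewrite /ins map_cat flatten_cat. Qed.

Lemma outs_cat OD1 OD2 : outs (OD1 ++ OD2) = outs OD1 ++ outs OD2.
Proof. by rewrite /outs map_cat flatten_cat. Qed.

Definition crossings (s : bool) (OD : seq overtex) : nat :=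
  count (fun w : overtex => (size w.1 == 4) && ((w.2.1 (+) w.2.2) == s)) OD.

Lemma count_flow e (OD : seq overtex) :
  count_mem e (ins OD) + count_mem e (outs OD) <= count_mem e (flatten (map fst OD)).
Proof.
elim: OD => // -[v [p q]] OD; rewrite /ins /outs /= !count_cat => IH.
suff : count_mem e (flow_in (v, (p, q))) + count_mem e (flow_out (v, (p, q))) <=
       count_mem e v by rewrite /=; lia.
by case: v => [|a [|b [|c [|d [|? ?]]]]] //=; case: p; case: q => /=; lia.
Qed.

Lemma count_flow_eq e (OD : seq overtex) :
  all (fun v : seq nat => (size v == 2) || (size v == 4)) (map fst OD) ->
  count_mem e (ins OD) + count_mem e (outs OD) = count_mem e (flatten (map fst OD)).
Proof.
elim: OD => // -[v [p q]] OD IH /andP[/= sv /IH]; rewrite /ins /outs /= !count_cat.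
suff : count_mem e (flow_in (v, (p, q))) + count_mem e (flow_out (v, (p, q))) =
       count_mem e v by rewrite /=; lia.
by case: v sv => [|a [|b [|c [|d [|? ?]]]]] //= _; case: p; case: q => /=; lia.
Qed.

(* Every orientation of D induces one of D', with d' s - d s more crossings of sign s. *)
Definition orients (D D' : diagram) (d d' : bool -> nat) : Prop :=
  forall OD, map fst OD = D -> oriented OD ->
  exists OD', [/\ map fst OD' = D', oriented OD' &
                  forall s, crossings s OD' + d s = crossings s OD + d' s].

(** The rest [C] keeps its orientation, so [L'] only has to absorb the same net flow at each label
    as [L]. A label absent from [C] has net flow zero in [L], which correlates the directions of the
    strands there. *)
Lemma orients_local L L' C d d' :
  (forall OL, map fst OL = L ->
     (forall e, e \notin flatten C -> count_mem e (ins OL) = count_mem e (outs OL)) ->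
     exists OL', [/\ map fst OL' = L',
       forall e, count_mem e (ins OL) + count_mem e (outs OL') =
                 count_mem e (outs OL) + count_mem e (ins OL') &
       forall s, crossings s OL' + d s = crossings s OL + d' s]) ->
  orients (L ++ C) (L' ++ C) d d'.
Proof.
move=> loc OD eOD oOD.
pose OL := take (size L) OD; pose OC := drop (size L) OD.
have eL : map fst OL = L by rewrite map_take eOD take_size_cat.
have eC : map fst OC = C by rewrite map_drop eOD drop_size_cat.
have eD : OD = OL ++ OC by rewrite cat_take_drop.
have cO e : count_mem e (ins OL) + count_mem e (ins OC) =
            count_mem e (outs OL) + count_mem e (outs OC).
  by have /orientedP/(_ e) := oOD; rewrite eD ins_cat outs_cat !count_cat.
have [|OL' [e1 e2 e3]] := loc OL eL.
  move=> e eC'; have := count_flow e OC; rewrite eC (count_memPn eC').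
  by have := cO e; lia.
exists (OL' ++ OC); split.
- by rewrite map_cat e1 eC.
- apply/orientedP => e; rewrite ins_cat outs_cat !count_cat.
  by have := cO e; have := e2 e; lia.
- by move=> s; rewrite eD /crossings !count_cat; have := e3 s; rewrite /crossings; lia.
Qed.

Definition no_shift (s : bool) : nat := 0.

Lemma orients_perm D D' : perm_eq D D' -> orients D D' no_shift no_shift.
Proof.
move=> pD OD eOD oOD; subst D.
have /(perm_iotaP [::])[Is pI eD'] : perm_eq D' (map fst OD) by rewrite perm_sym.
pose x0 : overtex := ([::], (true, true)).
have pO : perm_eq (map (nth x0 OD) Is) OD.
  by apply/(perm_iotaP x0); exists Is; rewrite // size_map in pI *.
exists (map (nth x0 OD) Is); split.
- rewrite eD' -map_comp; apply/eq_in_map => i; rewrite (perm_mem pI) mem_iota size_map => h.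
  by rewrite /= (nth_map x0).
- have pin : perm_eq (ins (map (nth x0 OD) Is)) (ins OD) by apply/perm_flatten/perm_map.
  have pout : perm_eq (outs (map (nth x0 OD) Is)) (outs OD) by apply/perm_flatten/perm_map.
  apply: (perm_trans pin); apply: (perm_trans oOD); by rewrite perm_sym.
- by move=> s; rewrite !addn0 /crossings; apply/permP.
Qed.

Lemma flow_map (f : nat -> nat) v pq :
  flow_in (map f v, pq) = map f (flow_in (v, pq)) /\
  flow_out (map f v, pq) = map f (flow_out (v, pq)).
Proof.
by case: pq => p q; case: v => [|a [|b [|c [|d [|? ?]]]]] //=; case: p; case: q.
Qed.

Definition map_overtex (f : nat -> nat) (w : overtex) : overtex := (map f w.1, w.2).

Lemma ins_map f OD : ins (map (map_overtex f) OD) = map f (ins OD).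
Proof.
rewrite /ins map_flatten -!map_comp; congr flatten; apply: eq_map => -[v pq].
exact: (flow_map f v pq).1.
Qed.

Lemma outs_map f OD : outs (map (map_overtex f) OD) = map f (outs OD).
Proof.
rewrite /outs map_flatten -!map_comp; congr flatten; apply: eq_map => -[v pq].
exact: (flow_map f v pq).2.
Qed.

Lemma crossings_map s f OD : crossings s (map (map_overtex f) OD) = crossings s OD.
Proof. by rewrite /crossings count_map; apply: eq_count => -[v pq] /=; rewrite size_map. Qed.

Lemma orients_relabel (f : nat -> nat) D :
  orients D (map (map f) D) no_shift no_shift.
Proof.
move=> OD eOD oOD; exists (map (map_overtex f) OD); split.
- by rewrite -eOD -!map_comp.
- by rewrite /oriented ins_map outs_map perm_map.
- by move=> s; rewrite crossings_map.
Qed.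

Ltac bits OL :=
  repeat (case: OL => [//|[? [? ?]] OL] /=); case: OL => [|//].

Lemma orients_rotX a b c d C : orients (X a b c d :: C) (X c d a b :: C) no_shift no_shift.
Proof.
apply: (@orients_local [:: _] [:: _]) => -[//|[v [p q]] [|//]] [->] _.
exists [:: (X c d a b, (~~ p, ~~ q))]; split=> //.
  by move=> e /=; case: p; case: q => /=; lia.
by move=> s; rewrite /crossings /=; case: p; case: q.
Qed.

Lemma orients_rotP a b C : orients (P a b :: C) (P b a :: C) no_shift no_shift.
Proof.
apply: (@orients_local [:: _] [:: _]) => -[//|[v [p q]] [|//]] [->] _.
exists [:: (P b a, (~~ p, q))]; split=> //.
by move=> e /=; case: p => /=; lia.
Qed.

Lemma orients_erase a b C : a != b ->
  orients (P a b :: C) (map (map (fun x => if x == b then a else x)) C) no_shift no_shift.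
Proof.
move=> ab [//|[v [p q]] OC] [-> eC] oC; rewrite /oriented /ins /outs /= in oC.
pose h x := if x == b then a else x; exists (map (map_overtex h) OC); split.
- by rewrite -eC -!map_comp.
- have := perm_map h oC; rewrite /oriented ins_map outs_map.
  have ha : h a = a by rewrite /h (negPf ab).
  have hb : h b = a by rewrite /h eqxx.
  by case: (p) => /=; rewrite ?ha ?hb perm_cons.
- by move=> s; rewrite crossings_map /crossings.
Qed.

Lemma map_overtex_zip f (C : diagram) B :
  map (map_overtex f) (zip C B) = zip (map (map f) C) B.
Proof. by elim: C B => [|v C IH] [|b B] //=; rewrite IH. Qed.

(** After the split, [a] and [b] have one end each in [C]. Conservation at the merged label says
    that one of these ends is incoming and the other outgoing, which tells the direction [p] of the
    marked point. *)
Lemma orients_unerase a b C : a != b -> is_knot_diagram (P a b :: C) ->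
  orients (map (map (fun x => if x == b then a else x)) C) (P a b :: C) no_shift no_shift.
Proof.
move=> ab /and4P[/andP[_ szC] cC _ _]; pose h x := if x == b then a else x; move=> OD eOD oOD.
have sz : size OD = size C by rewrite -(size_map fst) eOD size_map.
pose OC : seq overtex := zip C (map snd OD).
have eC : map fst OC = C by apply: unzip1_zip; rewrite size_map sz.
have eO : OD = map (map_overtex h) OC by rewrite map_overtex_zip -eOD zip_unzip.
have cnt2 e : e \in flatten (P a b :: C) -> count_mem e (flatten (P a b :: C)) = 2.
  by move=> /(allP cC)/eqP.
have ca : count_mem a (flatten C) = 1.
  have := cnt2 a; rewrite /= inE eqxx => /(_ isT); rewrite eq_sym (negPf ab); lia.
have cb : count_mem b (flatten C) = 1.
  have := cnt2 b; rewrite /= !inE eqxx orbT => /(_ isT); rewrite (negPf ab); lia.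
have fl e : count_mem e (ins OC) + count_mem e (outs OC) = count_mem e (flatten C).
  by rewrite count_flow_eq eC.
have cmap e s : count_mem e (map h s) =
    (if e == a then count_mem a s + count_mem b s
     else if e == b then 0 else count_mem e s).
  rewrite count_map; elim: s => [|x s IH]; first by case: (e == a); case: (e == b).
  rewrite [LHS]/= IH /h; case: (eqVneq e a) => [->|ea] /=.
    case: (eqVneq x b) => [->|xb]; last by lia.
    by rewrite eqxx [b == a]eq_sym (negPf ab); lia.
  case: (eqVneq e b) => [->|eb].
    by case: (eqVneq x b) => [_|xb]; rewrite ?(negPf ab) ?(negPf xb).
  case: (eqVneq x b) => [->|//].
  by rewrite [a == e]eq_sym (negPf ea) [b == e]eq_sym (negPf eb).
have cO e : count_mem e (map h (ins OC)) = count_mem e (map h (outs OC)).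
  by move: oOD; rewrite /oriented eO ins_map outs_map => /permP/(_ (pred1 e)).
pose p := count_mem a (outs OC) == 1.
exists ((P a b, (p, true)) :: OC); split; first by rewrite /= eC.
  apply/orientedP => e; rewrite /ins /outs /= -/(ins OC) -/(outs OC).
  have := cO e; rewrite !cmap.
  have := cO a; rewrite !cmap eqxx; have := fl a; have := fl b; rewrite ca cb => fb fa ab'.
  case: (eqVneq e a) => [-> _|ea].
    move: fa fb ab'; rewrite /p; case: (count_mem a (outs OC) =P 1) => /= h1;
    rewrite ?eqxx ?[b == a]eq_sym ?(negPf ab);
    move: h1 (count_mem a (ins OC)) (count_mem b (ins OC)) (count_mem b (outs OC));
    by move: (count_mem a (outs OC)) => ? ? ? ? ? ?; lia.
  case: (eqVneq e b) => [-> _|eb].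
    move: fa fb ab'; rewrite /p; case: (count_mem a (outs OC) =P 1) => /= h1;
    rewrite ?eqxx ?(negPf ab);
    move: h1 (count_mem a (ins OC)) (count_mem b (ins OC)) (count_mem b (outs OC));
    by move: (count_mem a (outs OC)) => ? ? ? ? ? ?; lia.
  by case: (p) => /=; rewrite ![_ == e]eq_sym (negPf ea) (negPf eb); lia.
by move=> s; rewrite eO crossings_map /crossings.
Qed.

Ltac bits_lia :=
  repeat match goal with
  | |- context [nat_of_bool ?b] => let n := fresh in move: (nat_of_bool b) => n
  end; clear; lia.

Lemma is_knot_fresh D e t :
  is_knot_diagram D -> perm_eq (flatten D) [:: e, e & t] -> e \notin t.
Proof.
case/and4P=> _ /allP c _ _ p; have := c e; rewrite (perm_mem p) mem_head => /(_ isT).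
rewrite (permP p) /= eqxx => /eqP h; apply/count_memPn; move: h.
by move: (count_mem e t) => n; lia.
Qed.

Lemma fresh_R1l e a b C : is_knot_diagram (X e e a b :: C) ->
  [/\ (a == e) = false, (b == e) = false & e \notin flatten C].
Proof.
move=> k; have /(is_knot_fresh k) : perm_eq (flatten (X e e a b :: C)) [:: e, e, a, b & flatten C] by [].
by rewrite !inE !negb_or => /and3P[]; rewrite ![e == _]eq_sym => /negPf-> /negPf->.
Qed.

Lemma fresh_R1r e a b C : is_knot_diagram (X a e e b :: C) ->
  [/\ (a == e) = false, (b == e) = false & e \notin flatten C].
Proof.
move=> k; have /(is_knot_fresh k) : perm_eq (flatten (X a e e b :: C)) [:: e, e, a, b & flatten C].
  by apply/permP => Q /=; bits_lia.
by rewrite !inE !negb_or => /and3P[]; rewrite ![e == _]eq_sym => /negPf-> /negPf->.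
Qed.

Lemma fresh_R2 a b c d e f C : is_knot_diagram [:: X c e f a, X f e d b & C] ->
  [/\ [/\ (a == e) = false, (b == e) = false, (c == e) = false & (d == e) = false],
      [/\ (a == f) = false, (b == f) = false, (c == f) = false & (d == f) = false],
      (e == f) = false, e \notin flatten C & f \notin flatten C].
Proof.
move=> k.
have /(is_knot_fresh k) : perm_eq (flatten [:: X c e f a, X f e d b & C])
  [:: e, e, c, f, a, f, d, b & flatten C] by apply/permP => Q /=; bits_lia.
have /(is_knot_fresh k) : perm_eq (flatten [:: X c e f a, X f e d b & C])
  [:: f, f, c, e, a, e, d, b & flatten C] by apply/permP => Q /=; bits_lia.
have ns (x y : nat) : x != y -> (y == x) = false by rewrite eq_sym => /negPf.
rewrite !inE !negb_or => /and5P[fc fe fa _ /and3P[fd fb fC]].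
move=> /and5P[ec _ ea _ /and3P[ed eb eC]].
by split=> //; [split; apply: ns | split; apply: ns | apply: ns].
Qed.

(** Conservation at the loop [e] leaves two of the four pairs of bits, the two directions of the
    strand, and the crossing is positive for both. *)
Lemma orients_R1l e a b C : is_knot_diagram (X e e a b :: C) ->
  orients (X e e a b :: C) (P a b :: C) nat_of_bool no_shift.
Proof.
move=> /fresh_R1l[ae be eC]; apply: (@orients_local [:: _] [:: _]) => -[//|[v [p q]] [|//]] [->].
move=> /(_ e eC) /= cO; exists [:: (P a b, (q, true))]; split=> //.
  by move=> x; move: cO; case: p; case: q => /=; rewrite ?eqxx ?ae ?be //; lia.
by move: cO; case: p; case: q => /=; rewrite ?eqxx ?ae ?be // => _ [].
Qed.

Lemma orients_R1l' e a b C : orients (P a b :: C) (X e e a b :: C) no_shift nat_of_bool.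
Proof.
apply: (@orients_local [:: _] [:: _]) => -[//|[v [p q]] [|//]] [->] _.
exists [:: (X e e a b, (~~ p, p))]; split=> //.
  by move=> x; case: p => /=; lia.
by case: p => -[].
Qed.

Definition neg_shift (s : bool) : nat := ~~ s.

Lemma orients_R1r e a b C : is_knot_diagram (X a e e b :: C) ->
  orients (X a e e b :: C) (P a b :: C) neg_shift no_shift.
Proof.
move=> /fresh_R1r[ae be eC]; apply: (@orients_local [:: _] [:: _]) => -[//|[v [p q]] [|//]] [->].
move=> /(_ e eC) /= cO; exists [:: (P a b, (p, true))]; split=> //.
  by move=> x; move: cO; case: p; case: q => /=; rewrite ?eqxx ?ae ?be //; lia.
by move: cO; case: p; case: q => /=; rewrite ?eqxx ?ae ?be // => _ [].
Qed.

Lemma orients_R1r' e a b C : orients (P a b :: C) (X a e e b :: C) no_shift neg_shift.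
Proof.
apply: (@orients_local [:: _] [:: _]) => -[//|[v [p q]] [|//]] [->] _.
exists [:: (X a e e b, (p, p))]; split=> //.
  by move=> x; case: p => /=; lia.
by case: p => -[].
Qed.

Definition one_shift (s : bool) : nat := 1.

(** Whatever the directions of the two arcs, the crossings of the bigon have opposite signs. *)
Lemma orients_R2 a b c d e f C : is_knot_diagram [:: X c e f a, X f e d b & C] ->
  orients [:: X c e f a, X f e d b & C] [:: P a b, P c d & C] one_shift no_shift.
Proof.
move=> /fresh_R2[[ae be ce de] [af bf cf df] ef eC fC].
apply: (@orients_local [:: _; _] [:: _; _]) => -[//|[v [p q]] [//|[v' [p' q']] [|//]]] [-> ->] cO.
move: (cO e eC) (cO f fC) => {cO} /= ce' cf'.
exists [:: (P a b, (q', true)); (P c d, (p, true))]; split=> //.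
  move=> x; move: ce' cf'; case: p; case: q; case: p'; case: q' => /=;
  by rewrite ?eqxx ?[f == e]eq_sym ?ae ?be ?ce ?de ?af ?bf ?cf ?df ?ef //=; lia.
move: ce' cf'; case: p; case: q; case: p'; case: q' => /=;
by rewrite ?eqxx ?[f == e]eq_sym ?ae ?be ?ce ?de ?af ?bf ?cf ?df ?ef //= => _ _ [].
Qed.

Lemma orients_R2' a b c d e f C :
  orients [:: P a b, P c d & C] [:: X c e f a, X f e d b & C] no_shift one_shift.
Proof.
apply: (@orients_local [:: _; _] [:: _; _]) => -[//|[v [p q]] [//|[v' [r q']] [|//]]] [-> ->] _.
exists [:: (X c e f a, (r, ~~ p)); (X f e d b, (r, p))]; split=> //.
  by move=> x; case: p; case: r => /=; lia.
by case: p; case: r => -[].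
Qed.

Lemma notin_cat3 (e : nat) (s1 s2 s3 : seq nat) :
  e \notin s1 ++ s2 ++ s3 -> e \notin s1 /\ e \notin s3.
Proof. by rewrite !mem_cat !negb_or => /and3P[]. Qed.

Lemma notin8 (e a b c d f g h i : nat) : e \notin [:: a; b; c; d; f; g; h; i] ->
  ((a == e) = false) * ((b == e) = false) * ((c == e) = false) * ((d == e) = false) *
  ((f == e) = false) * ((g == e) = false) * ((h == e) = false) * ((i == e) = false).
Proof.
have ns (x : nat) : e != x -> (x == e) = false by rewrite eq_sym => /negPf.
rewrite !inE !negb_or => /and5P[/ns-> /ns-> /ns-> /ns-> /and4P[/ns-> /ns-> /ns-> /ns->]].
by [].
Qed.

Section Triangle.

Variables (t1 t2 t3 m1 m2 m3 u1 u2 u3 : nat) (C : diagram).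

Definition triangle_fresh : Prop :=
  [/\ [/\ t2 \notin [:: t1; t3; m1; m2; m3; u1; u2; u3], m2 \notin [:: t1; t2; t3; m1; m3; u1; u2; u3]
        & u2 \notin [:: t1; t2; t3; m1; m2; m3; u1; u3]],
      t2 \notin flatten C, m2 \notin flatten C & u2 \notin flatten C].

Lemma triangle_freshP D : is_knot_diagram D ->
  perm_eq (flatten D) ([:: t1; t2; t2; t3; m1; m2; m2; m3; u1; u2; u2; u3] ++ flatten C) ->
  triangle_fresh.
Proof.
move=> k p.
have /(is_knot_fresh k) : perm_eq (flatten D) [:: t2, t2 &
    [:: t1; t3; m1; m2; m3; u1; u2; u3] ++ [:: m2; u2] ++ flatten C].
  by apply: (perm_trans p); apply/permP => Q /=; bits_lia.
have /(is_knot_fresh k) : perm_eq (flatten D) [:: m2, m2 &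
    [:: t1; t2; t3; m1; m3; u1; u2; u3] ++ [:: t2; u2] ++ flatten C].
  by apply: (perm_trans p); apply/permP => Q /=; bits_lia.
have /(is_knot_fresh k) : perm_eq (flatten D) [:: u2, u2 &
    [:: t1; t2; t3; m1; m2; m3; u1; u3] ++ [:: t2; m2] ++ flatten C].
  by apply: (perm_trans p); apply/permP => Q /=; bits_lia.
by move=> /notin_cat3[h1 h2] /notin_cat3[h3 h4] /notin_cat3[h5 h6]; split=> //; split.
Qed.

End Triangle.

Lemma if_neq (e a b : nat) (p : bool) :
  (a == e) = false -> (b == e) = false -> ((if p then a else b) == e) = false.
Proof. by case: p. Qed.

(* The flow is conserved at the inner edges t2, m2, u2, so the three strands keep *)
(* their directions; with the same bits on the other side, signs do not change.   *)
Lemma orients_R3l t1 t2 t3 m1 m2 m3 u1 u2 u3 C :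
  triangle_fresh t1 t2 t3 m1 m2 m3 u1 u2 u3 C ->
  orients [:: X m1 t2 m2 t1, X u1 t3 u2 t2, X u2 m3 u3 m2 & C]
          [:: X m2 t3 m3 t2, X u2 t2 u3 t1, X u1 m2 u2 m1 & C] no_shift no_shift.
Proof.
case=> -[/notin8 ft /notin8 fm /notin8 fu] tC mC uC.
apply: (@orients_local [:: _; _; _] [:: _; _; _]).
move=> [//|[? [p1 q1]] [//|[? [p2 q2]] [//|[? [p3 q3]] [|//]]]] [-> -> ->] cO.
exists [:: (X m2 t3 m3 t2, (p1, q1)); (X u2 t2 u3 t1, (p2, q2)); (X u1 m2 u2 m1, (p3, q3))].
split=> //.
move: (cO _ tC) (cO _ mC) (cO _ uC) => {cO} /=.
rewrite ?(@if_neq t2 m1 m2) ?(@if_neq t2 u1 u2) ?(@if_neq t2 u2 u3) ?(@if_neq t2 m3 m2) ?ft //.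
rewrite ?(@if_neq m2 t2 t1) ?(@if_neq m2 u1 u2) ?(@if_neq m2 t3 t2) ?(@if_neq m2 u2 u3) ?fm //.
rewrite ?(@if_neq u2 m1 m2) ?(@if_neq u2 t2 t1) ?(@if_neq u2 t3 t2) ?(@if_neq u2 m3 m2) ?fu //.
move=> ht hm hu.
have e1 : q2 = q1 by move: ht; case: (q1); case: (q2) => /=; rewrite ?eqxx ?ft.
have e2 : q3 = ~~ p1 by move: hm; case: (p1); case: (q3) => /=; rewrite ?eqxx ?fm.
have e3 : p3 = p2 by move: hu; case: (p2); case: (p3) => /=; rewrite ?eqxx ?fu.
rewrite e1 e2 e3 => e.
by case: (p1); case: (q1); case: (p2) => /=; bits_lia.
Qed.

Lemma orients_R3l' t1 t2 t3 m1 m2 m3 u1 u2 u3 C :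
  triangle_fresh t1 t2 t3 m1 m2 m3 u1 u2 u3 C ->
  orients [:: X m2 t3 m3 t2, X u2 t2 u3 t1, X u1 m2 u2 m1 & C]
          [:: X m1 t2 m2 t1, X u1 t3 u2 t2, X u2 m3 u3 m2 & C] no_shift no_shift.
Proof.
case=> -[/notin8 ft /notin8 fm /notin8 fu] tC mC uC.
apply: (@orients_local [:: _; _; _] [:: _; _; _]).
move=> [//|[? [p1 q1]] [//|[? [p2 q2]] [//|[? [p3 q3]] [|//]]]] [-> -> ->] cO.
exists [:: (X m1 t2 m2 t1, (p1, q1)); (X u1 t3 u2 t2, (p2, q2)); (X u2 m3 u3 m2, (p3, q3))].
split=> //.
move: (cO _ tC) (cO _ mC) (cO _ uC) => {cO} /=.
rewrite ?(@if_neq t2 m2 m3) ?(@if_neq t2 u2 u3) ?(@if_neq t2 u1 u2) ?(@if_neq t2 m2 m1) ?ft //.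
rewrite ?(@if_neq m2 t3 t2) ?(@if_neq m2 u2 u3) ?(@if_neq m2 t2 t1) ?(@if_neq m2 u1 u2) ?fm //.
rewrite ?(@if_neq u2 m2 m3) ?(@if_neq u2 t3 t2) ?(@if_neq u2 t2 t1) ?(@if_neq u2 m2 m1) ?fu //.
move=> ht hm hu.
have e1 : q2 = q1 by move: ht; case: (q1); case: (q2) => /=; rewrite ?eqxx ?ft.
have e2 : q3 = ~~ p1 by move: hm; case: (p1); case: (q3) => /=; rewrite ?eqxx ?fm.
have e3 : p3 = p2 by move: hu; case: (p2); case: (p3) => /=; rewrite ?eqxx ?fu.
rewrite e1 e2 e3 => e.
by case: (p1); case: (q1); case: (p2) => /=; bits_lia.
Qed.

Lemma orients_R3r t1 t2 t3 m1 m2 m3 u1 u2 u3 C :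
  triangle_fresh t1 t2 t3 m1 m2 m3 u1 u2 u3 C ->
  orients [:: X m1 t2 m2 t1, X u1 t3 u2 t2, X m2 u2 m3 u3 & C]
          [:: X m2 t3 m3 t2, X u2 t2 u3 t1, X m1 u1 m2 u2 & C] no_shift no_shift.
Proof.
case=> -[/notin8 ft /notin8 fm /notin8 fu] tC mC uC.
apply: (@orients_local [:: _; _; _] [:: _; _; _]).
move=> [//|[? [p1 q1]] [//|[? [p2 q2]] [//|[? [p3 q3]] [|//]]]] [-> -> ->] cO.
exists [:: (X m2 t3 m3 t2, (p1, q1)); (X u2 t2 u3 t1, (p2, q2)); (X m1 u1 m2 u2, (p3, q3))].
split=> //.
move: (cO _ tC) (cO _ mC) (cO _ uC) => {cO} /=.
rewrite ?(@if_neq t2 m1 m2) ?(@if_neq t2 u1 u2) ?(@if_neq t2 m2 m3) ?(@if_neq t2 u2 u3) ?ft //.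
rewrite ?(@if_neq m2 t2 t1) ?(@if_neq m2 u1 u2) ?(@if_neq m2 t3 t2) ?(@if_neq m2 u2 u3) ?fm //.
rewrite ?(@if_neq u2 m1 m2) ?(@if_neq u2 t2 t1) ?(@if_neq u2 t3 t2) ?(@if_neq u2 m2 m3) ?fu //.
move=> ht hm hu.
have e1 : q2 = q1 by move: ht; case: (q1); case: (q2) => /=; rewrite ?eqxx ?ft.
have e2 : p3 = p1 by move: hm; case: (p1); case: (p3) => /=; rewrite ?eqxx ?fm.
have e3 : q3 = p2 by move: hu; case: (p2); case: (q3) => /=; rewrite ?eqxx ?fu.
rewrite e1 e2 e3 => e.
by case: (p1); case: (q1); case: (p2) => /=; bits_lia.
Qed.

Lemma orients_R3r' t1 t2 t3 m1 m2 m3 u1 u2 u3 C :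
  triangle_fresh t1 t2 t3 m1 m2 m3 u1 u2 u3 C ->
  orients [:: X m2 t3 m3 t2, X u2 t2 u3 t1, X m1 u1 m2 u2 & C]
          [:: X m1 t2 m2 t1, X u1 t3 u2 t2, X m2 u2 m3 u3 & C] no_shift no_shift.
Proof.
case=> -[/notin8 ft /notin8 fm /notin8 fu] tC mC uC.
apply: (@orients_local [:: _; _; _] [:: _; _; _]).
move=> [//|[? [p1 q1]] [//|[? [p2 q2]] [//|[? [p3 q3]] [|//]]]] [-> -> ->] cO.
exists [:: (X m1 t2 m2 t1, (p1, q1)); (X u1 t3 u2 t2, (p2, q2)); (X m2 u2 m3 u3, (p3, q3))].
split=> //.
move: (cO _ tC) (cO _ mC) (cO _ uC) => {cO} /=.
rewrite ?(@if_neq t2 m2 m3) ?(@if_neq t2 u2 u3) ?(@if_neq t2 m1 m2) ?(@if_neq t2 u1 u2) ?ft //.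
rewrite ?(@if_neq m2 t3 t2) ?(@if_neq m2 u2 u3) ?(@if_neq m2 t2 t1) ?(@if_neq m2 u1 u2) ?fm //.
rewrite ?(@if_neq u2 m2 m3) ?(@if_neq u2 t3 t2) ?(@if_neq u2 t2 t1) ?(@if_neq u2 m1 m2) ?fu //.
move=> ht hm hu.
have e1 : q2 = q1 by move: ht; case: (q1); case: (q2) => /=; rewrite ?eqxx ?ft.
have e2 : p3 = p1 by move: hm; case: (p1); case: (p3) => /=; rewrite ?eqxx ?fm.
have e3 : q3 = p2 by move: hu; case: (p2); case: (q3) => /=; rewrite ?eqxx ?fu.
rewrite e1 e2 e3 => e.
by case: (p1); case: (q1); case: (p2) => /=; bits_lia.
Qed.

Local Open Scope ring_scope.

(** * Invariance of the index of the form *)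

Definition same_index (D D' : diagram) (d : bool -> nat) : Prop :=
  forall s k, Pos s D k <-> Pos s D' (k + d s)%N.

Lemma Pos_id s D D' k :
  (forall x, balanced_on D x -> balanced_on D' x /\ sg s * form D x <= sg s * form D' x) ->
  Pos s D k -> Pos s D' k.
Proof. exact: (Pos_op linear_id). Qed.

Lemma same_index_id D D' :
  (forall x, balanced_on D x = balanced_on D' x) -> (forall x, form D x = form D' x) ->
  same_index D D' no_shift.
Proof.
by move=> h1 h2 s k; rewrite addn0; split; apply: Pos_id => x; rewrite h1 h2.
Qed.

Lemma same_index_perm D D' : perm_eq D D' -> same_index D D' no_shift.
Proof.
move=> p; apply: same_index_id => x; first exact: perm_all.
exact: perm_big.
Qed.

Lemma same_index_rotX a b c d C : same_index (X a b c d :: C) (X c d a b :: C) no_shift.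
Proof.
apply: same_index_id => x; rewrite ?form_cons /balanced_on /= ?energyE.
  by rewrite addrC [x b + x d]addrC.
by congr (_ + _); ring.
Qed.

Lemma same_index_rotP a b C : same_index (P a b :: C) (P b a :: C) no_shift.
Proof.
by apply: same_index_id => x; rewrite ?form_cons /balanced_on //= eq_sym.
Qed.

Lemma linear_comp (f : nat -> nat) : linear_op (fun x n => x (f n)).
Proof. by move=> a x y z h n; apply: h. Qed.

Lemma same_index_relabel (f : nat -> nat) D : {in flatten D &, injective f} ->
  same_index D (map (map f) D) no_shift.
Proof.
move=> fI s k; rewrite addn0.
pose g m := nth 0%N (flatten D) (index m (map f (flatten D))).
have gK : {in flatten D, cancel f g}.
  move=> n nD; apply: fI => //.
    by apply: mem_nth; rewrite -(size_map f) index_mem map_f.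
  rewrite -(nth_map _ (f 0%N)); last by rewrite -(size_map f) index_mem map_f.
  by rewrite nth_index // map_f.
split.
  apply: (Pos_op (linear_comp g)) => x bx; rewrite balanced_on_map form_map.
  have e : {in flatten D, (fun n => x (g n)) \o f =1 x} by move=> n /gK /= ->.
  by rewrite (balanced_on_ext e) (form_ext e).
apply: (Pos_op (linear_comp f)) => x.
by rewrite balanced_on_map form_map.
Qed.

Lemma same_index_erase a b C : a != b ->
  same_index (P a b :: C) (map (map (fun x => if x == b then a else x)) C) no_shift.
Proof.
move=> ab s k; rewrite addn0; pose h x := if x == b then a else x.
rewrite -/h; split.
  apply: Pos_id => x; rewrite balanced_on_cons balancedP => /andP[/eqP xab bC]; rewrite balanced_on_map form_map form_cons energyP add0r.
  have e : {in flatten C, x \o h =1 x}.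
    by move=> n _ /=; rewrite /h; case: eqP => // ->.
  by rewrite (balanced_on_ext e) (form_ext e).
apply: (Pos_op (linear_comp h)) => x; rewrite balanced_on_map form_map form_cons energyP add0r.
by move=> bC; split=> //; apply/andP; split=> //=; rewrite /h (negPf ab) eqxx.
Qed.

Definition upd (x : nat -> rat) (e : nat) (v : rat) (n : nat) : rat :=
  if n == e then v else x n.

Lemma linear_upd e (phi : (nat -> rat) -> rat) :
  (forall a x y z, (forall n, z n = a * x n + y n) -> phi z = a * phi x + phi y) ->
  linear_op (fun x => upd x e (phi x)).
Proof. by move=> lp a x y z h n; rewrite /upd; case: eqP => // _; apply: lp. Qed.

Lemma upd_notin x e v C : e \notin flatten C -> {in flatten C, upd x e v =1 x}.
Proof. by move=> eC n nC; rewrite /upd; case: eqP => // en; rewrite -en nC in eC. Qed.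

(** The equation at the kink gives [x a = x b], and its energy is the square of [x e - x a] with
    [x e] free: one new positive square and no negative one. *)
Lemma same_index_R1l e a b C : is_knot_diagram (X e e a b :: C) ->
  same_index (P a b :: C) (X e e a b :: C) nat_of_bool.
Proof.
move=> /fresh_R1l[ae be eC] s k.
have linT : linear_op (fun x => upd x e (x a)) by apply: linear_upd => c x y z ->.
case: s; rewrite ?addn1 ?addn0; split.
- apply: (@Pos_add _ _ _ _ _ (fun n => (n == e)%:R) linT) => x c; rewrite balanced_on_cons balancedP => /andP[/eqP xab bC].
  set y := fun n => _; have ey : {in flatten C, y =1 x}.
    move=> n nC; rewrite /y (upd_notin _ _ eC) //.
    by case: eqP => [en|_]; [rewrite en (negPf eC) in nC | rewrite mulr0 addr0].
  rewrite !form_cons energyE energyP balanced_on_cons balancedX.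
  rewrite (balanced_on_ext ey) (form_ext ey) bC /y /upd eqxx ae be xab eqxx /=.
  by split=> //; rewrite /sg; ring.
- apply: (@Pos_cut _ _ _ _ e a) => x; rewrite !balanced_on_cons balancedX balancedP => /andP[/eqP bx bC] xea.
  rewrite !form_cons energyE energyP xea subrr mul0r; split=> //.
  by rewrite bC andbT; apply/eqP; move: bx; lra.
- apply: (Pos_op linT) => x; rewrite balanced_on_cons balancedP => /andP[/eqP xab bC].
  have ey := upd_notin x (x a) eC.
  rewrite !form_cons energyE energyP balanced_on_cons balancedX.
  rewrite (balanced_on_ext ey) (form_ext ey) bC /upd eqxx ae be xab eqxx /=.
  by rewrite subrr mul0r.
- apply: Pos_id => x; rewrite !balanced_on_cons balancedX balancedP => /andP[/eqP bx bC]; rewrite !form_cons energyE energyP.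
  have xab : x a = x b by move: bx; lra.
  split; first by rewrite xab eqxx.
  by rewrite /sg xab; have := sqr_ge0 (x e - x b); rewrite expr2; lra.
Qed.

Lemma same_index_R1r e a b C : is_knot_diagram (X a e e b :: C) ->
  same_index (P a b :: C) (X a e e b :: C) neg_shift.
Proof.
move=> /fresh_R1r[ae be eC] s k; rewrite /neg_shift.
have linT : linear_op (fun x => upd x e (x a)) by apply: linear_upd => c x y z ->.
case: s; rewrite ?addn1 ?addn0; split.
- apply: (Pos_op linT) => x; rewrite balanced_on_cons balancedP => /andP[/eqP xab bC].
  have ey := upd_notin x (x a) eC.
  rewrite !form_cons energyE energyP balanced_on_cons balancedX.
  rewrite (balanced_on_ext ey) (form_ext ey) bC /upd eqxx ae be xab eqxx /=.
  by rewrite subrr mul0r.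
- apply: Pos_id => x; rewrite !balanced_on_cons balancedX balancedP => /andP[/eqP bx bC]; rewrite !form_cons energyE energyP.
  have xab : x a = x b by move: bx; lra.
  split; first by rewrite xab eqxx.
  by rewrite /sg xab; have := sqr_ge0 (x e - x b); rewrite expr2; lra.
- apply: (@Pos_add _ _ _ _ _ (fun n => (n == e)%:R) linT) => x c; rewrite balanced_on_cons balancedP => /andP[/eqP xab bC].
  set y := fun n => _; have ey : {in flatten C, y =1 x}.
    move=> n nC; rewrite /y (upd_notin _ _ eC) //.
    by case: eqP => [en|_]; [rewrite en (negPf eC) in nC | rewrite mulr0 addr0].
  rewrite !form_cons energyE energyP balanced_on_cons balancedX.
  rewrite (balanced_on_ext ey) (form_ext ey) bC /y /upd eqxx ae be xab andbT /=.
  split; first by apply/eqP; ring.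
  by rewrite /sg; ring.
- apply: (@Pos_cut _ _ _ _ e a) => x; rewrite !balanced_on_cons balancedX balancedP => /andP[/eqP bx bC] xea.
  rewrite !form_cons energyE energyP xea subrr mul0r; split=> //.
  by rewrite bC andbT; apply/eqP; move: bx; lra.
Qed.

Section Bigon.

Variables (a b c d e f : nat) (C : diagram).
Hypothesis knotD : is_knot_diagram [:: X c e f a, X f e d b & C].

Let D := [:: P a b, P c d & C].
Let D' := [:: X c e f a, X f e d b & C].

(** The bigon contributes a product of [x a - x b] with a factor in which [x f] is free: a
    hyperbolic plane, unless [x a - x b] vanishes identically. *)
Lemma bigon_form x : balanced_on D' x ->
  x c - x d = x a - x b /\
  form D' x = (x a - x b) * (2 * x f - x a - x b) + form C x.
Proof.
rewrite !balanced_on_cons !balancedX !form_cons !energyE => /and3P[/eqP h1 /eqP h2 _].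
have ex : x e = x c + x f - x a by move: h1; lra.
have dx : x d = x c + x b - x a by move: h2; rewrite ex; lra.
by rewrite ex dx; split; ring.
Qed.

Lemma bigon_restrict x : balanced_on D' x -> x a = x b ->
  balanced_on D x /\ form D' x = form D x.
Proof.
move=> bx ab; have [cd ->] := bigon_form bx; move: bx.
rewrite !balanced_on_cons !balancedP !form_cons !energyP ab => /and3P[_ _ ->].
rewrite subrr mul0r !add0r eqxx /=; split=> //; rewrite andbT.
by apply/eqP; move: cd; rewrite ab; lra.
Qed.

(* The edges e, f of the bigon get the values x c + phi x and x a + phi x. *)
Definition bigon_extend (phi : (nat -> rat) -> rat) (x : nat -> rat) : nat -> rat :=
  upd (upd x f (x a + phi x)) e (x c + phi x).

Lemma linear_bigon_extend phi :
  (forall a x y z, (forall n, z n = a * x n + y n) -> phi z = a * phi x + phi y) ->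
  linear_op (bigon_extend phi).
Proof.
move=> lp k x y z h n; rewrite /bigon_extend /upd.
case: (n == e); first by rewrite h (lp _ _ _ _ h); ring.
by case: (n == f); [rewrite h (lp _ _ _ _ h); ring | apply: h].
Qed.

(** Either the bigon adds a hyperbolic plane, that is, one square of each sign, or only the radical
    grows. The counts for the two signs shift equally in both cases, and only their difference
    enters the signature. *)
Lemma same_index_R2 : same_index D D' one_shift \/ same_index D D' no_shift.
Proof.
have [[ae be ce de] [af bf cf df] ef eC fC] := fresh_R2 knotD.
have fe : (f == e) = false by rewrite eq_sym.
have [[w bw wab]|nw] := classic (exists2 w, balanced_on D' w & w a <> w b).
  left=> s k; rewrite addn1; split; last first.
    apply: (@Pos_cut _ _ _ _ a b) => x bx ab.
    by have [-> ->] := bigon_restrict bx ab.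
  pose al := w a - w b.
  have al0 : al != 0 by rewrite subr_eq0; apply/eqP.
  (* Solved from the formula of [bigon_form]: [mu] makes the extension of [x] orthogonal to [v], and
     [la] gives [v] the square [sg s]. *)
  pose mu x := - polar C x w / (2 * al).
  pose la := ((sg s - form C w) / al - (2 * w f - w a - w b)) / 2.
  pose v n := w n + la * ((n == e) || (n == f))%:R.
  have linT : linear_op (bigon_extend mu).
    apply: linear_bigon_extend => k' x y z h; rewrite /mu (polar_linear _ _ h).
    by field.
  apply: (@Pos_add _ _ _ _ _ v linT) => x r.
  rewrite !balanced_on_cons !balancedP => /and3P[/eqP xab /eqP xcd bC].
  set y := fun n => _.
  have ey : {in flatten C, y =1 fun n => x n + r * w n}.
    move=> n nC; have ne : (n == e) = false by apply/eqP => h; rewrite -h nC in eC.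
    have nf : (n == f) = false by apply/eqP => h; rewrite -h nC in fC.
    by rewrite /y /bigon_extend /upd /v ne nf mulr0 addr0.
  have ya : y a = x a + r * w a by rewrite /y /bigon_extend /upd /v ae af mulr0 addr0.
  have yb : y b = x a + r * w b by rewrite /y /bigon_extend /upd /v be bf mulr0 addr0 xab.
  have yc : y c = x c + r * w c by rewrite /y /bigon_extend /upd /v ce cf mulr0 addr0.
  have yd : y d = x c + r * w d by rewrite /y /bigon_extend /upd /v de df mulr0 addr0 xcd.
  have ye : y e = x c + mu x + r * (w e + la).
    by rewrite /y /bigon_extend /upd /v eqxx /= mulr1.
  have yf : y f = x a + mu x + r * (w f + la).
    by rewrite /y /bigon_extend /upd /v eqxx fe /= mulr1.
  have by_ : balanced_on D' y.
    move: bw; rewrite !balanced_on_cons !balancedX => /and3P[/eqP w1 /eqP w2 wC].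
    rewrite (balanced_on_ext ey) balanced_onD // andbT ya yb yc yd ye yf.
    have we : w e = w c + w f - w a by move: w1; lra.
    have wd : w d = w c + w b - w a by move: w2; rewrite we; lra.
    by apply/andP; split; apply/eqP; rewrite ?wd we; ring.
  split=> //; have [_ ->] := bigon_form by_.
  rewrite (form_ext ey) form_polar !form_cons !energyP !add0r ya yb yf.
  have -> : x a + r * w a - (x a + r * w b) = r * al by rewrite /al; ring.
  rewrite /mu /la; field.
  by rewrite al0.
right=> s k; rewrite addn0.
have ab x : balanced_on D' x -> x a = x b.
  by move=> bx; apply: NNPP => h; apply: nw; exists x.
split; last first.
  by apply: Pos_id => x bx; have [-> ->] := bigon_restrict bx (ab _ bx).
have linT : linear_op (bigon_extend (fun=> 0)).
  by apply: linear_bigon_extend => *; rewrite mulr0 addr0.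
apply: (Pos_op linT) => x.
rewrite !balanced_on_cons !balancedP => /and3P[/eqP xab /eqP xcd bC].
set y := bigon_extend _ x.
have ey : {in flatten C, y =1 x}.
  move=> n nC; have ne : (n == e) = false by apply/eqP => h; rewrite -h nC in eC.
  have nf : (n == f) = false by apply/eqP => h; rewrite -h nC in fC.
  by rewrite /y /bigon_extend /upd ne nf.
have ya : y a = x a by rewrite /y /bigon_extend /upd ae af.
have yb : y b = x a by rewrite /y /bigon_extend /upd be bf xab.
have yc : y c = x c by rewrite /y /bigon_extend /upd ce cf.
have yd : y d = x c by rewrite /y /bigon_extend /upd de df xcd.
have ye : y e = x c by rewrite /y /bigon_extend /upd eqxx addr0.
have yf : y f = x a by rewrite /y /bigon_extend /upd eqxx fe addr0.
rewrite !balancedX !form_cons !energyE !energyP (form_ext ey).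
rewrite (balanced_on_ext ey) bC ya yb yc yd ye yf [x a + x c]addrC !eqxx; split=> //.
by have -> : (x c - x a) * (x c - x a) + ((x a - x c) * (x c - x a) + form C x) =
  0 + (0 + form C x) by ring.
Qed.

End Bigon.

Section TriangleIndex.

Variables (t1 t2 t3 m1 m2 m3 u1 u2 u3 : nat) (C : diagram).
Hypothesis fresh : triangle_fresh t1 t2 t3 m1 m2 m3 u1 u2 u3 C.

Definition triangle_extend (ft fm fu : (nat -> rat) -> rat) (x : nat -> rat) : nat -> rat :=
  upd (upd (upd x t2 (ft x)) m2 (fm x)) u2 (fu x).

Let linear_functional (phi : (nat -> rat) -> rat) :=
  forall a x y z, (forall n, z n = a * x n + y n) -> phi z = a * phi x + phi y.

Lemma linear_triangle_extend ft fm fu :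
  linear_functional ft -> linear_functional fm -> linear_functional fu ->
  linear_op (triangle_extend ft fm fu).
Proof.
move=> h1 h2 h3 k x y z h n; rewrite /triangle_extend /upd.
case: (n == u2); first exact: h3.
case: (n == m2); first exact: h2.
by case: (n == t2); [apply: h1 | apply: h].
Qed.

Lemma triangle_extendE ft fm fu x (y := triangle_extend ft fm fu x) :
  [/\ {in flatten C, y =1 x},
      [/\ y t1 = x t1, y t3 = x t3, y m1 = x m1 & y m3 = x m3],
      [/\ y u1 = x u1 & y u3 = x u3]
    & [/\ y t2 = ft x, y m2 = fm x & y u2 = fu x]].
Proof.
case: fresh => -[/notin8 nt /notin8 nm /notin8 nu] tC mC uC.
rewrite /y /triangle_extend /upd !nu !nm !nt !eqxx; split=> //.
move=> n nC.
have -> : (n == u2) = false by apply/eqP => h; rewrite -h nC in uC.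
have -> : (n == m2) = false by apply/eqP => h; rewrite -h nC in mC.
by have -> : (n == t2) = false by apply/eqP => h; rewrite -h nC in tC.
Qed.

Let L := [:: X m1 t2 m2 t1, X u1 t3 u2 t2, X u2 m3 u3 m2 & C].
Let L' := [:: X m2 t3 m3 t2, X u2 t2 u3 t1, X u1 m2 u2 m1 & C].
Let R := [:: X m1 t2 m2 t1, X u1 t3 u2 t2, X m2 u2 m3 u3 & C].
Let R' := [:: X m2 t3 m3 t2, X u2 t2 u3 t1, X m1 u1 m2 u2 & C].

(** Outer edges keep their values. The equations leave one inner value to choose: [fm] is chosen so
    that the forms agree, and [ft] and [fu] then follow from the first two crossings of the new
    triangle. *)
Lemma same_index_R3l : same_index L L' no_shift.
Proof.
move=> s k; rewrite addn0; split.
  pose fm x : rat := x m1 + x m3 - x m2.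
  pose ft x : rat := fm x + x m3 - x t3.
  pose fu x : rat := ft x + x t1 - x u3.
  have linT : linear_op (triangle_extend ft fm fu).
    by apply: linear_triangle_extend => a x y z h; rewrite /fu /ft /fm !h; ring.
  apply: (Pos_op linT) => x; have := triangle_extendE ft fm fu x.
  set y := triangle_extend _ _ _ x => -[ey [y1 y2 y3 y4] [y5 y6] [y7 y8 y9]].
  rewrite !balanced_on_cons !balancedX !form_cons !energyE (balanced_on_ext ey) (form_ext ey).
  rewrite y1 y2 y3 y4 y5 y6 y7 y8 y9 /fu /ft /fm => /and4P[/eqP h1 /eqP h2 /eqP h3 ->].
  have e1 : x t2 = x m1 + x m2 - x t1 by move: h1; lra.
  have e2 : x u2 = x t3 + x m1 + x m2 - x t1 - x u1 by move: h2; rewrite e1; lra.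
  have e3 : x m3 = x t3 + x m1 - x t1 - x u1 + x u3 by move: h3; rewrite e2; lra.
  rewrite e1 e2 e3; split; first by rewrite andbT; apply/and3P; split; apply/eqP; ring.
  by rewrite le_eqVlt; apply/orP; left; apply/eqP; ring.
pose fm x : rat := x m1 + x m3 - x m2.
pose ft x : rat := x m1 + fm x - x t1.
pose fu x : rat := ft x + x t3 - x u1.
have linT : linear_op (triangle_extend ft fm fu).
  by apply: linear_triangle_extend => a x y z h; rewrite /fu /ft /fm !h; ring.
apply: (Pos_op linT) => x; have := triangle_extendE ft fm fu x.
set y := triangle_extend _ _ _ x => -[ey [y1 y2 y3 y4] [y5 y6] [y7 y8 y9]].
rewrite !balanced_on_cons !balancedX !form_cons !energyE (balanced_on_ext ey) (form_ext ey).
rewrite y1 y2 y3 y4 y5 y6 y7 y8 y9 /fu /ft /fm => /and4P[/eqP h1 /eqP h2 /eqP h3 ->].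
have e1 : x t2 = x m2 + x m3 - x t3 by move: h1; lra.
have e2 : x u2 = x m2 + x m3 - x t3 + x t1 - x u3 by move: h2; rewrite e1; lra.
have e3 : x m1 = x u1 + x m3 - x t3 + x t1 - x u3 by move: h3; rewrite e2; lra.
rewrite e1 e2 e3; split; first by rewrite andbT; apply/and3P; split; apply/eqP; ring.
by rewrite le_eqVlt; apply/orP; left; apply/eqP; ring.
Qed.

Lemma same_index_R3r : same_index R R' no_shift.
Proof.
move=> s k; rewrite addn0; split.
  pose fm x : rat := x m2 + x m1 - x m3.
  pose ft x : rat := fm x + x m3 - x t3.
  pose fu x : rat := ft x + x t1 - x u3.
  have linT : linear_op (triangle_extend ft fm fu).
    by apply: linear_triangle_extend => a x y z h; rewrite /fu /ft /fm !h; ring.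
  apply: (Pos_op linT) => x; have := triangle_extendE ft fm fu x.
  set y := triangle_extend _ _ _ x => -[ey [y1 y2 y3 y4] [y5 y6] [y7 y8 y9]].
  rewrite !balanced_on_cons !balancedX !form_cons !energyE (balanced_on_ext ey) (form_ext ey).
  rewrite y1 y2 y3 y4 y5 y6 y7 y8 y9 /fu /ft /fm => /and4P[/eqP h1 /eqP h2 /eqP h3 ->].
  have e1 : x t2 = x m1 + x m2 - x t1 by move: h1; lra.
  have e2 : x u2 = x t3 + x m1 + x m2 - x t1 - x u1 by move: h2; rewrite e1; lra.
  have e3 : x m3 = x t3 + x m1 - x t1 - x u1 + x u3 by move: h3; rewrite e2; lra.
  rewrite e1 e2 e3; split; first by rewrite andbT; apply/and3P; split; apply/eqP; ring.
  by rewrite le_eqVlt; apply/orP; left; apply/eqP; ring.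
pose fm x : rat := x m2 + x m3 - x m1.
pose ft x : rat := x m1 + fm x - x t1.
pose fu x : rat := ft x + x t3 - x u1.
have linT : linear_op (triangle_extend ft fm fu).
  by apply: linear_triangle_extend => a x y z h; rewrite /fu /ft /fm !h; ring.
apply: (Pos_op linT) => x; have := triangle_extendE ft fm fu x.
set y := triangle_extend _ _ _ x => -[ey [y1 y2 y3 y4] [y5 y6] [y7 y8 y9]].
rewrite !balanced_on_cons !balancedX !form_cons !energyE (balanced_on_ext ey) (form_ext ey).
rewrite y1 y2 y3 y4 y5 y6 y7 y8 y9 /fu /ft /fm => /and4P[/eqP h1 /eqP h2 /eqP h3 ->].
have e1 : x t2 = x m2 + x m3 - x t3 by move: h1; lra.
have e2 : x u2 = x m2 + x m3 - x t3 + x t1 - x u3 by move: h2; rewrite e1; lra.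
have e3 : x m1 = x u1 + x m3 - x t3 + x t1 - x u3 by move: h3; rewrite e2; lra.
rewrite e1 e2 e3; split; first by rewrite andbT; apply/and3P; split; apply/eqP; ring.
by rewrite le_eqVlt; apply/orP; left; apply/eqP; ring.
Qed.

End TriangleIndex.

Local Close Scope ring_scope.

(** * The signature bound *)

(* k - l - writhe is twice the signature (up to sign) of a knot with diagram D, *)
(* when k and l are the numbers of squares of sign s and ~~ s of the form.      *)
Definition excess (s : bool) (D : diagram) (m : nat) : Prop :=
  exists OD k l, [/\ map fst OD = D, oriented OD, Pos s D k, ~ Pos (~~ s) D l.+1
    & l + crossings s OD + m <= k + crossings (~~ s) OD].

(** With [d] counting crossings and [d'] squares: the writhe and the signature of the form change by
    the same amount. *)
Definition even_shift (d d' : bool -> nat) : Prop := d true + d' false = d false + d' true.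

Lemma excess_shift s D D' d d' m :
  orients D D' no_shift d -> same_index D D' d' -> even_shift d d' ->
  excess s D m -> excess s D' m.
Proof.
move=> oD iD ev [OD [k [l [e o pk nl le]]]].
have [OD' [e' o' c']] := oD OD e o.
exists OD', (k + d' s), (l + d' (~~ s)); split=> //; first by apply/iD.
  by rewrite -addSn => /iD.
by move: (c' s) (c' (~~ s)) ev le; rewrite /no_shift /even_shift; case: s {pk nl c'} => /=; lia.
Qed.

Lemma excess_unshift s D D' d d' m :
  orients D' D d no_shift -> same_index D D' d' -> even_shift d d' ->
  excess s D' m -> excess s D m.
Proof.
move=> oD iD ev [OD' [k [l [e o pk nl le]]]].
have [OD [e' o' c']] := oD OD' e o.
(* The squares that [same_index] adds exist in [D'] whatever [D] is, so [l] counts them and the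
   subtraction below does not truncate. *)
have dl : d' (~~ s) <= l.
  rewrite leqNgt; apply/negP => lt; apply: nl; apply: (Pos_le lt).
  by rewrite -[X in Pos _ _ X]add0n; apply/iD; apply: Pos0.
exists OD, (k - d' s), (l - d' (~~ s)); split=> //.
- case: (leqP (d' s) k) => h; first by apply/iD; rewrite subnK.
  by move/ltnW: h; rewrite -subn_eq0 => /eqP->; apply: Pos0.
- by move=> /iD; rewrite addSn subnK.
by move: (c' s) (c' (~~ s)) ev le; rewrite /no_shift /even_shift; case: s {pk nl c'} dl => /=; lia.
Qed.

Lemma excess_equiv s D D' d d' m :
  orients D D' no_shift d -> orients D' D d no_shift -> same_index D D' d' ->
  even_shift d d' -> excess s D m <-> excess s D' m.
Proof. by move=> h1 h2 h3 h4; split; [apply: excess_shift h4 | apply: excess_unshift h4]. Qed.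

Lemma excess_move s D D' m : is_knot_diagram D -> is_knot_diagram D' ->
  move D D' -> excess s D m <-> excess s D' m.
Proof.
move=> + + mv; case: mv => {D D'}.
- move=> D D' p _ _; apply: (@excess_equiv _ _ _ no_shift no_shift) => //.
  + exact: orients_perm.
  + by apply: orients_perm; rewrite perm_sym.
  + exact: same_index_perm.
- move=> f D fI _ _; apply: (@excess_equiv _ _ _ no_shift no_shift) => //.
  + exact: orients_relabel.
  (* [g] inverts [f] on the labels of [D], the only place where [f] is injective. *)
  + pose g m := nth 0 (flatten D) (index m (map f (flatten D))).
    have -> : orients (map (map f) D) D = orients (map (map f) D) (map (map g) (map (map f) D)).
      congr orients; rewrite -map_comp -[LHS]map_id; apply/eq_in_map => v vD /=.
      rewrite -map_comp -[LHS]map_id; apply/eq_in_map => n nv /=.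
      have nD : n \in flatten D by apply/flattenP; exists v.
      apply: fI => //; first by apply: mem_nth; rewrite -(size_map f) index_mem map_f.
      rewrite -(nth_map _ (f 0)); last by rewrite -(size_map f) index_mem map_f.
      by rewrite nth_index // map_f.
    exact: orients_relabel.
  + exact: same_index_relabel.
- move=> a b c d C _ _; apply: (@excess_equiv _ _ _ no_shift no_shift) => //.
  + exact: orients_rotX.
  + exact: orients_rotX.
  + exact: same_index_rotX.
- move=> a b C _ _; apply: (@excess_equiv _ _ _ no_shift no_shift) => //.
  + exact: orients_rotP.
  + exact: orients_rotP.
  + exact: same_index_rotP.
- move=> a b C ab k _; apply: (@excess_equiv _ _ _ no_shift no_shift) => //.
  + exact: orients_erase.
  + exact: orients_unerase.
  + exact: same_index_erase.
- move=> e a b C k _; apply: iff_sym.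
  apply: (@excess_equiv _ _ _ nat_of_bool nat_of_bool) => //.
  + exact: orients_R1l'.
  + exact: orients_R1l.
  + exact: same_index_R1l.
- move=> e a b C k _; apply: iff_sym.
  apply: (@excess_equiv _ _ _ neg_shift neg_shift) => //.
  + exact: orients_R1r'.
  + exact: orients_R1r.
  + exact: same_index_R1r.
- move=> a b c d e f C k _; apply: iff_sym.
  have [h|h] := same_index_R2 k.
    by apply: (@excess_equiv _ _ _ one_shift one_shift) => //;
      [apply: orients_R2' | apply: orients_R2].
  by apply: (@excess_equiv _ _ _ one_shift no_shift) => //;
    [apply: orients_R2' | apply: orients_R2].
- move=> t1 t2 t3 m1 m2 m3 u1 u2 u3 C k _.
  have fr : triangle_fresh t1 t2 t3 m1 m2 m3 u1 u2 u3 C.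
    by apply: triangle_freshP k _; apply/permP => Q /=; bits_lia.
  apply: (@excess_equiv _ _ _ no_shift no_shift) => //.
  + exact: orients_R3l.
  + exact: orients_R3l'.
  + exact: same_index_R3l.
- move=> t1 t2 t3 m1 m2 m3 u1 u2 u3 C k _.
  have fr : triangle_fresh t1 t2 t3 m1 m2 m3 u1 u2 u3 C.
    by apply: triangle_freshP k _; apply/permP => Q /=; bits_lia.
  apply: (@excess_equiv _ _ _ no_shift no_shift) => //.
  + exact: orients_R3r.
  + exact: orients_R3r'.
  + exact: same_index_R3r.
Qed.

Lemma excess_isotopic s D D' m : isotopic D D' -> excess s D m <-> excess s D' m.
Proof.
elim=> {D D'} [D D' [k k' mv] | D | D D' _ | D1 D2 D3 _ h1 _ h2].
- exact: excess_move.
- by [].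
- exact: iff_sym.
- exact: iff_trans h1 h2.
Qed.

Lemma excess_unknot s m : excess s unknot m -> m = 0.
Proof.
case=> OD [k [l [e _ [F [_ _ pF]] _ le]]].
have k0 : k = 0.
  case: k F pF {le} => // k F pF; have /pF : delta_mx ord0 ord0 != 0%R :> 'rV[rat]_k.+1.
    apply/eqP => /matrixP/(_ ord0 ord0); rewrite !mxE eqxx /= => /eqP.
    by rewrite oner_eq0.
  by rewrite /form big_seq1 mulr0 ltxx.
case: OD e le => [//|[v [p q]] [|//]] [->]; rewrite k0 /crossings /=; lia.
Qed.

(** On the hyperplane [x a = x c] the crossing has no energy before or after the change, so [k]
    drops and [l] grows by one at most; the writhe changes by 2. *)
Lemma excess_crossing_change s D D' m :
  crossing_change D D' -> excess s D (m + 4) -> excess s D' m.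
Proof.
case=> a b c d C [[|[v [p q]] OC] [k [l [e o pk nl le]]]] //; case: e => ev eC.
rewrite ev in o le; exists ((X b c d a, (q, ~~ p)) :: OC), k.-1, l.+1; split.
- by rewrite /= eC.
- move/orientedP: o => o; apply/orientedP => x; have := o x; rewrite /ins /outs /=.
  by case: (p); case: (q) => /=; lia.
- case: k pk {le} => [_|k pk]; first exact: Pos0.
  apply: (@Pos_cut _ _ _ _ a c) pk => x; rewrite !balanced_on_cons !balancedX !form_cons !energyE.
  move=> /andP[/eqP h ->] ac; rewrite ac subrr mul0r mulr0; split=> //; rewrite andbT.
  by rewrite -h ac.
- move=> h; apply: nl; apply: (@Pos_cut _ _ _ _ a c) h => x.
  rewrite !balanced_on_cons !balancedX !form_cons !energyE.
  move=> /andP[/eqP h ->] ac; rewrite ac subrr mul0r mulr0; split=> //; rewrite andbT.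
  by rewrite h ac.
- by move: le; rewrite /crossings /=; case: (s); case: (p); case: (q) => /=; lia.
Qed.

Lemma unknots_in_excess s D n m : unknots_in D n -> excess s D m -> m <= 4 * n.
Proof.
move=> u; elim: u m => {D n} [D iso | D D1 D2 n iso c _ IH] m ex.
  by rewrite (@excess_unknot s m) //; apply/(excess_isotopic _ _ iso).
case: (leqP 4 m) => h; last by lia.
have := IH (m - 4); rewrite mulnS; suff ex' : excess s D2 (m - 4) by move=> /(_ ex'); lia.
apply: excess_crossing_change c _; rewrite subnK //.
exact/(excess_isotopic _ _ iso).
Qed.

(** * Mirror images, and the lower bounds for the trefoil and 10_6 *)

Lemma mirror_form D x : is_knot_diagram D ->
  balanced_on (mirror D) x = balanced_on D x /\ form (mirror D) x = (- form D x)%R.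
Proof.
case/and4P=> sz _ _ _; elim: D sz => [|v D IH]; first by rewrite /form !big_nil oppr0.
move=> /andP[sv /IH[h1 h2]]; rewrite mirror_cons !balanced_on_cons !form_cons h1 h2 opprD.
case: v sv => [|a [|b [|c [|d [|? ?]]]]] //= _; split=> //; rewrite ?oppr0 //.
  by rewrite eq_sym addrC.
by congr (_ - _)%R; ring.
Qed.

Lemma Pos_mirror s D k : is_knot_diagram D -> Pos s D k <-> Pos (~~ s) (mirror D) k.
Proof.
move=> kD; have e x : (sg (~~ s) * form (mirror D) x = sg s * form D x)%R.
  by rewrite (mirror_form x kD).2; case: s; rewrite /sg /=; ring.
split=> -[F [lF bF pF]]; exists F; split=> //.
- by move=> u; rewrite (mirror_form _ kD).1.
- by move=> u /pF; rewrite e.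
- by move=> u; rewrite -(mirror_form _ kD).1.
- by move=> u /pF; rewrite e.
Qed.

Lemma excess_mirror s D m : is_knot_diagram D -> excess s D m -> excess (~~ s) (mirror D) m.
Proof.
move=> kD [OD [k [l [e o pk nl le]]]].
pose g (w : overtex) : overtex :=
  if size w.1 == 4 then (rot 1 w.1, (w.2.2, ~~ w.2.1)) else w.
have cr t : crossings (~~ t) (map g OD) = crossings t OD.
  rewrite /crossings count_map; apply: eq_count => -[v [p q]]; rewrite /= /g /=.
  case: ifP => h /=; last by rewrite h.
  by rewrite size_rot h; case: p; case: q; case: t.
exists (map g OD), k, l; split.
- by rewrite -e /mirror -!map_comp; apply: eq_map => -[v [p q]] /=; rewrite /g /=; case: ifP.
- move/orientedP: o => o; apply/orientedP => x; have := o x.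
  suff [-> ->] : count_mem x (ins (map g OD)) = count_mem x (ins OD) /\
                 count_mem x (outs (map g OD)) = count_mem x (outs OD) by [].
  elim: (OD) => // -[v [p q]] E; rewrite /ins /outs /= !count_cat => -[-> ->].
  suff [-> ->] : count_mem x (flow_in (g (v, (p, q)))) = count_mem x (flow_in (v, (p, q))) /\
    count_mem x (flow_out (g (v, (p, q)))) = count_mem x (flow_out (v, (p, q))) by [].
  by rewrite /g /=; case: v => [|a [|b [|c [|d [|? ?]]]]] //=; case: p; case: q => /=; split; lia.
- exact/(Pos_mirror _ _ kD).
- by move=> h; apply: nl; apply/(Pos_mirror _ _ kD).
- by rewrite !cr.
Qed.

Lemma Pos_bound s D (ps : seq (nat * nat)) :
  (forall x, balanced_on D x -> all (fun p => x p.1 == x p.2) ps ->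
     (sg s * form D x <= 0)%R) -> ~ Pos s D (size ps).+1.
Proof.
move=> h [F [linF bF pF]]; pose pr i := nth (0, 0) ps i.
pose A : 'M[rat]_((size ps).+1, size ps) :=
  (\matrix_(i, j) (F (delta_mx ord0 i) (pr j).1 - F (delta_mx ord0 i) (pr j).2))%R.
have [u u0 uA] := kernel_exists A (ltnSn _).
have := pF u u0; rewrite ltNge h //; apply/(all_nthP (0, 0)) => i ip.
rewrite -subr_eq0 !(additive_family_sum u _ linF) -sumrB; apply/eqP.
have /matrixP/(_ ord0 (Ordinal ip)) := uA; rewrite !mxE => uA0.
by apply: etrans uA0; apply: eq_bigr => j _; rewrite mxE mulrBr.
Qed.

(* The labelings constant around each white face, where face n is the white face *)
(* along the edge n of an alternating diagram; face k gets the value 0.          *)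
Lemma Pos_faces D k (face : seq nat) (f := nth 0 face) :
  all (fun v : seq nat => if v is [:: a; b; c; d] then (f b == f c) && (f a == f d) else false) D ->
  (forall g : nat -> rat, g k = 0%R ->
    all (fun v : seq nat => if v is [:: a; b; c; d] then g (f a) == g (f c) else true) D ->
    forall i, i < k -> g i = 0%R) ->
  Pos false D k.
Proof.
move=> fD conn.
pose g (u : 'rV[rat]_k) (j : nat) : rat := (\sum_i u ord0 i * (j == i :> nat)%:R)%R.
have gE u (i : 'I_k) : g u i = u ord0 i.
  rewrite /g (bigD1 i) //= eqxx mulr1 big1 ?addr0 // => j ji.
  have -> : (i == j :> nat) = false by apply/eqP => /val_inj ij; rewrite ij eqxx in ji.
  by rewrite mulr0.
have gk u : g u k = 0%R.
  by rewrite /g big1 // => j _; rewrite gtn_eqF ?mulr0.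
exists (fun u n => g u (f n)); split.
- move=> a u v n; rewrite /g mulr_sumr -big_split; apply: eq_bigr => i _ /=.
  by rewrite !mxE mulrDl mulrA.
- move=> u; apply/allP => v /(allP fD).
  by case: v => [|a [|b [|c [|d [|? ?]]]]] //= /andP[/eqP-> /eqP->]; rewrite addrC.
- move=> u u0.
  pose sq v : rat := if v is [:: a; b; c; d] then ((g u (f a) - g u (f c)) ^+ 2)%R else 0%R.
  have sq0 v : (0 <= sq v)%R.
    by case: v => [|a [|b [|c [|d [|? ?]]]]] //=; apply: sqr_ge0.
  (* As the white corners lie at the same places of all crossings, the squares have one sign: the
     form is minus the Laplacian form of the graph of white faces. The hypothesis [conn] expresses
     that this graph is connected. *)
  have -> : (sg false * form D (fun n => g u (f n)) = \sum_(v <- D) sq v)%R.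
    rewrite /form mulr_sumr big_seq [RHS]big_seq; apply: eq_bigr => v /(allP fD).
    by case: v => [|a [|b [|c [|d [|? ?]]]]] //= /andP[/eqP-> /eqP->]; rewrite /sg; ring.
  rewrite lt0r sumr_ge0 // andbT; apply: contra u0.
  rewrite psumr_eq0 // => /allP all0; apply/eqP/rowP => i; rewrite mxE -gE.
  apply: (conn (g u)) => //; apply/allP => v /all0.
  by case: v => [|a [|b [|c [|d [|? ?]]]]] //=; rewrite sqrf_eq0 subr_eq0.
Qed.

Lemma energy_le0 (x : nat -> rat) a b c d :
  x a = x d -> x b = x c -> (energy x (X a b c d) <= 0)%R.
Proof.
move=> ad bc; rewrite energyE bc ad; have := sqr_ge0 (x c - x d)%R.
by rewrite expr2 => h; rewrite -oppr_ge0 -mulNr opprB.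
Qed.

Lemma trefoil_excess : excess false knot3_1 4.
Proof.
(* One less than the numbers of white faces (three) and black faces (two); all crossings are
   positive. Labels start at 1, so entry 0 of the list of faces is a filler. *)
exists (zip knot3_1 (nseq 3 (false, true))), 2, 1; split=> //.
- apply: (@Pos_faces _ _ [:: 3; 1; 0; 2; 1; 0; 2]) => // g g2 /=.
  by move=> /and4P[/eqP h1 /eqP h2 /eqP h3 _] [|[|//]] _; move: h1 h2 h3; rewrite g2; lra.
- apply: (@Pos_bound _ _ [:: (5, 2)]) => x; rewrite !balanced_on_cons !balancedX /=.
  move=> /and4P[/eqP h1 /eqP h2 /eqP h3 _] /andP[/eqP e1 _].
  have e2 : x 1 = x 4 by move: h1; lra.
  have e3 : x 3 = x 6 by move: h2; lra.
  have n1 := energy_le0 e2 e1; have n2 := energy_le0 e3 e2; have n3 := energy_le0 e1 e3.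
  by rewrite !form_cons /form big_nil /sg; lra.
Qed.

Lemma knot10_6_excess : excess false knot10_6 8.
Proof.
(* Seven white and five black faces; only the two crossings of the last twist region are
   negative. *)
exists (zip knot10_6 (nseq 8 (false, true) ++ nseq 2 (false, false))), 6, 4; split=> //.
- apply: (@Pos_faces _ _
    [:: 7; 0; 5; 0; 5; 6; 0; 5; 0; 5; 4; 3; 2; 1; 0; 6; 5; 4; 3; 2; 1]) => // g g6 /=.
  move=> /and5P[/eqP h1 /eqP h2 /eqP h3 /eqP h4 /and5P[/eqP h5 /eqP h6 /eqP h7 /eqP h8]].
  move=> /and3P[/eqP h9 /eqP h10 _] i; rewrite g6 in h9 h10.
  by do 6 (case: i => [|i]; first by move: h1 h2 h3 h4 h5 h6 h7 h8 h9 h10; lra).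
(* One equation for each black face but one. Together with the equations at the crossings they make
   [x] constant around the white faces, where [energy_le0] applies. *)
- apply: (@Pos_bound _ _ [:: (14, 1); (2, 9); (8, 3); (4, 7)]) => x.
  rewrite !balanced_on_cons !balancedX /=.
  move=> /and5P[/eqP h1 /eqP h2 /eqP h3 /eqP h4 /and5P[/eqP h5 /eqP h6 /eqP h7 /eqP h8]].
  move=> /and3P[/eqP h9 /eqP h10 _] /and5P[/eqP c1 /eqP c2 /eqP c3 /eqP c4 _].
  have e1 : x 20 = x 13 by move: h1; lra.
  have e2 : x 12 = x 19 by move: h2; lra.
  have e3 : x 18 = x 11 by move: h3; lra.
  have e4 : x 10 = x 17 by move: h4; lra.
  have e5 : x 16 = x 9 by move: h5; lra.
  have e6 : x 8 = x 1 by move: h6; lra.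
  have e7 : x 2 = x 7 by move: h7; lra.
  have e8 : x 6 = x 3 by move: h8; lra.
  have e9 : x 14 = x 6 by lra.
  have e10 : x 5 = x 15 by move: h10; lra.
  have e11 : x 4 = x 16 by lra.
  have n1 := energy_le0 e1 c1; have n2 := energy_le0 e2 e1.
  have n3 := energy_le0 e3 e2; have n4 := energy_le0 e4 e3.
  have n5 := energy_le0 e5 e4; have n6 := energy_le0 e6 c2.
  have n7 := energy_le0 e7 c3; have n8 := energy_le0 e8 c4.
  have n9 := energy_le0 e11 (esym e10); have n10 := energy_le0 e9 e10.
  by rewrite !form_cons /form big_nil /sg; lra.
Qed.

Lemma unknots_in_trefoil n : unknots_in knot3_1 n \/ unknots_in (mirror knot3_1) n -> 0 < n.
Proof.
have kT : is_knot_diagram knot3_1 by apply: fast_knotP; vm_compute.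
case=> u; first by have := unknots_in_excess u trefoil_excess; lia.
by have := unknots_in_excess u (excess_mirror kT trefoil_excess); lia.
Qed.

Lemma unknots_in_knot10_6 n : unknots_in knot10_6 n \/ unknots_in (mirror knot10_6) n -> 1 < n.
Proof.
have kK : is_knot_diagram knot10_6 by apply: fast_knotP; vm_compute.
case=> u; first by have := unknots_in_excess u knot10_6_excess; lia.
by have := unknots_in_excess u (excess_mirror kK knot10_6_excess); lia.
Qed.

Local Open Scope ring_scope.

(** * Signatures of connected sums *)

(** In a diagonalization, the hyperplane permits at most one entry of sign [e], and the image of [B]
    forces at least [m] entries of the opposite sign. *)
Lemma signature_bound (e : bool) n m (A : 'M[rat]_n) (s : int)
    (q := fun x : 'rV[rat]_n => sg e * (x *m A *m x^T) 0 0)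
    (c : 'cV[rat]_n) (B : 'M[rat]_(m, n)) :
  form_signature A s ->
  (forall x, x *m c = 0 -> q x <= 0) ->
  (forall w, w != 0 -> q (w *m B) < 0) ->
  m%:Z - 1 <= `|s|.
Proof.
case=> Q [d [Qu QAQ sE]] cP BP.
pose d' i := sg e * d 0 i.
have qQ y : q (y *m Q) = \sum_i d' i * y 0 i ^+ 2.
  rewrite /q trmx_mul !mulmxA -[y *m Q *m A]mulmxA -(mulmxA y) QAQ mxE mulr_sumr.
  by apply: eq_bigr => i _; rewrite mul_mx_diag !mxE /d'; ring.
pose Pset := [set i | 0 < d' i]; pose Nset := [set i | d' i < 0].
have P1 : (#|Pset| <= 1)%N.
  rewrite leqNgt; apply/negP => /card_gt1P[i [j [iP jP ij]]].
  rewrite !inE in iP jP.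
  pose ci := ((delta_mx 0 i : 'rV[rat]_n) *m Q *m c) 0 0.
  pose cj := ((delta_mx 0 j : 'rV[rat]_n) *m Q *m c) 0 0.
  (* Two entries of sign [e] would span a plane, and a plane meets the hyperplane in a nonzero
     vector. *)
  have ex : exists a b : rat, a * ci + b * cj = 0 /\ 0 < a ^+ 2 + b ^+ 2.
    have [ci0|cin0] := eqVneq ci 0.
      by exists 1, 0; rewrite ci0 mulr0 mul0r addr0 expr1n expr0n addr0.
    exists cj, (- ci); split; first by ring.
    by rewrite sqrrN ltr_wpDl ?sqr_ge0 // exprn_even_gt0.
  case: ex => a [b [ab0 ab1]].
  pose y : 'rV[rat]_n := a *: delta_mx 0 i + b *: delta_mx 0 j.
  have /cP : y *m Q *m c = 0.
    apply/matrixP => i' j'; rewrite (ord1 i') (ord1 j') /y !mulmxDl -!scalemxAl.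
    by rewrite [LHS]mxE; do 2 rewrite [(_ *: (_ *m _)) _ _]mxE; rewrite -/ci -/cj ab0 mxE.
  rewrite qQ; apply/negP; rewrite -ltNge (bigD1 i) //= (bigD1 j) ?(eq_sym j) //=.
  rewrite big1 => [|k /andP[ki kj]]; last first.
    by rewrite !mxE (negPf ki) (negPf kj) !andbF !mulr0.
  rewrite !mxE !eqxx (negPf ij) (eq_sym j) (negPf ij) !andbF !mulr0 !mulr1 !addr0 add0r.
  have [a0|an0] := eqVneq a 0.
    have b0 : b != 0 by apply: contraTneq ab1 => ->; rewrite a0 expr0n addr0 ltxx.
    by rewrite a0 expr0n mulr0 add0r mulr_gt0 // exprn_even_gt0.
  apply: ltr_wpDr; first by rewrite mulr_ge0 ?sqr_ge0 // ltW.
  by apply: mulr_gt0 => //; rewrite exprn_even_gt0.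
have N4 : (m <= #|Nset|)%N.
  rewrite leqNgt; apply/negP => N4.
  (* With fewer than [m] such entries, some nonzero [w] has vanishing coordinates on all of them. *)
  pose M : 'M[rat]_(m, #|Nset|) := \matrix_(i, j) (B *m invmx Q) i (enum_val j).
  have [w w0 wN] := kernel_exists M N4.
  have := BP w w0; rewrite -(mulmxKV Qu (w *m B)) qQ => lt0.
  suff : 0 <= \sum_i d' i * (w *m B *m invmx Q) 0 i ^+ 2 by rewrite leNgt lt0.
  apply: sumr_ge0 => k _; have [kN|/negPf kN] := boolP (k \in Nset); last first.
    by rewrite mulr_ge0 ?sqr_ge0 // leNgt; move: kN; rewrite inE => ->.
  have /matrixP/(_ 0 (enum_rank_in kN k)) := wN; rewrite [LHS]mxE [RHS]mxE => h.
  suff -> : (w *m B *m invmx Q) 0 k = 0 by rewrite expr0n mulr0.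
  rewrite -mulmxA mxE -[RHS]h; apply: eq_bigr => j _.
  by rewrite [in RHS]mxE enum_rankK_in.
have sgzd i : sgz (d' i) = sgz (sg e) * sgz (d 0 i) by rewrite /d' sgzM.
have : sgz (sg e) * s = #|Pset|%:Z - #|Nset|%:Z.
  rewrite sE mulr_sumr -!sum1_card -!natz !natr_sum.
  rewrite (big_mkcond (mem Pset)) (big_mkcond (mem Nset)) -sumrB; apply: eq_bigr => i _.
  by rewrite -sgzd !inE; case: sgzP.
by move: P1 N4; case: (e); rewrite /sg ?sgzN sgz1 ?mul1r ?mulN1r; lia.
Qed.

Section SeifertForm.

Variable D : diagram.

Definition face_value (x : 'rV[rat]_(size (faces D))) (k : nat) : rat :=
  \sum_i x 0 i * (nth 0%N (faces D) i == corner_face D k)%:R.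

Definition seifert_sum (X : nat -> rat) : rat :=
  \sum_(k <- north_corners D)
    (X k - X (turn D 2 k)) *
    (X (turn D 1 k) - X (if positive_crossing D k then k else turn D 2 k)).

(** A vector indexed by the faces becomes a function on corners, and the double sum over faces
    factors at each crossing. This frees the computation from the list of faces, which differs from
    sum to sum. *)
Lemma seifert_quadratic x :
  (x *m (seifert_matrix D + (seifert_matrix D)^T) *m x^T) 0 0 =
  2 * seifert_sum (face_value x).
Proof.
set V := seifert_matrix D.
have -> : (x *m (V + V^T) *m x^T) 0 0 = 2 * (x *m V *m x^T) 0 0.
  have e : (x *m V^T *m x^T) 0 0 = (x *m V *m x^T) 0 0.
    have -> : x *m V^T *m x^T = (x *m V *m x^T)^T by rewrite !trmx_mul trmxK mulmxA.
    by rewrite mxE.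
  by rewrite mulmxDr mulmxDl mxE e; ring.
congr (_ * _); rewrite mxE /seifert_sum.
transitivity (\sum_j \sum_i \sum_(k <- north_corners D)
  (x 0 i * ((nth 0%N (faces D) i == corner_face D k)%:R -
            (nth 0%N (faces D) i == corner_face D (turn D 2 k))%:R)) *
  (x 0 j * ((nth 0%N (faces D) j == corner_face D (turn D 1 k))%:R -
            (nth 0%N (faces D) j ==
               corner_face D (if positive_crossing D k then k else turn D 2 k))%:R))).
  apply: eq_bigr => j _; rewrite !mxE mulr_suml; apply: eq_bigr => i _.
  rewrite mxE /seifert_form rmorph_sum /= mulr_sumr mulr_suml; apply: eq_bigr => k _.
  rewrite rmorphM !rmorphB /= !rmorph_nat.
  rewrite -(fun_if (corner_face D)) ![corner_face D _ == _]eq_sym.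
  by ring.
transitivity (\sum_(k <- north_corners D) \sum_j \sum_i
  (x 0 i * ((nth 0%N (faces D) i == corner_face D k)%:R -
            (nth 0%N (faces D) i == corner_face D (turn D 2 k))%:R)) *
  (x 0 j * ((nth 0%N (faces D) j == corner_face D (turn D 1 k))%:R -
            (nth 0%N (faces D) j ==
               corner_face D (if positive_crossing D k then k else turn D 2 k))%:R))).
  by rewrite [RHS]exchange_big; apply: eq_bigr => j _; rewrite exchange_big.
apply: eq_bigr => k _; rewrite /face_value -!sumrB.
rewrite mulr_sumr; apply: eq_bigr => j _; rewrite -mulrBr.
by rewrite mulr_suml; apply: eq_bigr => i _; rewrite -mulrBr.
Qed.

Hypothesis pairD : all (fun e => count_mem e (flatten D) == 2%N) (flatten D).

Lemma stable_face_next : stable (nhalf D) (face_next D).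
Proof. exact: (stable_next pairD leq_pred). Qed.

Lemma corner_face_in k : (k < nhalf D)%N -> corner_face D k \in faces D.
Proof.
move=> kn; have fP := stable_face_next.
by rewrite mem_minreps minrep_lt //= minrep_idem.
Qed.

(** Here [signature_bound] is read on functions of faces: the hyperplane equates the values at [p1]
    and [p2], and the definite space is spanned by the indicators of the faces in [fam]. *)
Lemma signature_by_faces (e : bool) (s : int) (p1 p2 : nat) (fam : seq nat) :
  (p1 < nhalf D)%N -> (p2 < nhalf D)%N -> all (fun k => k < nhalf D)%N fam ->
  knot_signature D s ->
  (forall X : nat -> rat, (forall j k, corner_face D j = corner_face D k -> X j = X k) ->
     X p1 = X p2 -> sg e * seifert_sum X <= 0) ->
  (forall w : 'I_(size fam) -> rat, (exists i, w i != 0) ->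
     sg e * seifert_sum (fun k =>
       \sum_i w i * (corner_face D (nth 0%N fam i) == corner_face D k)%:R) < 0) ->
  (size fam)%:Z - 1 <= `|s|.
Proof.
move=> p1n p2n famP sD nonpos neg.
pose B : 'M[rat]_(size fam, size (faces D)) :=
  \matrix_(i, j) (nth 0%N (faces D) j == corner_face D (nth 0%N fam i))%:R.
pose c : 'cV[rat]_(size (faces D)) := \col_i
  ((nth 0%N (faces D) i == corner_face D p1)%:R -
   (nth 0%N (faces D) i == corner_face D p2)%:R).
apply: (@signature_bound e _ _ _ s c B sD) => [x xc|w w0].
  rewrite seifert_quadratic mulrCA pmulr_rle0 //; apply: nonpos => [j k e'|].
    by rewrite /face_value e'.
  apply/eqP; rewrite -subr_eq0 /face_value -sumrB; apply/eqP.
  have /matrixP/(_ 0 0) := xc; rewrite !mxE => xc0; rewrite -[RHS]xc0.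
  by apply: eq_bigr => i _; rewrite mxE mulrBr.
rewrite seifert_quadratic mulrCA pmulr_rlt0 //.
have val k : face_value (w *m B) k =
    \sum_i w 0 i * (corner_face D (nth 0%N fam i) == corner_face D k)%:R.
  rewrite /face_value; under eq_bigr => i _ do rewrite mxE mulr_suml.
  rewrite exchange_big; apply: eq_bigr => j _; under eq_bigr => i _ do rewrite -mulrA.
  rewrite -mulr_sumr; congr (_ * _).
  have fin : corner_face D (nth 0%N fam j) \in faces D.
    by apply: corner_face_in; apply: (allP famP); rewrite mem_nth.
  move: (fin); rewrite -index_mem => lt.
  rewrite (bigD1 (Ordinal lt)) //= mxE /= nth_index // eqxx mul1r big1 ?addr0 //.
  move=> i ij; rewrite mxE.
  case: (nth 0%N (faces D) i =P corner_face D _) => [e'|_]; last by rewrite mul0r.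
  case/eqP: ij; apply/val_inj => /=; rewrite -e' index_uniq //.
  by rewrite filter_uniq ?iota_uniq.
have -> : seifert_sum (face_value (w *m B)) = seifert_sum (fun k =>
    \sum_i w 0 i * (corner_face D (nth 0%N fam i) == corner_face D k)%:R).
  by apply: eq_bigr => k _; rewrite !val.
apply: neg; apply/existsP; apply: contraT; rewrite negb_exists => /forallP h.
case/eqP: w0; apply/matrixP => i j; rewrite (ord1 i) mxE.
by have := h j; rewrite negbK => /eqP.
Qed.

End SeifertForm.

(* The sums of knots whose signatures have equal signs *)
Local Close Scope ring_scope.

(* The half-edges 0, ..., 11 of the sum are those of the trefoil and 12, ..., 51 *)
(* those of 10_6. [rep] lists representatives of their faces in the summands,    *)
(* and [fam] some faces of 10_6. Looking 15 steps ahead is enough for [r] to     *)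
(* separate the faces of the sum: by the third test it is constant on each.      *)
Definition sum_check (norths : seq (seq nat)) (rep fam : seq nat) (D : diagram) : bool :=
  let n := nhalf D in
  let m := mates D in
  let next := map (nth 0 (turn_table predn 0 D)) m in
  let straight := map (nth 0 (turn_table half 0 D)) m in
  let out := traject (nth 0 straight) 0 n in
  let left := turn_table (fun=> 1) 0 D in
  let r := [seq foldr minn k (traject (nth 0 next) k 15) | k <- iota 0 n] in
  [&& shape D == nseq 13 4, paired D,
      all (fun k => nth 0 r (nth 0 next k) == nth 0 r k) (iota 0 n),
      [seq k <- iota 0 n | (k \in out) && (nth 0 left k \in out)] \in norths,
      all (fun k => nth 0 r (nth 0 rep k) == nth 0 r k) (iota 0 n)
    & all (fun j => all (fun k => (nth 0 r j == nth 0 r k) == (j == nth 0 rep k))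
        (iota 12 40)) fam].

Definition all_sums (A B : diagram) (P : diagram -> bool) : bool :=
  all (fun i => all (fun j => P (csum A i B j)) (iota 0 (nhalf B))) (iota 0 (nhalf A)).

(* The two relative orientations of the summands. *)
Definition sum_norths : seq (seq nat) :=
  [:: [:: 3; 7; 11; 15; 19; 23; 27; 31; 35; 39; 43; 44; 48];
      [:: 3; 7; 11; 13; 17; 21; 25; 29; 33; 37; 41; 46; 50]].

Definition sum_reps : seq nat :=
  [:: 0; 1; 2; 3; 0; 3; 2; 7; 0; 7; 2; 1; 12; 13; 14; 15; 12; 15; 14;
      19; 12; 19; 14; 23; 12; 23; 14; 27; 12; 27; 14; 31; 32; 31; 14;
      13; 32; 13; 38; 31; 40; 31; 38; 13; 40; 45; 12; 31; 12; 45; 40; 13].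

(* The primed data are those of the sum of the mirror images. *)
Definition sum_norths' : seq (seq nat) :=
  [:: [:: 0; 4; 8; 12; 16; 20; 24; 28; 32; 36; 40; 45; 49];
      [:: 0; 4; 8; 14; 18; 22; 26; 30; 34; 38; 42; 47; 51]].

Definition sum_reps' : seq nat :=
  [:: 0; 1; 2; 3; 2; 1; 6; 3; 6; 1; 0; 3; 12; 13; 14; 15; 14; 13; 18;
      15; 18; 13; 22; 15; 22; 13; 26; 15; 26; 13; 30; 15; 30; 13; 12;
      35; 12; 37; 30; 35; 30; 37; 12; 43; 44; 15; 30; 43; 44; 43; 12; 15].

Definition sum_family := [:: 15; 19; 23; 27; 31].
Definition sum_family' := [:: 14; 18; 22; 26; 30].

Lemma sums_checked :
  all_sums knot3_1 knot10_6 (sum_check sum_norths sum_reps sum_family).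
Proof. by vm_compute. Qed.

Lemma sums_checked' :
  all_sums (mirror knot3_1) (mirror knot10_6) (sum_check sum_norths' sum_reps' sum_family').
Proof. by vm_compute. Qed.

Lemma all_sumsP A B P h1 h2 : all_sums A B P -> h1 < nhalf A -> h2 < nhalf B ->
  P (csum A h1 B h2).
Proof.
by move=> /allP h h1A h2B; apply: (allP (h h1 _)); rewrite mem_iota.
Qed.

Lemma orbit_iter_eq n f k g : (forall i, i < n -> g i = f i) -> stable n f -> k < n ->
  forall i, iter i g k = iter i f k.
Proof. by move=> gf fP kn; elim=> //= i ->; rewrite gf // iter_lt. Qed.

Lemma sum_checkP norths rep fam D : sum_check norths rep fam D ->
  [/\ shape D = nseq 13 4,
      all (fun e => count_mem e (flatten D) == 2) (flatten D),
      north_corners D \in norths,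
      forall k, k < nhalf D -> nth 0 rep k < nhalf D ->
        corner_face D (nth 0 rep k) = corner_face D k
    & forall j k, j \in fam -> j < nhalf D -> 12 <= k < 52 -> k < nhalf D ->
        (corner_face D j == corner_face D k) = (j == nth 0 rep k)].
Proof.
rewrite /sum_check; set m := mates D; set next := map _ m; set straight := map _ m.
set out := traject _ _ _; set left := turn_table _ _ D; set r := map _ _.
case/and5P=> /eqP shD /pairedP[mD pairD] /allP rD nD /andP[/allP repD /allP famD].
have nextE k : k < nhalf D -> nth 0 next k = face_next D k.
  move=> kn; rewrite (nth_map 0) ?size_mkseq // nth_mates // nth_turn_table //.
  exact: mD.
have straightE k : k < nhalf D -> nth 0 straight k = strand_next D k.
  move=> kn; rewrite (nth_map 0) ?size_mkseq // nth_mates // nth_turn_table //.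
  exact: mD.
have fP := stable_face_next pairD.
have rE k : k < nhalf D -> nth 0 r k = foldr minn k (traject (nth 0 next) k 15).
  by move=> kn; rewrite (nth_map 0) ?size_iota // nth_iota.
have r_iter k i : k < nhalf D -> nth 0 r (iter i (face_next D) k) = nth 0 r k.
  move=> kn; elim: i => //= i IH; have ki := iter_lt fP i kn.
  by rewrite -nextE // -IH; apply/eqP/rD; rewrite mem_iota.
have r_in k : k < nhalf D -> exists i, nth 0 r k = iter i (face_next D) k.
  move=> kn; rewrite rE //; have := foldr_minn_mem k (traject (nth 0 next) k 15).
  rewrite inE => /predU1P[->|/trajectP[i _ ->]]; first by exists 0.
  by exists i; apply: orbit_iter_eq kn _.
have faceE j k : j < nhalf D -> k < nhalf D ->
    (corner_face D j == corner_face D k) = (nth 0 r j == nth 0 r k).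
  move=> jn kn; apply/eqP/eqP => e; last first.
    have [[a ea] [b eb]] := (r_in j jn, r_in k kn).
    rewrite /corner_face /orbit_rep -!/(minrep _ _ _).
    by rewrite -(minrep_orbit fP a jn) -(minrep_orbit fP b kn) -ea -eb e.
  have [a ea] := minrep_iter (nhalf D) (face_next D) j.
  have [b eb] := minrep_iter (nhalf D) (face_next D) k.
  by rewrite -(r_iter j a) // -(r_iter k b) // -ea -eb; congr nth.
split=> //.
- suff -> : north_corners D = [seq k <- iota 0 (nhalf D) | (k \in out) && (nth 0 left k \in out)] by [].
  have valD k : k < nhalf D -> valence D k = 4.
    move=> kn; have /reshape_indexP : k < sumn (shape D) by rewrite -size_flatten.
    by rewrite /valence shD size_nseq nth_nseq => ->.
  have outE k : outgoing D k = (k \in out).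
    rewrite /outgoing /out; congr (k \in _).
    apply: (@eq_from_nth _ 0); rewrite !size_traject // => i ilt.
    rewrite !nth_traject //; apply/esym; apply: (@orbit_iter_eq (nhalf D)) => //.
      exact: (stable_next pairD half_le).
    by apply: leq_ltn_trans ilt.
  apply: eq_in_filter => k; rewrite mem_iota => kn.
  by rewrite valD // eqxx /= !outE nth_turn_table.
- move=> k kn rn; apply/eqP; rewrite faceE //; apply: repD.
  by rewrite mem_iota.
- move=> j k jf jn k52 kn; rewrite faceE //.
  by have /allP/(_ k) := famD _ jf; rewrite mem_iota => /(_ k52)/eqP.
Qed.

(** [turn] and [positive_crossing] see only the shape, so one dummy diagram with 13 crossings stands
    for all the sums. *)
Definition rep_quads (N rep : seq nat) : seq (nat * nat * (nat * nat)) :=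
  let D := nseq 13 (X 0 0 0 0) in
  [seq (nth 0 rep k, nth 0 rep (turn D 2 k),
        (nth 0 rep (turn D 1 k),
         nth 0 rep (if positive_crossing D k then k else turn D 2 k))) | k <- N].

Local Open Scope ring_scope.

Lemma seifert_sum_reps D N rep (Y : nat -> rat) : shape D = nseq 13 4%N ->
  north_corners D = N -> (forall k, (k < nhalf D)%N -> Y (nth 0%N rep k) = Y k) ->
  seifert_sum D Y = \sum_(q <- rep_quads N rep) (Y q.1.1 - Y q.1.2) * (Y q.2.1 - Y q.2.2).
Proof.
move=> shD <- YE; rewrite /seifert_sum big_map; apply: eq_big_seq => k.
rewrite mem_filter mem_iota => /andP[_ kn] /=.
have shE : shape (nseq 13 (X 0 0 0 0)) = shape D by rewrite shD.
have tE j : turn (nseq 13 (X 0 0 0 0)) j k = turn D j k by rewrite /turn /valence shE.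
rewrite !tE /positive_crossing shE.
have tn j : (turn D j k < nhalf D)%N by have [] := turn_valence j kn.
by rewrite !YE //; case: ifP.
Qed.

(** [a], [b], [c] are the bigons of the trefoil. In 10_6, the face [d] and those of [fam] follow
    each other along the five crossings of the first twist region; the factor 3 comes from the
    second region, whose three crossings all lie between the last face of [fam] and [d]. *)
Definition cyclic_squares (a b c d : nat) (fam : seq nat) (Y : nat -> rat) : rat :=
  let y i := Y (nth 0%N fam i) in
  (Y a - Y b) ^+ 2 + (Y b - Y c) ^+ 2 + (Y c - Y a) ^+ 2 +
  ((Y d - y 0%N) ^+ 2 + (y 0%N - y 1%N) ^+ 2 + (y 1%N - y 2%N) ^+ 2 +
   (y 2%N - y 3%N) ^+ 2 + (y 3%N - y 4%N) ^+ 2 + 3 * (y 4%N - Y d) ^+ 2).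

(** At the last two crossings of 10_6 the north and south faces are those of 12 and 40, so the
    hyperplane removes these terms. Elsewhere the values of the western faces cancel, and summation
    by parts around the cycles turns the rest into half a sum of squares. *)
Lemma sum_form N (Y : nat -> rat) : N \in sum_norths -> Y 40%N = Y 12%N ->
  \sum_(q <- rep_quads N sum_reps) (Y q.1.1 - Y q.1.2) * (Y q.2.1 - Y q.2.2) =
  - cyclic_squares 1 3 7 13 sum_family Y / 2.
Proof.
move=> Nin Y40; rewrite /sum_norths !inE in Nin; case/orP: Nin => /eqP->;
  by set l := rep_quads _ _; vm_compute in l;
     rewrite /l !big_cons big_nil /cyclic_squares /= Y40; field.
Qed.

Lemma sum_form' N (Y : nat -> rat) : N \in sum_norths' -> Y 43%N = Y 15%N ->
  \sum_(q <- rep_quads N sum_reps') (Y q.1.1 - Y q.1.2) * (Y q.2.1 - Y q.2.2) =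
  cyclic_squares 0 2 6 12 sum_family' Y / 2.
Proof.
move=> Nin Y43; rewrite /sum_norths' !inE in Nin; case/orP: Nin => /eqP->;
  by set l := rep_quads _ _; vm_compute in l;
     rewrite /l !big_cons big_nil /cyclic_squares /= Y43; field.
Qed.

Lemma cyclic_squares_ge0 a b c d fam Y : 0 <= cyclic_squares a b c d fam Y.
Proof. by rewrite /cyclic_squares /= !addr_ge0 ?sqr_ge0 // pmulr_rge0 ?sqr_ge0. Qed.

Lemma cyclic_squares_le0 a b c d fam Y : cyclic_squares a b c d fam Y <= 0 ->
  Y d = 0 -> forall i, (i < 5)%N -> Y (nth 0%N fam i) = 0.
Proof.
move=> le0 Yd0; have sq0 (x : rat) : x ^+ 2 <= 0 -> x = 0.
  by move=> h; apply/eqP; rewrite -sqrf_eq0 eq_le h sqr_ge0.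
have eq (x y : nat) : (Y x - Y y) ^+ 2 <= 0 -> Y x = Y y.
  by move/sq0/eqP; rewrite subr_eq0 => /eqP.
rewrite /cyclic_squares in le0.
set y := fun i => Y (nth 0%N fam i).
have h a' b' : 0 <= (Y a' - Y b') ^+ 2 by apply: sqr_ge0.
have := (h a b, h b c, h c a, h d (nth 0 fam 0)%N, h (nth 0 fam 0)%N (nth 0 fam 1)%N,
  h (nth 0 fam 1)%N (nth 0 fam 2)%N, h (nth 0 fam 2)%N (nth 0 fam 3)%N,
  h (nth 0 fam 3)%N (nth 0 fam 4)%N, h (nth 0 fam 4)%N d).
move=> [[[[[[[[h1 h2] h3] h4] h5] h6] h7] h8] h9].
have e0 : Y d = y 0%N by apply: eq; lra.
have e1 : y 0%N = y 1%N by apply: eq; lra.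
have e2 : y 1%N = y 2%N by apply: eq; lra.
have e3 : y 2%N = y 3%N by apply: eq; lra.
have e4 : y 3%N = y 4%N by apply: eq; lra.
by case=> [|[|[|[|[|//]]]]] _; rewrite -/(y _) -?e4 -?e3 -?e2 -?e1 -?e0.
Qed.

(** A face of the sum may consist of faces of both summands, so indicators of faces of 10_6 can be
    nonzero at the trefoil. The squares there are nonnegative anyway: definiteness comes from the
    cycle of 10_6, on which the value at [d] is 0. *)
Lemma sum_signature_ge4 e norths rep fam D a b c d p1 p2 s :
  sum_check norths rep fam D -> size fam = 5%N -> uniq fam ->
  all (fun k => (12 <= k < 52)%N) [:: d, p1, p2 & fam] ->
  all (fun k => nth 0%N rep k < 52)%N (iota 0 52) ->
  all (fun k => nth 0%N rep k == k) fam ->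
  all (fun k => nth 0%N rep k \notin fam) [:: d; p1; p2] ->
  (forall N (Y : nat -> rat), N \in norths -> Y p1 = Y p2 ->
    sg e * \sum_(q <- rep_quads N rep) (Y q.1.1 - Y q.1.2) * (Y q.2.1 - Y q.2.2) =
    - cyclic_squares a b c d fam Y / 2) ->
  knot_signature D s -> 4 <= `|s|.
Proof.
move=> /sum_checkP[shD pairD nD repD famD] sz5 ufam /and4P[dn p1n p2n famn] /allP repn.
move=> /allP repf /and4P[dfam p1fam p2fam _] formE sD.
have n52 : nhalf D = 52%N by rewrite /nhalf size_flatten shD.
rewrite n52 in repD famD.
have {}repD k : (k < 52)%N -> corner_face D (nth 0%N rep k) = corner_face D k.
  by move=> kn; apply: repD => //; apply: repn; rewrite mem_iota.
have lt52 k : (12 <= k < 52)%N -> (k < 52)%N by case/andP.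
have sumE (Y : nat -> rat) :
    (forall j k, corner_face D j = corner_face D k -> Y j = Y k) -> Y p1 = Y p2 ->
    sg e * seifert_sum D Y = - cyclic_squares a b c d fam Y / 2.
  move=> Yc Yp; rewrite -(formE _ _ nD Yp); congr (_ * _); apply: seifert_sum_reps => //.
  by rewrite n52 => k kn; apply/Yc/repD.
have -> : 4 = (size fam)%:Z - 1 by rewrite sz5.
apply: (@signature_by_faces D pairD e s p1 p2 fam).
- by rewrite n52 lt52.
- by rewrite n52 lt52.
- by rewrite n52; apply: sub_all famn => k /lt52.
- exact: sD.
- move=> Y Yc Yp; rewrite sumE //.
  by have := cyclic_squares_ge0 a b c d fam Y; lra.
- move=> w [i0 w0]; set Y := fun k : nat => _.
  have YE k : (12 <= k < 52)%N -> Y k = \sum_i w i * (nth 0%N fam i == nth 0%N rep k)%:R.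
    move=> k52; apply: eq_bigr => i _; congr (_ * _%:R).
    have fi : nth 0%N fam i \in fam by rewrite mem_nth.
    by rewrite (famD _ _ fi (lt52 _ (allP famn _ fi)) k52 (lt52 _ k52)).
  have Y0 k : (12 <= k < 52)%N -> nth 0%N rep k \notin fam -> Y k = 0.
    move=> k52 kf; rewrite YE // big1 // => i _; case: eqP => [e'|]; last by rewrite mulr0.
    by rewrite -e' mem_nth in kf.
  rewrite sumE ?(Y0 p1) ?(Y0 p2) //; last by move=> j k e'; rewrite /Y e'.
  suff : 0 < cyclic_squares a b c d fam Y by lra.
  rewrite ltNge; apply/negP => /cyclic_squares_le0 h; case/eqP: w0.
  have i05 : (i0 < 5)%N by rewrite -[5%N]sz5.
  rewrite -(h (Y0 d dn dfam) i0 i05) YE; last by apply: (allP famn); rewrite mem_nth.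
  rewrite (eqP (repf _ (mem_nth _ _))) // (bigD1 i0) //= eqxx mulr1 big1 ?addr0 //.
  by move=> i ii0; rewrite nth_uniq // (inj_eq val_inj) (negPf ii0) mulr0.
Qed.

Lemma same_sign_sum_signature h1 h2 s : (h1 < 12)%N -> (h2 < 40)%N ->
  knot_signature (csum knot3_1 h1 knot10_6 h2) s -> 4 <= `|s|.
Proof.
move=> h1n h2n; have := all_sumsP sums_checked h1n h2n.
move=> /(@sum_signature_ge4 true _ _ _ _ 1 3 7 13 40 12); apply=> // N Y Nin Yp.
by rewrite mul1r sum_form.
Qed.

Lemma same_sign_sum_signature' h1 h2 s : (h1 < 12)%N -> (h2 < 40)%N ->
  knot_signature (csum (mirror knot3_1) h1 (mirror knot10_6) h2) s -> 4 <= `|s|.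
Proof.
move=> h1n h2n; have := all_sumsP sums_checked' h1n h2n.
move=> /(@sum_signature_ge4 false _ _ _ _ 0 2 6 12 43 15); apply=> // N Y Nin Yp.
by rewrite mulN1r sum_form' // mulNr.
Qed.

(** * Unknotting numbers *)

Lemma unknotting_number_exists D m : unknots_in D m ->
  exists n, unknotting_number D n /\ (n <= m)%N.
Proof.
elim/ltn_ind: m => m IH Dm.
have [[k [km Dk]]|none] := classic (exists k, (k < m)%N /\ unknots_in D k).
  have [n [Dn nk]] := IH k km Dk; exists n; split=> //.
  by apply: leq_trans nk (ltnW km).
exists m; split=> //; split=> // k Dk; rewrite leqNgt; apply/negP => km.
by apply: none; exists k.
Qed.

Theorem theorem1p3 (K1 K2 K3 : diagram) (s : int) :
  K1 = knot3_1 \/ K1 = mirror knot3_1 ->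
  K2 = knot10_6 \/ K2 = mirror knot10_6 ->
  connected_sum K1 K2 K3 ->
  knot_signature K3 s ->
  `|s| = 2 ->
  [/\ unknotting_number K1 1%N,
      exists n : nat, unknotting_number K2 n /\ (n = 2 \/ n = 3)%N
    & exists n : nat, unknotting_number K3 n /\ (n <= 3)%N].
Proof.
move=> K1E K2E [h1 [h2 [h1n h2n ->]]] sig s2.
have K1in : unknots_in K1 1.
  case: K1E => ->; first exact: trefoil_unknots_in1.
  exact/unknots_in_mirror/trefoil_unknots_in1.
have K2in : unknots_in K2 3.
  case: K2E => ->; first exact: knot10_6_unknots_in3.
  exact/unknots_in_mirror/knot10_6_unknots_in3.
split.
- split=> // m Dm; apply: unknots_in_trefoil.
  by case: K1E Dm => ->; [left|right].
- have [n [K2n n3]] := unknotting_number_exists K2in; exists n; split=> //.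
  have : (1 < n)%N by apply: unknots_in_knot10_6; case: K2E K2n => -> []; [left|right].
  by case: n n3 {K2n} => [|[|[|[|n]]]] //; [left|right].
- apply: unknotting_number_exists.
  case: K1E K2E => [K1E|K1E] [K2E|K2E]; subst K1 K2.
  + by have := same_sign_sum_signature h1n h2n sig; rewrite s2.
  + exact: csum_mirror_knot10_6_unknots_in3.
  + exact: csum_mirror_trefoil_unknots_in3.
  + by have := same_sign_sum_signature' h1n h2n sig; rewrite s2.
Qed.
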